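(* Let $l\in\mathbb N$, $s\in\mathbb Z_{\geq0}$ with $s\neq l$, and a sign $\pm$. No left-moving tangency of the boundary curve $\partial L_{s,\pm}$ with the axis $\Lambda_l$ is a generalized simple intersection.
   Context: For $\omega>0$ and $(B,A)\in\mathbb R^2$ consider $\frac{d\varphi}{dt}=-\sin\varphi+B+A\cos\omega t$; with $\tau=\omega t$, $l=B/\omega$, $\mu=A/(2\omega)$ this gives the vector field $\dot\varphi=-\frac{\sin\varphi}{\omega}+l+2\mu\cos\tau$, $\dot\tau=1$ on the torus $\mathbb R^2/2\pi\mathbb Z^2$. The rotation number is $\rho(B,A;\omega)=\lim_{k\to+\infty}\varphi(2\pi k)/(2\pi k)$; for $s\in\mathbb Z$, $L_s(\omega)=\{\rho=s\}$ is the phase-lock area. The Poincaré map $h_{(B,A)}$ is the time-$2\pi$ flow map on $\{\tau=0\}$. $\partial L_{s,\pm}(\omega)$ is the set of points of $L_s(\omega)$ at which $h_{(B,A)}$ fixes $\pm\frac\pi2\pmod{2\pi}$ (an analytic curve; $\partial L_s=\partial L_{s,+}\cup\partial L_{s,-}$). A constriction is a point of some $L_s$ with $A\neq0$ at which $h_{(B,A)}$ is the identity. The axis is $\Lambda_l(\omega)=\{B=l\omega\}$. A generalized simple intersection is a point of $\Lambda_l(\omega)\cap\partial L_s(\omega)$ with $s\equiv l\pmod 2$ that is not a constriction. Left-moving tangency: let $\omega_0>0$, $l\in\mathbb N$, $\mu>0$, $B_0=l\omega_0$, $A_0=2\mu\omega_0$, $s\in\mathbb Z_{\geq0}$, and suppose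 $(B_0,A_0)\in\partial L_{s,\pm}(\omega_0)$, the curve $\partial L_{s,\pm}(\omega_0)$ is tangent to $\Lambda_l(\omega_0)$ at $(B_0,A_0)$, and the germ of $\partial L_{s,\pm}(\omega_0)$ at $(B_0,A_0)$ lies on the right of the line $\Lambda_l(\omega_0)$. Then $(B_0,A_0)$ is called a left-moving tangency (for $\omega=\omega_0$) if there is a neighborhood $U$ of $(B_0,A_0)$ such that for every $\omega>\omega_0$ close enough to $\omega_0$ (depending on $U$) the intersection $\partial L_{s,\pm}(\omega)\cap\Lambda_l(\omega)$ contains no points of $U$. *)

(* Defs.v *)
From Stdlib Require Import Reals ZArith.
From Coquelicot Require Import Coquelicot.
Open Scope R_scope.

(* Right-hand side of the equation in the torus time tau = omega t:
   dphi/dtau = -sin(phi)/omega + l + 2 mu cos tau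
             = (-sin phi + B + A cos tau)/omega,  l = B/omega, mu = A/(2 omega). *)
Definition rhs (om B A phi tau : R) : R := (- sin phi + B + A * cos tau) / om.

Definition is_sol (om B A x : R) (phi : R -> R) : Prop :=
  phi 0 = x /\ forall tau, is_derive phi tau (rhs om B A (phi tau) tau).

Definition cong2pi (a b : R) : Prop := exists k : Z, a = b + 2 * PI * IZR k.

Definition poinc_fixes (om B A x : R) : Prop :=
  forall phi, is_sol om B A x phi -> cong2pi (phi (2 * PI)) x.

Definition rot_num (om B A r : R) : Prop :=
  forall x phi, is_sol om B A x phi ->
    is_lim_seq (fun k : nat => phi (2 * PI * INR k) / (2 * PI * INR k)) r.

Definition phase_lock (om : R) (s : Z) (B A : R) : Prop := rot_num om B A (IZR s).

Definition bdry_sgn (om : R) (s : Z) (sg : bool) (B A : R) : Prop :=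
  phase_lock om s B A /\ poinc_fixes om B A (if sg then PI / 2 else - (PI / 2)).

Definition bdry (om : R) (s : Z) (B A : R) : Prop :=
  bdry_sgn om s true B A \/ bdry_sgn om s false B A.

Definition constriction (om B A : R) : Prop :=
  (exists s : Z, phase_lock om s B A) /\ A <> 0 /\
  forall x, poinc_fixes om B A x.

Definition axis (om : R) (l : Z) (B : R) : Prop := B = IZR l * om.

Definition gen_simple_int (om : R) (l : Z) (B A : R) : Prop :=
  exists s : Z, Z.Even (s - l) /\ axis om l B /\ bdry om s B A /\
    ~ constriction om B A.

(* The set S (a curve in the (B,A)-plane) is tangent at (B0,A0) to the
   vertical line {B = B0}: its tangent cone at (B0,A0) lies in that line. *)
Definition tangent_vert (S : R -> R -> Prop) (B0 A0 : R) : Prop :=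
  forall eps, 0 < eps -> exists del, 0 < del /\
    forall B A, S B A -> Rabs (B - B0) < del -> Rabs (A - A0) < del ->
      Rabs (B - B0) <= eps * Rabs (A - A0).

Definition germ_right (S : R -> R -> Prop) (B0 A0 : R) : Prop :=
  exists del, 0 < del /\
    forall B A, S B A -> Rabs (B - B0) < del -> Rabs (A - A0) < del -> B0 <= B.

(* (B0,A0) is a left-moving tangency of dL_{s,sg} with Lambda_l for omega = om0
   (the standing assumptions on om0, l, mu, s, B0, A0 are hypotheses of the
   theorem). *)
Definition left_moving_tangency (om0 : R) (l s : Z) (sg : bool) (B0 A0 : R) : Prop :=
  bdry_sgn om0 s sg B0 A0 /\
  tangent_vert (bdry_sgn om0 s sg) B0 A0 /\
  germ_right (bdry_sgn om0 s sg) B0 A0 /\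
  exists r, 0 < r /\ exists eps, 0 < eps /\
    forall om, om0 < om < om0 + eps ->
      forall B A, Rabs (B - B0) < r -> Rabs (A - A0) < r ->
        ~ (bdry_sgn om s sg B A /\ axis om l B).

(* Main.v *)
Require Import Defs.
From Stdlib Require Import Reals ZArith Lra Lia Psatz Classical.
From Coquelicot Require Import Coquelicot.
Open Scope R_scope.

(** In the coordinates al = 1/omega, b = B/omega, c = A/omega, with mu = c/2, write
    e = 1 or -1 for the sign of the curve and r = exp(al/2 int cos phi) for the
    amplitude of the associated linear system.  Let phi be the orbit of e pi/2, with
    phi(2 pi) = phi(0) + 2 pi s and s = l mod 2, and put z = exp(i t),
    chi = (l t - phi + e pi/2)/2.  The Fourier coefficients g_k of
    r exp(mu cos t) exp(i chi) satisfy k g_k + mu g_(k+1) = e (al/2) g_(l-k).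

    If g_1 = ... = g_l = 0, changing the sign of the coefficients with k <= 0 gives a
    solution of the recurrence for -e; hence the orbit of -e pi/2 is fixed as well, and
    the point is a constriction.

    Otherwise e_j = g_(l-j) / (j! (l-1-j)!) are the coefficients of a polynomial E of
    degree < l such that exp(mu z) E(z) is proportional to r exp(i (chi + mu sin t)).
    The integral of Im(conj f f') over the circle is positive for a nonconstant f
    holomorphic in the disc, and here it is a positive multiple of int r^2 sin phi.
    So the orbit of e pi/2 moves up when omega increases along the axis.  Moreover, for
    a given al such an E exists for finitely many values of mu only.

    If the germ of the curve lies on the right of the axis, then phi(2 pi) <= phi(0) + 2 pi s
    on the axis near the point for omega = omega_0, with strict inequality somewhere
    arbitrarily close.  For omega slightly above omega_0 both signs of
    phi(2 pi) - phi(0) - 2 pi s occur on the axis near the point, so the curve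
    still meets the axis there. *)

(** * Calculus *)

(** The definitions quantify over all solutions, so a global solution must exist before they say
    anything; [flow] supplies it, and the zero set of its displacement [defect] is the curve in the
    coordinates al, b, c.

    The sign change works because the recurrence links k only with k + 1 and l - k: the vanishing
    block 1, ..., l separates k <= 0 from k > l, and the reflection carries each side into the other
    or into the block. The new coefficients are only known to be O(1/k), so no series is summed:
    symmetric truncations solve a linear system up to two end terms of size O(1/N), enough for a
    Wronskian estimate.

    The weights 1/(j! (l-1-j)!) are chosen so that, on the circle, z E' + mu z E = e (al/2) z^l conj
    E; r exp(-mu cos t) exp(i chi) solves the same real linear system, and both are real at t = 0,
    hence proportional.

    Holomorphy enters only through polynomials: exp(mu z) is replaced by Taylor sums. A limit of
    strict inequalities would lose strictness, so the integral of the squared imaginary part is kept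
    throughout as a lower bound of the area integral. *)

Lemma is_derive_continuity_pt (f : R -> R) (x d : R) :
  is_derive f x d -> continuity_pt f x.
Proof.
  intros H. apply continuity_pt_filterlim, (ex_derive_continuous f).
  now exists d.
Qed.

Lemma deriv_nonpos_le (f df : R -> R) (a b : R) :
  a <= b -> (forall t, a <= t <= b -> is_derive f t (df t)) ->
  (forall t, a <= t <= b -> df t <= 0) -> f b <= f a.
Proof.
  intros Hab Hd Hs.
  destruct (MVT_gen f a b df) as [c [Hc E]].
  - intros x. rewrite Rmin_left, Rmax_right by lra. intros Hx. apply Hd. lra.
  - intros x. rewrite Rmin_left, Rmax_right by lra. intros Hx.
    apply (is_derive_continuity_pt f x (df x)), Hd. lra.
  - rewrite Rmin_left, Rmax_right in Hc by lra.
    specialize (Hs c Hc). nra.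
Qed.

Lemma deriv_zero_eq (f df : R -> R) (a b : R) :
  a <= b -> (forall t, a <= t <= b -> is_derive f t (df t)) ->
  (forall t, a <= t <= b -> df t = 0) -> f b = f a.
Proof.
  intros Hab Hd Hs. apply Rle_antisym.
  - apply (deriv_nonpos_le f df a b Hab Hd). intros t Ht. rewrite (Hs t Ht). lra.
  - cut (- f b <= - f a); [lra|].
    apply (deriv_nonpos_le (fun t => - f t) (fun t => - df t) a b Hab).
    + intros t Ht. auto_derive.
      * exists (df t). now apply Hd.
      * replace (Derive (fun x => f x) t) with (df t); [ring|].
        symmetry. apply is_derive_unique. now apply Hd.
    + intros t Ht. rewrite (Hs t Ht). lra.
Qed.

Lemma deriv_abs_le (f df m dm : R -> R) (a b : R) :
  a <= b -> (forall t, a <= t <= b -> is_derive f t (df t)) ->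
  (forall t, a <= t <= b -> is_derive m t (dm t)) ->
  (forall t, a <= t <= b -> Rabs (df t) <= dm t) ->
  Rabs (f b - f a) <= m b - m a.
Proof.
  intros Hab Hf Hm Hs. apply Rabs_le. split.
  - cut (- f b - m b <= - f a - m a); [lra|].
    apply (deriv_nonpos_le (fun t => - f t - m t) (fun t => - df t - dm t) a b Hab).
    + intros t Ht. apply @is_derive_minus; [|now apply Hm].
      apply @is_derive_opp. now apply Hf.
    + intros t Ht. specialize (Hs t Ht). revert Hs. unfold Rabs. destruct Rcase_abs; lra.
  - cut (f b - m b <= f a - m a); [lra|].
    apply (deriv_nonpos_le (fun t => f t - m t) (fun t => df t - dm t) a b Hab).
    + intros t Ht. apply @is_derive_minus; [now apply Hf|now apply Hm].
    + intros t Ht. specialize (Hs t Ht). revert Hs. unfold Rabs. destruct Rcase_abs; lra.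
Qed.

Lemma deriv_bound_le (f df : R -> R) (M a b : R) :
  a <= b -> (forall t, a <= t <= b -> is_derive f t (df t)) ->
  (forall t, a <= t <= b -> Rabs (df t) <= M) ->
  Rabs (f b - f a) <= M * (b - a).
Proof.
  intros Hab Hf Hs.
  replace (M * (b - a)) with (M * b - M * a) by ring.
  apply (deriv_abs_le f df (fun t => M * t) (fun _ => M) a b Hab Hf); [|exact Hs].
  intros t _. auto_derive; [exact I|ring].
Qed.

(** The function n t exp(- k t) - eta t is nonincreasing, because exp(- k t) <= 1 on the
    interval. *)
Lemma gronwall (n dn : R -> R) (k eta T : R) :
  0 <= k -> 0 <= eta -> 0 <= T ->
  (forall t, 0 <= t <= T -> is_derive n t (dn t)) ->
  (forall t, 0 <= t <= T -> dn t <= k * n t + eta) ->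
  n T <= (n 0 + eta * T) * exp (k * T).
Proof.
  intros Hk He HT Hd Hs.
  assert (H : n T * exp (- k * T) - eta * T <= n 0 * exp (- k * 0) - eta * 0).
  { apply (deriv_nonpos_le (fun t => n t * exp (- k * t) - eta * t)
      (fun t => (dn t - k * n t) * exp (- k * t) - eta) 0 T HT).
    - intros t Ht. auto_derive.
      + exists (dn t). now apply Hd.
      + replace (Derive (fun x => n x) t) with (dn t); [ring|].
        symmetry. apply is_derive_unique. now apply Hd.
    - intros t Ht. specialize (Hs t Ht).
      assert (0 < exp (- k * t) <= 1).
      { split; [apply exp_pos|]. rewrite <- exp_0.
        destruct (Req_dec (- k * t) 0) as [->|Hn]; [lra|].
        left. apply exp_increasing. nra. }
      nra. }
  rewrite !Rmult_0_r, exp_0 in H.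
  assert (E : exp (- k * T) * exp (k * T) = 1).
  { rewrite <- exp_plus. replace (- k * T + k * T) with 0 by ring. apply exp_0. }
  assert (0 < exp (k * T)) by apply exp_pos.
  replace (n T) with (n T * (exp (- k * T) * exp (k * T))) by (rewrite E; ring).
  nra.
Qed.

Lemma sin_lipschitz (x y : R) : Rabs (sin x - sin y) <= Rabs (x - y).
Proof.
  destruct (MVT_gen sin y x cos) as [c [_ E]].
  - intros. apply is_derive_sin.
  - intros. apply continuity_sin.
  - rewrite E, Rabs_mult.
    assert (Rabs (cos c) <= 1) by (apply Rabs_le; apply COS_bound).
    assert (0 <= Rabs (x - y)) by apply Rabs_pos. nra.
Qed.

Lemma cos_lipschitz (x y : R) : Rabs (cos x - cos y) <= Rabs (x - y).
Proof.
  rewrite (cos_sin x), (cos_sin y). eapply Rle_trans; [apply sin_lipschitz|].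
  right. f_equal. ring.
Qed.

Lemma antiderivative_continuous (f : R -> R) (a t : R) :
  (forall s, continuous f s) -> is_derive (fun u => RInt f a u) t (f t).
Proof.
  intros Hc. apply (is_derive_RInt f (fun u => RInt f a u) a t).
  - apply filter_forall. intros u. apply @RInt_correct.
    apply ex_RInt_continuous. intros; apply Hc.
  - apply Hc.
Qed.

Lemma RInt_derivative (F f : R -> R) (a b : R) :
  (forall t, is_derive F t (f t)) -> (forall t, continuous f t) ->
  RInt f a b = F b - F a.
Proof.
  intros Hd Hc. apply is_RInt_unique.
  apply (is_RInt_derive F f); intros; [apply Hd|apply Hc].
Qed.

(** * Existence and dependence on the parameters *)

Definition fld (al b c p t : R) : R := - al * sin p + b + c * cos t.

Definition sol (al b c x : R) (phi : R -> R) : Prop :=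
  phi 0 = x /\ forall t, is_derive phi t (fld al b c (phi t) t).

Fixpoint picard (al b c x : R) (n : nat) : R -> R :=
  match n with
  | O => fun _ => x
  | S m => fun t => x + RInt (fun s => fld al b c (picard al b c x m s) s) 0 t
  end.

Lemma fld_continuous (al b c : R) (f : R -> R) :
  (forall s, continuous f s) -> forall s, continuous (fun u => fld al b c (f u) u) s.
Proof.
  intros Hf s. unfold fld.
  apply @continuous_plus.
  - apply @continuous_plus; [|apply continuous_const].
    apply (continuous_mult (fun _ : R => - al) (fun u => sin (f u))).
    + apply continuous_const.
    + apply (continuous_comp f sin); [apply Hf|apply continuous_sin].
  - apply (continuous_mult (fun _ : R => c) cos).
    + apply continuous_const.
    + apply continuous_cos.
Qed.

Lemma picard_continuous (al b c x : R) (n : nat) (t : R) :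
  continuous (picard al b c x n) t.
Proof.
  revert t. induction n as [|n IH]; intros t; simpl.
  - apply continuous_const.
  - apply @continuous_plus; [apply continuous_const|].
    apply (ex_derive_continuous (fun t => RInt (fun s => fld al b c (picard al b c x n s) s) 0 t)).
    eexists. apply (antiderivative_continuous (fun s => fld al b c (picard al b c x n s) s)).
    now apply fld_continuous.
Qed.

Lemma is_derive_const_plus (x : R) (F : R -> R) (t d : R) :
  is_derive F t d -> is_derive (fun u => x + F u) t d.
Proof.
  intros H. auto_derive; [now exists d|].
  replace (Derive (fun x0 => F x0) t) with d; [ring|].
  symmetry. now apply is_derive_unique.
Qed.

Lemma picard_derive (al b c x : R) (n : nat) (t : R) :
  is_derive (picard al b c x (S n)) t (fld al b c (picard al b c x n t) t).
Proof.
  simpl. apply is_derive_const_plus.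
  apply (antiderivative_continuous (fun s => fld al b c (picard al b c x n s) s)).
  apply fld_continuous, picard_continuous.
Qed.

Lemma picard_0 (al b c x : R) (n : nat) : picard al b c x n 0 = x.
Proof.
  destruct n; simpl; [reflexivity|]. rewrite RInt_point. unfold zero; simpl. ring.
Qed.

Lemma fld_lipschitz (al b c p q t : R) :
  Rabs (fld al b c p t - fld al b c q t) <= Rabs al * Rabs (p - q).
Proof.
  unfold fld.
  replace (- al * sin p + b + c * cos t - (- al * sin q + b + c * cos t))
    with (- al * (sin p - sin q)) by ring.
  rewrite Rabs_mult, Rabs_Ropp.
  apply Rmult_le_compat_l; [apply Rabs_pos|apply sin_lipschitz].
Qed.

Lemma Rabs_sin_le (x : R) : Rabs (sin x) <= 1.
Proof. apply Rabs_le, SIN_bound. Qed.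

Lemma Rabs_cos_le (x : R) : Rabs (cos x) <= 1.
Proof. apply Rabs_le, COS_bound. Qed.

Lemma fld_bound (al b c p t : R) :
  Rabs (fld al b c p t) <= Rabs al + Rabs b + Rabs c.
Proof.
  unfold fld.
  eapply Rle_trans; [apply Rabs_triang|].
  eapply Rle_trans; [apply Rplus_le_compat_r, Rabs_triang|].
  rewrite !Rabs_mult, Rabs_Ropp.
  assert (H1 := Rabs_sin_le p). assert (H2 := Rabs_cos_le t).
  assert (0 <= Rabs al) by apply Rabs_pos. assert (0 <= Rabs c) by apply Rabs_pos. nra.
Qed.

(** The estimate behind a contraction in the norm weighted by exp(- k |t|): integration divides such
    a bound by k. Negative times reduce to positive ones by reflecting [f]. *)
Lemma deriv_exp_le (f df : R -> R) (k C : R) :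
  0 < k -> 0 <= C -> (forall t, is_derive f t (df t)) ->
  (forall t, Rabs (df t) <= k * C * exp (k * Rabs t)) ->
  forall t, Rabs (f t - f 0) <= C * exp (k * Rabs t).
Proof.
  intros Hk HC Hd Hb.
  assert (P : forall g dg : R -> R, (forall t, is_derive g t (dg t)) ->
    (forall t, Rabs (dg t) <= k * C * exp (k * Rabs t)) ->
    forall t, 0 <= t -> Rabs (g t - g 0) <= C * exp (k * t)).
  { intros g dg Hg Hgb t Ht.
    apply Rle_trans with (C * exp (k * t) - C * exp (k * 0)).
    - apply (deriv_abs_le g dg (fun s => C * exp (k * s)) (fun s => k * C * exp (k * s)) 0 t Ht).
      + intros s _. apply Hg.
      + intros s _. auto_derive; [exact I|ring].
      + intros s Hs. specialize (Hgb s). rewrite (Rabs_pos_eq s) in Hgb by lra. exact Hgb.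
    - assert (0 < exp (k * 0)) by apply exp_pos. nra. }
  intros t. destruct (Rle_dec 0 t) as [Ht|Ht].
  - rewrite (Rabs_pos_eq t) by lra. apply (P f df Hd Hb t Ht).
  - rewrite (Rabs_left t) by lra.
    assert (Q := P (fun s => f (- s)) (fun s => - df (- s))).
    specialize (Q ltac:(intros s; auto_derive;
      [exists (df (- s)); apply Hd|
       replace (Derive (fun x => f x) (- s)) with (df (- s)) by (symmetry; apply is_derive_unique, Hd);
       ring])).
    specialize (Q ltac:(intros s; cbv beta; rewrite Rabs_Ropp; rewrite <- (Rabs_Ropp s); apply Hb)).
    specialize (Q (- t) ltac:(lra)). cbv beta in Q.
    rewrite Ropp_involutive, Ropp_0 in Q. exact Q.
Qed.

(** The field is bounded, and Lipschitz in the angle with constant |al|. With the weight rate 2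
    (|al| + 1) each integration gains a factor below 1/2, so the iterates converge geometrically on
    the whole line at once. *)
Lemma picard_step (al b c x : R) (n : nat) (t : R) :
  Rabs (picard al b c x (S n) t - picard al b c x n t) <=
  (Rabs al + Rabs b + Rabs c) * exp (2 * (Rabs al + 1) * Rabs t) * (/ 2) ^ n.
Proof.
  assert (Hal : 0 <= Rabs al) by apply Rabs_pos.
  assert (Hb : 0 <= Rabs b) by apply Rabs_pos.
  assert (Hc : 0 <= Rabs c) by apply Rabs_pos.
  set (M := Rabs al + Rabs b + Rabs c). set (k := 2 * (Rabs al + 1)).
  assert (HM : 0 <= M) by (unfold M; lra).
  assert (Hk : 2 <= k) by (unfold k; lra).
  revert t. induction n as [|n IH]; intros t.
  - rewrite pow_O, Rmult_1_r.
    assert (H := deriv_exp_le (picard al b c x 1) (fun s => fld al b c x s) k M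
      ltac:(lra) HM (picard_derive al b c x 0)).
    assert (Hs : forall s, Rabs (fld al b c x s) <= k * M * exp (k * Rabs s)).
    { intros s. eapply Rle_trans; [apply fld_bound|]. fold M.
      assert (0 <= Rabs s) by apply Rabs_pos.
      assert (1 + k * Rabs s <= exp (k * Rabs s)) by apply exp_ineq1_le.
      assert (1 <= k * exp (k * Rabs s)) by nra. nra. }
    specialize (H Hs).
    specialize (H t). rewrite (picard_0 al b c x 1) in H. exact H.
  - assert (Hp : 0 < (/ 2) ^ n) by (apply pow_lt; lra).
    assert (H := deriv_exp_le
      (fun s => picard al b c x (S (S n)) s - picard al b c x (S n) s)
      (fun s => fld al b c (picard al b c x (S n) s) s - fld al b c (picard al b c x n s) s)
      k (M * (/ 2) ^ S n) ltac:(lra)).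
    assert (Hq : 0 <= M * (/ 2) ^ S n) by (simpl; nra).
    specialize (H Hq).
    specialize (H ltac:(intros s; apply @is_derive_minus; apply picard_derive)).
    cbv beta in H.
    assert (Hs : forall s, Rabs (fld al b c (picard al b c x (S n) s) s - fld al b c (picard al b c x n s) s)
      <= k * (M * (/ 2) ^ S n) * exp (k * Rabs s)).
    { intros s. eapply Rle_trans; [apply fld_lipschitz|]. specialize (IH s).
      set (E := exp (k * Rabs s)) in *. assert (0 < E) by apply exp_pos.
      simpl pow. replace (k * (M * (/ 2 * (/ 2) ^ n)) * E)
        with ((Rabs al + 1) * (M * E * (/ 2) ^ n)) by (unfold k; field).
      assert (0 <= M * E * (/ 2) ^ n) by
        (apply Rmult_le_pos; [apply Rmult_le_pos|]; lra).
      assert (0 <= Rabs (picard al b c x (S n) s - picard al b c x n s)) by apply Rabs_pos.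
      nra. }
    specialize (H Hs t). rewrite !picard_0 in H.
    replace (picard al b c x (S (S n)) t - picard al b c x (S n) t - (x - x))
      with (picard al b c x (S (S n)) t - picard al b c x (S n) t) in H by ring.
    eapply Rle_trans; [exact H|]. right. ring.
Qed.

Lemma geometric_cauchy (u : nat -> R) (C : R) :
  (forall n, Rabs (u (S n) - u n) <= C * (/ 2) ^ n) ->
  exists l : R, is_lim_seq u l /\ forall n, Rabs (l - u n) <= 2 * C * (/ 2) ^ n.
Proof.
  intros Hu.
  assert (HC : 0 <= C).
  { specialize (Hu 0%nat). assert (0 <= Rabs (u 1%nat - u 0%nat)) by apply Rabs_pos.
    simpl in Hu. lra. }
  assert (H2 : forall n p, Rabs (u (n + p)%nat - u n) <= 2 * C * (/ 2) ^ n - 2 * C * (/ 2) ^ (n + p)).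
  { intros n p. induction p as [|p IH].
    - rewrite Nat.add_0_r, Rminus_diag, Rabs_R0. lra.
    - rewrite Nat.add_succ_r.
      replace (u (S (n + p)) - u n) with ((u (S (n + p)) - u (n + p)%nat) + (u (n + p)%nat - u n)) by ring.
      eapply Rle_trans; [apply Rabs_triang|]. specialize (Hu (n + p)%nat). simpl. lra. }
  assert (Hlim : ex_finite_lim_seq u).
  { apply ex_lim_seq_cauchy_corr. intros eps.
    destruct (pow_lt_1_zero (/ 2) ltac:(rewrite Rabs_pos_eq; lra) (eps / (4 * (C + 1)))) as [N HN].
    { apply Rdiv_lt_0_compat; [apply eps|lra]. }
    assert (HNN : forall n, (N <= n)%nat -> Rabs (u n - u N) < eps / 2).
    { intros n Hn. replace n with (N + (n - N))%nat by lia.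
      eapply Rle_lt_trans; [apply H2|].
      specialize (HN N (Nat.le_refl N)).
      assert (0 < (/ 2) ^ N) by (apply pow_lt; lra).
      assert (0 < (/ 2) ^ (N + (n - N))) by (apply pow_lt; lra).
      rewrite Rabs_pos_eq in HN by lra.
      apply Rle_lt_trans with (2 * (C + 1) * (/ 2) ^ N); [nra|].
      apply Rlt_le_trans with (2 * (C + 1) * (eps / (4 * (C + 1)))).
      - apply Rmult_lt_compat_l; lra.
      - right. field. lra. }
    exists N. intros n m Hn Hm.
    replace (u n - u m) with ((u n - u N) - (u m - u N)) by ring.
    eapply Rle_lt_trans; [apply Rabs_triang|]. rewrite Rabs_Ropp.
    specialize (HNN n Hn) as A1. specialize (HNN m Hm) as A2. lra. }
  destruct Hlim as [l Hl]. exists l. split; [exact Hl|].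
  intros n. apply Rabs_le.
  assert (Hs : is_lim_seq (fun p => u (n + p)%nat) l).
  { apply is_lim_seq_ext with (fun p => u (p + n)%nat).
    - intros p. f_equal. lia.
    - now apply is_lim_seq_incr_n. }
  assert (B : forall p, u n - 2 * C * (/ 2) ^ n <= u (n + p)%nat <= u n + 2 * C * (/ 2) ^ n).
  { intros p. specialize (H2 n p). apply Rabs_le_between in H2.
    assert (0 < (/ 2) ^ (n + p)) by (apply pow_lt; lra). nra. }
  split.
  - assert (Rbar_le (u n - 2 * C * (/ 2) ^ n) l).
    { apply (is_lim_seq_le (fun _ => u n - 2 * C * (/ 2) ^ n) (fun p => u (n + p)%nat)); auto.
      - apply B.
      - apply is_lim_seq_const. }
    simpl in *. lra.
  - assert (Rbar_le l (u n + 2 * C * (/ 2) ^ n)).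
    { apply (is_lim_seq_le (fun p => u (n + p)%nat) (fun _ => u n + 2 * C * (/ 2) ^ n)); auto.
      - apply B.
      - apply is_lim_seq_const. }
    simpl in *. lra.
Qed.

(** [Lim_seq] is total; [flow_picard] shows that the limit is a true finite one. Solutions thus
    become a function of the parameters, which the intermediate value arguments require. *)
Definition flow (al b c x t : R) : R := real (Lim_seq (fun n => picard al b c x n t)).

Lemma flow_picard (al b c x t : R) :
  is_lim_seq (fun n => picard al b c x n t) (flow al b c x t) /\
  forall n, Rabs (flow al b c x t - picard al b c x n t) <=
    2 * ((Rabs al + Rabs b + Rabs c) * exp (2 * (Rabs al + 1) * Rabs t)) * (/ 2) ^ n.
Proof.
  destruct (geometric_cauchy (fun n => picard al b c x n t) _
    (fun n => picard_step al b c x n t)) as [l [Hl Hb]].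
  unfold flow. rewrite (is_lim_seq_unique _ _ Hl). split; [exact Hl|exact Hb].
Qed.

Lemma picard_lipschitz (al b c x : R) (n : nat) (s t : R) : s <= t ->
  Rabs (picard al b c x n t - picard al b c x n s) <= (Rabs al + Rabs b + Rabs c) * (t - s).
Proof.
  intros Hst. destruct n as [|n].
  - simpl. rewrite Rminus_diag, Rabs_R0.
    assert (0 <= Rabs al) by apply Rabs_pos. assert (0 <= Rabs b) by apply Rabs_pos.
    assert (0 <= Rabs c) by apply Rabs_pos. apply Rmult_le_pos; lra.
  - apply (deriv_bound_le _ (fun u => fld al b c (picard al b c x n u) u)); [exact Hst| |].
    + intros; apply picard_derive.
    + intros; apply fld_bound.
Qed.

Lemma lipschitz_continuous (f : R -> R) (M : R) :
  (forall s t, s <= t -> Rabs (f t - f s) <= M * (t - s)) -> forall t, continuous f t.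
Proof.
  intros Hf t. apply continuity_pt_filterlim.
  intros eps Heps. exists (eps / (Rabs M + 1)). split.
  { apply Rdiv_lt_0_compat; [exact Heps|]. assert (0 <= Rabs M) by apply Rabs_pos. lra. }
  intros x [_ Hx]. simpl in *. unfold Rdist in *.
  assert (HM : 0 <= Rabs M) by apply Rabs_pos.
  assert (Hle : Rabs (f x - f t) <= Rabs M * Rabs (x - t)).
  { destruct (Rle_dec t x) as [H|H].
    - rewrite (Rabs_pos_eq (x - t)) by lra. eapply Rle_trans; [now apply Hf|].
      apply Rmult_le_compat_r; [lra|apply Rle_abs].
    - rewrite (Rabs_left (x - t)) by lra. rewrite Rabs_minus_sym.
      eapply Rle_trans; [apply Hf; lra|].
      replace (- (x - t)) with (t - x) by ring.
      apply Rmult_le_compat_r; [lra|apply Rle_abs]. }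
  apply Rle_lt_trans with (1 := Hle).
  apply Rle_lt_trans with ((Rabs M + 1) * Rabs (x - t)).
  - assert (0 <= Rabs (x - t)) by apply Rabs_pos. nra.
  - apply Rlt_le_trans with ((Rabs M + 1) * (eps / (Rabs M + 1))).
    + apply Rmult_lt_compat_l; lra.
    + right. field. lra.
Qed.

Lemma flow_continuous (al b c x t : R) : continuous (flow al b c x) t.
Proof.
  apply lipschitz_continuous with (Rabs al + Rabs b + Rabs c).
  clear t. intros s t Hst.
  destruct (flow_picard al b c x s) as [Hs _]. destruct (flow_picard al b c x t) as [Ht _].
  assert (H := is_lim_seq_le (fun n => Rabs (picard al b c x n t - picard al b c x n s))
    (fun _ => (Rabs al + Rabs b + Rabs c) * (t - s))
    (Rabs (flow al b c x t - flow al b c x s)) ((Rabs al + Rabs b + Rabs c) * (t - s))).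
  apply H.
  - intros n. now apply picard_lipschitz.
  - apply (is_lim_seq_abs _ (flow al b c x t - flow al b c x s)).
    now apply (is_lim_seq_minus' _ _ (flow al b c x t) (flow al b c x s)).
  - apply is_lim_seq_const.
Qed.

Lemma Rabs_small_eq_0 (y C : R) : (forall n, Rabs y <= C * (/ 2) ^ n) -> y = 0.
Proof.
  intros H.
  assert (L : Rbar_le (Rabs y) 0).
  { apply (is_lim_seq_le (fun _ => Rabs y) (fun n => C * (/ 2) ^ n)); [exact H|apply is_lim_seq_const|].
    replace (Finite 0) with (Rbar_mult C 0) by (simpl; f_equal; ring).
    apply is_lim_seq_scal_l. apply is_lim_seq_geom. rewrite Rabs_pos_eq; lra. }
  simpl in L. assert (0 <= Rabs y) by apply Rabs_pos.
  destruct (Req_dec y 0) as [E|E]; [exact E|].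
  assert (0 < Rabs y) by now apply Rabs_pos_lt. lra.
Qed.

(** Both sides are within a multiple of (1/2)^n of the iterate [S n]: the left by [flow_picard], the
    right by the weighted estimate applied to the difference of the integrands. *)
Lemma flow_integral (al b c x t : R) :
  flow al b c x t = x + RInt (fun s => fld al b c (flow al b c x s) s) 0 t.
Proof.
  set (I := fun t => RInt (fun s => fld al b c (flow al b c x s) s) 0 t).
  assert (HI : forall t, is_derive I t (fld al b c (flow al b c x t) t)).
  { intros u. apply (antiderivative_continuous (fun s => fld al b c (flow al b c x s) s)).
    apply fld_continuous, flow_continuous. }
  assert (HI0 : I 0 = 0) by (unfold I; rewrite RInt_point; reflexivity).
  fold (I t).
  assert (Hal : 0 <= Rabs al) by apply Rabs_pos.
  assert (Hb : 0 <= Rabs b) by apply Rabs_pos.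
  assert (Hc : 0 <= Rabs c) by apply Rabs_pos.
  set (M := Rabs al + Rabs b + Rabs c). set (k := 2 * (Rabs al + 1)).
  assert (HM : 0 <= M) by (unfold M; lra).
  assert (H1 : forall n, Rabs (picard al b c x (S n) t - I t - x) <= M * (/ 2) ^ n * exp (k * Rabs t)).
  { intros n. assert (Hp : 0 < (/ 2) ^ n) by (apply pow_lt; lra).
    assert (H := deriv_exp_le (fun s => picard al b c x (S n) s - I s)
      (fun s => fld al b c (picard al b c x n s) s - fld al b c (flow al b c x s) s)
      k (M * (/ 2) ^ n) ltac:(unfold k; lra) ltac:(nra)).
    specialize (H ltac:(intros s; apply @is_derive_minus; [apply picard_derive|apply HI])).
    cbv beta in H. rewrite HI0, picard_0 in H. rewrite Rminus_0_r in H. apply H.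
    intros s. eapply Rle_trans; [apply fld_lipschitz|].
    destruct (flow_picard al b c x s) as [_ Hf]. specialize (Hf n).
    rewrite Rabs_minus_sym in Hf. fold M in Hf. fold k in Hf.
    set (E := exp (k * Rabs s)) in *. assert (0 < E) by apply exp_pos.
    replace (k * (M * (/ 2) ^ n) * E) with ((Rabs al + 1) * (2 * (M * E) * (/ 2) ^ n)) by (unfold k; ring).
    assert (0 <= 2 * (M * E) * (/ 2) ^ n) by
      (apply Rmult_le_pos; [apply Rmult_le_pos; [lra|apply Rmult_le_pos; lra]|lra]).
    assert (0 <= Rabs (picard al b c x n s - flow al b c x s)) by apply Rabs_pos.
    nra. }
  cut (flow al b c x t - (x + I t) = 0); [lra|].
  apply Rabs_small_eq_0 with (2 * M * exp (k * Rabs t)). intros n.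
  destruct (flow_picard al b c x t) as [_ Hf]. specialize (Hf (S n)).
  specialize (H1 n). fold M k in Hf.
  replace (flow al b c x t - (x + I t)) with
    ((flow al b c x t - picard al b c x (S n) t) + (picard al b c x (S n) t - I t - x)) by ring.
  eapply Rle_trans; [apply Rabs_triang|]. simpl pow in Hf. lra.
Qed.

Lemma flow_sol (al b c x : R) : sol al b c x (flow al b c x).
Proof.
  split.
  - rewrite flow_integral, RInt_point. apply Rplus_0_r.
  - intros t. apply is_derive_ext with
      (fun t => x + RInt (fun s => fld al b c (flow al b c x s) s) 0 t).
    + intros u. symmetry. apply flow_integral.
    + apply is_derive_const_plus.
      apply (antiderivative_continuous (fun s => fld al b c (flow al b c x s) s)).
      apply fld_continuous, flow_continuous.
Qed.

(** Squares are estimated, since |psi - phi| need not be differentiable where it vanishes. The cross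
    term 2 |psi - phi| eta is split into two squares, whence the + 1 in the exponent. *)
Lemma sol_dependence (al b c al' b' c' x : R) (phi psi : R -> R) (T : R) :
  0 <= T -> sol al b c x phi -> sol al' b' c' x psi ->
  Rsqr (psi T - phi T) <=
  Rsqr (Rabs (al' - al) + Rabs (b' - b) + Rabs (c' - c)) * T * exp ((2 * Rabs al + 1) * T).
Proof.
  intros HT [P0 P] [Q0 Q].
  set (eta := Rabs (al' - al) + Rabs (b' - b) + Rabs (c' - c)).
  assert (H := gronwall (fun t => Rsqr (psi t - phi t))
    (fun t => 2 * (psi t - phi t) * (fld al' b' c' (psi t) t - fld al b c (phi t) t))
    (2 * Rabs al + 1) (Rsqr eta) T).
  cbv beta in H. rewrite P0, Q0 in H.
  replace (Rsqr (x - x)) with 0 in H by (unfold Rsqr; ring). rewrite Rplus_0_l in H.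
  apply H; clear H.
  - assert (0 <= Rabs al) by apply Rabs_pos. lra.
  - apply Rle_0_sqr.
  - exact HT.
  - intros t _. unfold Rsqr.
    auto_derive.
    + repeat match goal with |- _ /\ _ => split end; try exact I; eexists; (apply P || apply Q).
    + rewrite (is_derive_unique (fun x0 : R => psi x0) _ _ (Q t)), (is_derive_unique (fun x0 : R => phi x0) _ _ (P t)). ring.
  - intros t _. set (d := psi t - phi t).
    set (g := fld al' b' c' (psi t) t - fld al b c (phi t) t).
    assert (Hg : Rabs g <= Rabs al * Rabs d + eta).
    { unfold g. replace (fld al' b' c' (psi t) t - fld al b c (phi t) t) with
       ((fld al b c (psi t) t - fld al b c (phi t) t) + fld (al' - al) (b' - b) (c' - c) (psi t) t)
        by (unfold fld; ring).
      eapply Rle_trans; [apply Rabs_triang|].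
      apply Rplus_le_compat; [apply fld_lipschitz|apply fld_bound]. }
    assert (E : 2 * d * g <= 2 * Rabs d * Rabs g).
    { replace (2 * Rabs d * Rabs g) with (2 * Rabs (d * g)) by (rewrite Rabs_mult; ring).
      assert (d * g <= Rabs (d * g)) by apply Rle_abs. lra. }
    assert (S : Rsqr d = Rabs d * Rabs d) by (rewrite Rsqr_abs; reflexivity).
    fold d g. rewrite S. unfold Rsqr.
    assert (0 <= Rabs d) by apply Rabs_pos. assert (0 <= Rabs al) by apply Rabs_pos.
    set (D := Rabs d) in *. set (A := Rabs al) in *.
    assert (2 * D * Rabs g <= 2 * D * (A * D + eta)) by (apply Rmult_le_compat_l; lra).
    assert (0 <= (D - eta) * (D - eta)) by (apply Rle_0_sqr).
    nra.
Qed.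

Lemma sol_unique (al b c x : R) (phi psi : R -> R) (T : R) :
  0 <= T -> sol al b c x phi -> sol al b c x psi -> psi T = phi T.
Proof.
  intros HT Hp Hq. assert (H := sol_dependence _ _ _ _ _ _ _ _ _ T HT Hp Hq).
  rewrite !Rminus_diag, Rabs_R0 in H.
  replace (Rsqr (0 + 0 + 0)) with 0 in H by (unfold Rsqr; ring).
  rewrite !Rmult_0_l in H.
  assert (psi T - phi T = 0); [|lra].
  apply Rsqr_0_uniq. apply Rle_antisym; [exact H|apply Rle_0_sqr].
Qed.

(** * The Wronskian and the rotation number *)

(** The square of [amp] is the reciprocal of the derivative of the time-t map in the initial value,
    hence the integrating factor of the linearised equation. *)
Definition amp (al : R) (phi : R -> R) (t : R) : R :=
  exp (RInt (fun s => al / 2 * cos (phi s)) 0 t).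

Ltac conj_split := repeat match goal with |- _ /\ _ => split end; try exact I.

Ltac ex_der := conj_split;
  match goal with
  | H : forall s, is_derive ?f s _ |- ex_derive ?f ?t => eexists; exact (H t)
  | H : forall s, is_derive ?f s _ |- ex_derive (fun x => ?f x) ?t => eexists; exact (H t)
  end.

Lemma sol_continuous (al b c x : R) (phi : R -> R) (t : R) :
  sol al b c x phi -> continuous phi t.
Proof. intros [_ H]. apply (ex_derive_continuous phi). eexists; apply H. Qed.

Lemma amp_pos (al : R) (phi : R -> R) (t : R) : 0 < amp al phi t.
Proof. apply exp_pos. Qed.

Lemma amp_0 (al : R) (phi : R -> R) : amp al phi 0 = 1.
Proof. unfold amp. rewrite RInt_point. apply exp_0. Qed.

Lemma amp_derive (al b c x : R) (phi : R -> R) (t : R) :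
  sol al b c x phi -> is_derive (amp al phi) t (al / 2 * cos (phi t) * amp al phi t).
Proof.
  intros H.
  assert (D : is_derive (fun u => RInt (fun s => al / 2 * cos (phi s)) 0 u) t (al / 2 * cos (phi t))).
  { apply (antiderivative_continuous (fun s => al / 2 * cos (phi s))).
    intros s. apply (continuous_mult (fun _ : R => al / 2) (fun u => cos (phi u))).
    - apply continuous_const.
    - apply (continuous_comp phi cos); [eapply sol_continuous; exact H|apply continuous_cos]. }
  unfold amp. apply (is_derive_comp exp (fun u => RInt (fun s => al / 2 * cos (phi s)) 0 u)).
  - apply is_derive_exp.
  - exact D.
Qed.

(* The solutions of the equation are the doubled arguments of the solutions
   [amp * exp(i phi/2)] of a linear system; this is its Wronskian. *)
Lemma wronskian_const (al b c x y : R) (phi psi : R -> R) (t : R) :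
  0 <= t -> sol al b c x phi -> sol al b c y psi ->
  amp al phi t * amp al psi t * sin ((phi t - psi t) / 2) = sin ((x - y) / 2).
Proof.
  intros Ht Hp Hq.
  assert (E := deriv_zero_eq
    (fun s => amp al phi s * amp al psi s * sin ((phi s - psi s) / 2))
    (fun _ => 0) 0 t Ht).
  cbv beta in E. rewrite E; [|clear E; intros s _|reflexivity].
  - rewrite !amp_0. destruct Hp as [-> _], Hq as [-> _]. ring.
  - assert (A1 := fun s => amp_derive _ _ _ _ _ s Hp).
    assert (A2 := fun s => amp_derive _ _ _ _ _ s Hq).
    destruct Hp as [_ Hp], Hq as [_ Hq].
    auto_derive.
    + ex_der.
    + rewrite (is_derive_unique (fun u : R => amp al phi u) _ _ (A1 s)),
        (is_derive_unique (fun u : R => amp al psi u) _ _ (A2 s)),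
        (is_derive_unique (fun u : R => phi u) _ _ (Hp s)),
        (is_derive_unique (fun u : R => psi u) _ _ (Hq s)).
      unfold fld.
      set (M := (phi s + psi s) / 2). set (D := (phi s - psi s) / 2).
      replace (phi s) with (M + D) by (unfold M, D; field).
      replace (psi s) with (M - D) by (unfold M, D; field).
      replace ((M + D + - (M - D)) * / 2) with D by field.
      rewrite sin_plus, cos_plus, sin_minus, cos_minus. field.
Qed.

Lemma sol_shift_value (al b c x : R) (phi : R -> R) (k : Z) :
  sol al b c x phi -> sol al b c (x + 2 * PI * IZR k) (fun t => phi t + 2 * PI * IZR k).
Proof.
  intros [H0 H]. split; [now rewrite H0|].
  intros t. auto_derive; [eexists; apply H|].
  rewrite (is_derive_unique (fun u : R => phi u) _ _ (H t)). unfold fld.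
  replace (sin (phi t + 2 * PI * IZR k)) with (sin (phi t)); [ring|].
  rewrite sin_plus.
  assert (S : sin (2 * PI * IZR k) = 0).
  { apply sin_eq_0_1. exists (2 * k)%Z. rewrite mult_IZR. ring. }
  assert (C : cos (2 * PI * IZR k) = 1).
  { replace (2 * PI * IZR k) with (2 * (IZR k * PI)) by ring. rewrite cos_2a_sin.
    rewrite (sin_eq_0_1 (IZR k * PI)); [ring|now exists k]. }
  rewrite S, C. ring.
Qed.

Lemma sin_period_Z (x : R) (k : Z) : sin (x + 2 * PI * IZR k) = sin x.
Proof.
  rewrite sin_plus.
  replace (2 * PI * IZR k) with (2 * (IZR k * PI)) by ring.
  rewrite cos_2a_sin, sin_2a, (sin_eq_0_1 (IZR k * PI)); [ring|now exists k].
Qed.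

Lemma cos_period_Z (x : R) (k : Z) : cos (x + 2 * PI * IZR k) = cos x.
Proof.
  rewrite cos_plus.
  replace (2 * PI * IZR k) with (2 * (IZR k * PI)) by ring.
  rewrite cos_2a_sin, sin_2a, (sin_eq_0_1 (IZR k * PI)); [ring|now exists k].
Qed.

Lemma sol_periodic (al b c x : R) (s : Z) (phi : R -> R) :
  sol al b c x phi -> phi (2 * PI) = x + 2 * PI * IZR s ->
  forall t, 0 <= t -> phi (t + 2 * PI) = phi t + 2 * PI * IZR s.
Proof.
  intros H E t Ht.
  assert (H' : sol al b c x (fun t => phi (t + 2 * PI) + 2 * PI * IZR (- s))).
  { destruct H as [H0 H]. split.
    - rewrite Rplus_0_l, E, opp_IZR. ring.
    - intros u. auto_derive; [eexists; apply H|].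
      rewrite (is_derive_unique (fun v : R => phi v) _ _ (H (u + 2 * PI))). unfold fld.
      rewrite sin_period_Z.
      replace (u + 2 * PI) with (u + 2 * PI * IZR 1) by ring.
      rewrite cos_period_Z. ring. }
  assert (U := sol_unique _ _ _ _ _ _ t Ht H H'). cbv beta in U.
  rewrite opp_IZR in U. lra.
Qed.

Lemma continuity_lt_level (f : R -> R) (a b y : R) :
  continuity f -> a <= b -> (forall u, a <= u <= b -> f u <> y) -> f a < y -> f b < y.
Proof.
  intros Hc Hab Hn Ha. destruct (Rlt_dec (f b) y) as [L|L]; [exact L|exfalso].
  destruct (IVT_gen f a b y Hc) as [z [Hz Ez]].
  - rewrite Rmin_left, Rmax_right by lra. lra.
  - rewrite Rmin_left, Rmax_right in Hz by lra. now apply (Hn z).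
Qed.

Lemma continuity_gt_level (f : R -> R) (a b y : R) :
  continuity f -> a <= b -> (forall u, a <= u <= b -> f u <> y) -> y < f a -> y < f b.
Proof.
  intros Hc Hab Hn Ha.
  cut (- f b < - y); [lra|].
  apply (continuity_lt_level (fun u => - f u) a b (- y)); [now apply continuity_opp|exact Hab| |lra].
  intros u Hu E. apply (Hn u Hu). lra.
Qed.

(** The Wronskian keeps sin((psi - phi)/2) nonzero, so the difference of the two orbits never
    reaches a multiple of 2 pi. *)
Lemma sol_confined (al b c x d : R) (phi psi : R -> R) (t : R) :
  0 <= t -> 0 < d < 2 * PI -> sol al b c x phi -> sol al b c (x + d) psi ->
  0 < psi t - phi t < 2 * PI.
Proof.
  intros Ht Hd Hp Hq.
  assert (C : continuity (fun u => psi u - phi u)).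
  { intros u. apply continuity_pt_minus; apply continuity_pt_filterlim;
      eapply sol_continuous; eassumption. }
  assert (N : forall u (k : Z), 0 <= u -> psi u - phi u <> 2 * PI * IZR k).
  { intros u k Hu E. assert (W := wronskian_const _ _ _ _ _ _ _ u Hu Hq Hp).
    rewrite E in W.
    replace (2 * PI * IZR k / 2) with (IZR k * PI) in W by field.
    rewrite (sin_eq_0_1 (IZR k * PI)) in W by now exists k.
    assert (0 < sin ((x + d - x) / 2)) by (apply sin_gt_0; lra). lra. }
  assert (E0 : psi 0 - phi 0 = d) by (destruct Hp as [-> _], Hq as [-> _]; ring).
  split.
  - apply (continuity_gt_level (fun u => psi u - phi u) 0 t 0 C Ht); [|lra].
    intros u Hu. rewrite <- (Rmult_0_r (2 * PI)). apply (N u 0%Z). lra.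
  - apply (continuity_lt_level (fun u => psi u - phi u) 0 t (2 * PI) C Ht); [|lra].
    intros u Hu. rewrite <- (Rmult_1_r (2 * PI)). apply (N u 1%Z). lra.
Qed.

(** After a shift by a multiple of 2 pi any orbit stays within 2 pi of the fixed one for all t >= 0,
    and the fixed one advances by exactly 2 pi s per period. *)
Lemma rotation_number_fixed (al b c x0 : R) (s : Z) (phi0 : R -> R) :
  sol al b c x0 phi0 -> phi0 (2 * PI) = x0 + 2 * PI * IZR s ->
  forall x phi, sol al b c x phi ->
  is_lim_seq (fun k : nat => phi (2 * PI * INR k) / (2 * PI * INR k)) (IZR s).
Proof.
  intros H0 E x phi H.
  assert (HPI := PI_RGT_0).
  assert (Ek : forall k : nat, phi0 (2 * PI * INR k) = x0 + 2 * PI * IZR s * INR k).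
  { induction k as [|k IH].
    - simpl INR. rewrite !Rmult_0_r. destruct H0 as [-> _]. ring.
    - rewrite S_INR, Rmult_plus_distr_l, Rmult_1_r.
      rewrite (sol_periodic _ _ _ _ _ _ H0 E); [rewrite IH; ring|].
      assert (0 <= INR k) by apply pos_INR. nra. }
  destruct (floor_ex ((x - x0) / (2 * PI))) as [j Hj].
  set (d := x - x0 - 2 * PI * IZR j).
  assert (Hd : 0 <= d < 2 * PI).
  { unfold d. assert (Ex : x - x0 = (x - x0) / (2 * PI) * (2 * PI)) by (field; lra).
    split; rewrite Ex; nra. }
  assert (B : forall t, 0 <= t -> 0 <= phi t - 2 * PI * IZR j - phi0 t <= 2 * PI).
  { intros t Ht.
    assert (Hs := sol_shift_value _ _ _ _ _ (- j) H).
    replace (x + 2 * PI * IZR (- j)) with (x0 + d) in Hs by (unfold d; rewrite opp_IZR; ring).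
    destruct (Req_dec d 0) as [Ed|Ed].
    - rewrite Ed, Rplus_0_r in Hs.
      assert (U := sol_unique _ _ _ _ _ _ t Ht H0 Hs). cbv beta in U. rewrite opp_IZR in U. lra.
    - assert (U := sol_confined _ _ _ _ d _ _ t Ht ltac:(lra) H0 Hs). cbv beta in U.
      rewrite opp_IZR in U. lra. }
  set (C := Rabs (x0 + 2 * PI * IZR j) + 2 * PI).
  assert (HC : 0 <= C) by (unfold C; assert (0 <= Rabs (x0 + 2 * PI * IZR j)) by apply Rabs_pos; lra).
  set (v := fun k : nat => (phi (2 * PI * INR k) - 2 * PI * IZR s * INR k) / (2 * PI * INR k)).
  assert (Hv : is_lim_seq v 0).
  { apply is_lim_seq_abs_0.
    apply is_lim_seq_le_le_loc with (fun _ => 0) (fun k : nat => C * / INR k).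
    - exists 1%nat. intros k Hk. split; [apply Rabs_pos|].
      assert (1 <= INR k) by (apply (le_INR 1 k); exact Hk).
      assert (Hpk : 0 <= 2 * PI * INR k) by (apply Rmult_le_pos; lra).
      unfold v, Rdiv. rewrite Rabs_mult. apply Rmult_le_compat; try apply Rabs_pos.
      + specialize (B (2 * PI * INR k) Hpk). rewrite Ek in B.
        unfold C. revert B. unfold Rabs. repeat destruct Rcase_abs; lra.
      + assert (P3 := PI2_3_2).
        rewrite Rabs_inv, Rabs_pos_eq by exact Hpk. apply Rinv_le_contravar; [lra|nra].
    - apply is_lim_seq_const.
    - replace (Finite 0) with (Rbar_mult C 0) by (simpl; f_equal; ring).
      apply is_lim_seq_scal_l.
      replace (Finite 0) with (Rbar_inv p_infty) by reflexivity.
      apply is_lim_seq_inv; [apply is_lim_seq_INR|discriminate]. }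
  apply is_lim_seq_ext_loc with (fun k => v k + IZR s).
  - exists 1%nat. intros k Hk. assert (1 <= INR k) by (apply (le_INR 1 k); exact Hk).
    unfold v. field. lra.
  - replace (IZR s) with (0 + IZR s) at 1 by ring.
    apply is_lim_seq_plus'; [exact Hv|apply is_lim_seq_const].
Qed.

(** * Translation between the definitions in om, B, A and the coordinates al, b, c *)

Lemma is_sol_iff (om B A x : R) (phi : R -> R) : 0 < om ->
  is_sol om B A x phi <-> sol (/ om) (B / om) (A / om) x phi.
Proof.
  intros Hom.
  assert (E : forall p t, rhs om B A p t = fld (/ om) (B / om) (A / om) p t)
    by (intros; unfold rhs, fld; field; lra).
  split; intros [H0 H]; split; try exact H0; intros t; specialize (H t).
  - now rewrite <- E.
  - now rewrite E.
Qed.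

Definition half_pi (sg : bool) : R := if sg then PI / 2 else - (PI / 2).

Lemma phase_lock_of_fixed (om B A x : R) (s : Z) (phi : R -> R) : 0 < om ->
  sol (/ om) (B / om) (A / om) x phi -> phi (2 * PI) = x + 2 * PI * IZR s ->
  phase_lock om s B A.
Proof.
  intros Hom H E y psi Hy. apply is_sol_iff in Hy; [|exact Hom].
  exact (rotation_number_fixed _ _ _ _ _ _ H E y psi Hy).
Qed.

Lemma poinc_fixes_of_fixed (om B A x : R) (s : Z) (phi : R -> R) : 0 < om ->
  sol (/ om) (B / om) (A / om) x phi -> phi (2 * PI) = x + 2 * PI * IZR s ->
  poinc_fixes om B A x.
Proof.
  intros Hom H E psi Hy. apply is_sol_iff in Hy; [|exact Hom].
  exists s. assert (HPI := PI_RGT_0).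
  rewrite (sol_unique _ _ _ _ _ _ (2 * PI) ltac:(lra) H Hy). exact E.
Qed.

Lemma phase_lock_unique (om B A x : R) (s n : Z) (phi : R -> R) : 0 < om ->
  phase_lock om s B A ->
  sol (/ om) (B / om) (A / om) x phi -> phi (2 * PI) = x + 2 * PI * IZR n -> n = s.
Proof.
  intros Hom Hs H E.
  assert (L1 := rotation_number_fixed _ _ _ _ _ _ H E x phi H).
  assert (L2 := Hs x phi (proj2 (is_sol_iff _ _ _ _ _ Hom) H)).
  apply is_lim_seq_unique in L1. apply is_lim_seq_unique in L2.
  rewrite L1 in L2. apply eq_IZR. now injection L2.
Qed.

(** [poinc_fixes] gives a return up to an unknown multiple of 2 pi; the rotation number identifies
    that multiple. *)
Lemma fixed_of_poinc_fixes (om B A x : R) (s : Z) (phi : R -> R) : 0 < om ->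
  phase_lock om s B A -> poinc_fixes om B A x ->
  sol (/ om) (B / om) (A / om) x phi -> phi (2 * PI) = x + 2 * PI * IZR s.
Proof.
  intros Hom Hs Hf H.
  destruct (Hf phi (proj2 (is_sol_iff _ _ _ _ _ Hom) H)) as [n E].
  now rewrite <- (phase_lock_unique _ _ _ _ _ _ _ Hom Hs H E).
Qed.

(** * Periodic orbits and completeness of Fourier coefficients *)

Lemma RInt_linear3 (f g h : R -> R) (x y z a b : R) :
  (forall t, continuous f t) -> (forall t, continuous g t) -> (forall t, continuous h t) ->
  RInt (fun t => x * f t + y * g t + z * h t) a b =
  x * RInt f a b + y * RInt g a b + z * RInt h a b.
Proof.
  intros Hf Hg Hh.
  rewrite (RInt_derivative (fun t => x * RInt f a t + y * RInt g a t + z * RInt h a t)).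
  - rewrite !RInt_point. unfold zero; simpl. ring.
  - intros t.
    assert (Df := antiderivative_continuous f a t Hf).
    assert (Dg := antiderivative_continuous g a t Hg).
    assert (Dh := antiderivative_continuous h a t Hh).
    apply @is_derive_plus; [apply @is_derive_plus|]; apply is_derive_scal; assumption.
  - intros t. apply @continuous_plus; [apply @continuous_plus|];
      match goal with |- continuous (fun _ => ?k * ?w _) _ =>
        apply (continuous_mult (fun _ : R => k) w); [apply continuous_const|auto] end.
Qed.

Lemma RInt_lower (f : R -> R) (m a b : R) :
  a <= b -> (forall t, continuous f t) -> (forall t, a <= t <= b -> m <= f t) ->
  m * (b - a) <= RInt f a b.
Proof.
  intros Hab Hc Hf.
  assert (D := fun t => antiderivative_continuous f a t Hc).
  assert (H := deriv_nonpos_le (fun t => m * t - RInt f a t) (fun t => m - f t) a b Hab).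
  cbv beta in H. rewrite RInt_point in H. unfold zero in H; simpl in H.
  cut (m * b - RInt f a b <= m * a - 0); [lra|]. apply H.
  - intros t _. apply @is_derive_minus; [|apply D].
    auto_derive; [exact I|ring].
  - intros t Ht. specialize (Hf t Ht). lra.
Qed.

Lemma continuous_Ropp (f : R -> R) (t : R) : continuous f t -> continuous (fun u => - f u) t.
Proof. apply (continuous_opp f). Qed.

Lemma RInt_abs_bound (f : R -> R) (M a b : R) :
  a <= b -> (forall t, continuous f t) -> (forall t, a <= t <= b -> Rabs (f t) <= M) ->
  Rabs (RInt f a b) <= M * (b - a).
Proof.
  intros Hab Hc Hf.
  assert (D := fun t => antiderivative_continuous f a t Hc).
  assert (H := deriv_bound_le (RInt f a) f M a b Hab (fun t _ => D t) Hf).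
  rewrite RInt_point in H. unfold zero in H; simpl in H. now rewrite Rminus_0_r in H.
Qed.

Lemma RInt_monotone (f g : R -> R) (a b : R) :
  a <= b -> (forall t, continuous f t) -> (forall t, continuous g t) ->
  (forall t, a <= t <= b -> f t <= g t) -> RInt f a b <= RInt g a b.
Proof.
  intros Hab Hf Hg H. apply RInt_le; auto.
  - apply (ex_RInt_continuous f); auto.
  - apply (ex_RInt_continuous g); auto.
  - intros; apply H; lra.
Qed.

Lemma RInt_split (f : R -> R) (a b c : R) :
  (forall t, continuous f t) -> RInt f a c = RInt f a b + RInt f b c.
Proof.
  intros Hc. symmetry.
  apply (RInt_Chasles f a b c); apply (ex_RInt_continuous f); auto.
Qed.

Lemma continuous_bounded (f : R -> R) (a b : R) :
  (forall t, continuous f t) -> exists M, 0 <= M /\ forall t, a <= t <= b -> Rabs (f t) <= M.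
Proof.
  intros Hc.
  destruct (Rle_dec a b) as [Hab|Hab]; [|exists 0; split; [lra|intros; lra]].
  destruct (continuity_ab_maj (fun t => Rabs (f t)) a b Hab) as [m [Hm _]].
  - intros t _. apply continuity_pt_filterlim. apply (continuous_comp f Rabs); [apply Hc|apply continuous_Rabs].
  - exists (Rabs (f m)). split; [apply Rabs_pos|exact Hm].
Qed.

Lemma continuous_pos_near (f : R -> R) (x : R) : continuous f x -> 0 < f x ->
  exists d, 0 < d /\ forall t, Rabs (t - x) < d -> f x / 2 < f t.
Proof.
  intros Hc Hx. apply continuity_pt_filterlim in Hc.
  destruct (Hc (f x / 2) ltac:(lra)) as [d [Hd H]]. exists d. split; [exact Hd|].
  intros t Ht. destruct (Req_dec x t) as [<-|N]; [lra|].
  specialize (H t). simpl in H. unfold Rdist in H.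
  specialize (H (conj (conj I N) Ht)). apply Rabs_lt_between in H. lra.
Qed.

Ltac der_cont := apply (@ex_derive_continuous R_AbsRing R_NormedModule); auto_derive; conj_split.

(** Multiplication by (1 + cos t)/2 replaces the mode k by the modes k, k + 1, k - 1 with weights
    1/2, 1/4, 1/4, so the vanishing of all coefficients survives it. *)
Lemma kernel_moments (f h : R -> R) (n : nat) :
  (forall t, continuous f t) -> (forall t, continuous h t) ->
  (forall k : Z, RInt (fun t => f t * cos (h t - IZR k * t)) 0 (2 * PI) = 0) ->
  forall k : Z, RInt (fun t => f t * cos (h t - IZR k * t) * ((1 + cos t) / 2) ^ n) 0 (2 * PI) = 0.
Proof.
  intros Hf Hh H0. 
  assert (Hc : forall m (k : Z) t, continuous (fun t => f t * cos (h t - IZR k * t) * ((1 + cos t) / 2) ^ m) t).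
  { intros m k t.
    apply (continuous_mult (fun t => f t * cos (h t - IZR k * t)) (fun t => ((1 + cos t) / 2) ^ m)).
    - apply (continuous_mult f (fun t => cos (h t - IZR k * t))); [apply Hf|].
      apply (continuous_comp (fun t => h t - IZR k * t) cos); [|apply continuous_cos].
      apply (continuous_minus h (fun t => IZR k * t)); [apply Hh|]. der_cont.
    - der_cont. }
  induction n as [|n IH]; intros k.
  - etransitivity; [|apply (H0 k)]. apply RInt_ext. intros. simpl. ring.
  - transitivity (RInt (fun t => / 2 * (f t * cos (h t - IZR k * t) * ((1 + cos t) / 2) ^ n)
      + / 4 * (f t * cos (h t - IZR (k + 1) * t) * ((1 + cos t) / 2) ^ n)
      + / 4 * (f t * cos (h t - IZR (k - 1) * t) * ((1 + cos t) / 2) ^ n)) 0 (2 * PI)).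
    + apply RInt_ext. intros t _.
      replace (h t - IZR (k + 1) * t) with (h t - IZR k * t - t) by (rewrite plus_IZR; ring).
      replace (h t - IZR (k - 1) * t) with (h t - IZR k * t + t) by (rewrite minus_IZR; ring).
      set (y := h t - IZR k * t). rewrite cos_minus, cos_plus. simpl. field.
    + rewrite RInt_linear3 by (intros; apply Hc). rewrite !IH.
      match goal with |- ?u = ?v => change (@eq R u v) end. ring.
Qed.

(* The kernels [((1 + cos t) / 2) ^ n] concentrate at the end points of the period. *)
Lemma fourier_coefficients_not_all_zero (f h : R -> R) :
  (forall t, continuous f t) -> (forall t, continuous h t) ->
  0 < f 0 * cos (h 0) -> 0 < f (2 * PI) * cos (h (2 * PI)) ->
  ~ (forall k : Z, RInt (fun t => f t * cos (h t - IZR k * t)) 0 (2 * PI) = 0).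
Proof.
  intros Hf Hh P0 P1 HZ.
  assert (HPI := PI2_3_2).
  set (u := fun t => f t * cos (h t)).
  assert (Hu : forall t, continuous u t).
  { intros t. apply (continuous_mult f (fun t => cos (h t))); [apply Hf|].
    apply (continuous_comp h cos); [apply Hh|apply continuous_cos]. }
  set (w := fun t => (1 + cos t) / 2).
  assert (Huw : forall n t, continuous (fun t => u t * w t ^ n) t).
  { intros n t. apply (continuous_mult u (fun t => w t ^ n)); [apply Hu|].
    unfold w. der_cont. }
  assert (Hz : forall n, RInt (fun t => u t * w t ^ n) 0 (2 * PI) = 0).
  { intros n. etransitivity; [|apply (kernel_moments f h n Hf Hh HZ 0)]. apply RInt_ext.
    intros t _. unfold u, w. now rewrite Rmult_0_l, Rminus_0_r. }
  destruct (continuous_pos_near u 0 (Hu 0) P0) as [d0 [Hd0 H0]].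
  destruct (continuous_pos_near u (2 * PI) (Hu _) P1) as [d1 [Hd1 H1]].
  destruct (continuous_bounded u 0 (2 * PI) Hu) as [M [HM BM]].
  set (d := Rmin 1 (Rmin (d0 / 2) (d1 / 2))).
  assert (Hd : 0 < d <= 1 /\ d < d0 /\ d < d1).
  { unfold d. assert (A := Rmin_l 1 (Rmin (d0 / 2) (d1 / 2))).
    assert (B := Rmin_r 1 (Rmin (d0 / 2) (d1 / 2))).
    assert (C := Rmin_l (d0 / 2) (d1 / 2)). assert (D := Rmin_r (d0 / 2) (d1 / 2)).
    assert (0 < Rmin 1 (Rmin (d0 / 2) (d1 / 2))) by (repeat apply Rmin_glb_lt; lra). lra. }
  assert (W0 : forall t, 0 <= w t).
  { intros t. unfold w. assert (h0 := COS_bound t). lra. }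
  assert (W1 : forall x t, 0 <= x <= PI -> x <= t <= 2 * PI - x -> w t <= w x).
  { intros x t Hx Ht. unfold w. cut (cos t <= cos x); [lra|].
    destruct (Rle_dec t PI) as [L|L].
    - apply cos_decr_1; lra.
    - replace (cos t) with (cos (2 * PI - t)).
      + apply cos_decr_1; lra.
      + rewrite cos_minus, cos_2PI, sin_2PI. ring. }
  set (k1 := w (d / 2)). set (k2 := w d).
  assert (Hk : 0 < k2 < k1).
  { unfold k1, k2, w. split.
    - assert (0 < cos d) by (apply cos_gt_0; lra). lra.
    - assert (cos d < cos (d / 2)) by (apply cos_decreasing_1; lra). lra. }
  set (c0 := u 0 / 2).
  assert (Hc0 : 0 < c0) by (unfold c0, u; lra).
  (* The kernel is at least k1^n on [0, d/2] and at most k2^n on [d, 2 pi - d]; the pieces in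
     between and next to 2 pi contribute nonnegatively. Since k2 < k1, a large n is
     contradictory. *)
  assert (Q : forall n, c0 * k1 ^ n * (d / 2) <= M * k2 ^ n * (2 * PI)).
  { intros n. specialize (Hz n). specialize (Huw n).
    rewrite (RInt_split _ 0 (d / 2)), (RInt_split _ (d / 2) d), (RInt_split _ d (2 * PI - d)) in Hz by exact Huw.
    assert (I1 := RInt_lower (fun t => u t * w t ^ n) (c0 * k1 ^ n) 0 (d / 2) ltac:(lra) Huw).
    assert (I2 := RInt_lower (fun t => u t * w t ^ n) 0 (d / 2) d ltac:(lra) Huw).
    assert (I3 := RInt_abs_bound (fun t => u t * w t ^ n) (M * k2 ^ n) d (2 * PI - d) ltac:(lra) Huw).
    assert (I4 := RInt_lower (fun t => u t * w t ^ n) 0 (2 * PI - d) (2 * PI) ltac:(lra) Huw).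
    specialize (I1 ltac:(intros t Ht; apply Rmult_le_compat;
      [lra|apply pow_le; lra
      |left; apply H0; rewrite Rabs_pos_eq; lra
      |apply pow_incr; split; [lra|unfold k1, w; cut (cos (d / 2) <= cos t); [lra|apply cos_decr_1; lra]]])).
    specialize (I2 ltac:(intros t Ht; apply Rmult_le_pos; [|apply pow_le, W0];
      assert (u 0 / 2 < u t) by (apply H0; rewrite Rabs_pos_eq; lra); unfold c0 in Hc0; lra)).
    specialize (I3 ltac:(intros t Ht; cbv beta; rewrite Rabs_mult; apply Rmult_le_compat;
      [apply Rabs_pos|apply Rabs_pos|apply BM; lra
      |rewrite Rabs_pos_eq by (apply pow_le, W0); apply pow_incr; split; [apply W0|apply W1; lra]])).
    specialize (I4 ltac:(intros t Ht; apply Rmult_le_pos; [|apply pow_le, W0];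
      assert (u (2 * PI) / 2 < u t) by (apply H1; rewrite Rabs_left1; lra); unfold u in *; lra)).
    apply Rabs_le_between in I3.
    assert (0 < k2 ^ n) by (apply pow_lt; lra).
    assert (0 <= M * k2 ^ n) by nra.
    assert (M * k2 ^ n * (2 * PI - d - d) <= M * k2 ^ n * (2 * PI)) by (apply Rmult_le_compat_l; lra).
    rewrite Rminus_0_r in I1. lra. }
  assert (Hq : 0 < k2 / k1 < 1).
  { split; [apply Rdiv_lt_0_compat; lra|]. apply Rmult_lt_reg_r with k1; [lra|].
    unfold Rdiv. rewrite Rmult_assoc, Rinv_l; lra. }
  assert (He : 0 < c0 * (d / 2) / ((M + 1) * (2 * PI))).
  { apply Rdiv_lt_0_compat; nra. }
  destruct (pow_lt_1_zero (k2 / k1) ltac:(rewrite Rabs_pos_eq; lra) _ He) as [N HN].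
  specialize (HN N (Nat.le_refl N)). specialize (Q N).
  assert (A1 : 0 < k1 ^ N) by (apply pow_lt; lra).
  rewrite Rabs_pos_eq in HN by (apply pow_le; lra).
  assert (E : k2 ^ N = (k2 / k1) ^ N * k1 ^ N).
  { rewrite <- Rpow_mult_distr. f_equal. field. lra. }
  rewrite E in Q. set (q := (k2 / k1) ^ N) in *.
  assert (0 < q) by (apply pow_lt; lra).
  assert (Q' : c0 * (d / 2) <= M * q * (2 * PI)).
  { apply Rmult_le_reg_r with (k1 ^ N); [exact A1|]. lra. }
  assert (HN' : q * ((M + 1) * (2 * PI)) < c0 * (d / 2)).
  { apply Rlt_le_trans with (c0 * (d / 2) / ((M + 1) * (2 * PI)) * ((M + 1) * (2 * PI))).
    - apply Rmult_lt_compat_r; [nra|exact HN].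
    - right. field. split; lra. }
  nra.
Qed.

Lemma sin_add_half_pi (e x : R) : e = 1 \/ e = -1 -> sin (x + e * (PI / 2)) = e * cos x.
Proof.
  intros [-> | ->].
  - rewrite Rmult_1_l, sin_plus, cos_PI2, sin_PI2. ring.
  - replace (x + -1 * (PI / 2)) with (x - PI / 2) by ring.
    rewrite sin_minus, cos_PI2, sin_PI2. ring.
Qed.

Lemma cos_add_half_pi (e x : R) : e = 1 \/ e = -1 -> cos (x + e * (PI / 2)) = - e * sin x.
Proof.
  intros [-> | ->].
  - rewrite Rmult_1_l, cos_plus, cos_PI2, sin_PI2. ring.
  - replace (x + -1 * (PI / 2)) with (x - PI / 2) by ring.
    rewrite cos_minus, cos_PI2, sin_PI2. ring.
Qed.

(** The reflection t -> 2 pi - t, phi -> e pi - phi + 2 pi s preserves the equation and the initial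
    value of the fixed orbit of e pi/2. Hence cos phi is odd about t = pi and its integral over the
    period vanishes. *)
Lemma amp_2PI (al b c e : R) (s : Z) (phi : R -> R) :
  sol al b c (e * (PI / 2)) phi -> phi (2 * PI) = e * (PI / 2) + 2 * PI * IZR s ->
  e = 1 \/ e = -1 -> amp al phi (2 * PI) = 1.
Proof.
  intros H E He. assert (HPI := PI_RGT_0).
  assert (S : forall t, 0 <= t -> cos (phi (2 * PI - t)) = - cos (phi t)).
  { assert (H' : sol al b c (e * (PI / 2)) (fun t => e * PI - phi (2 * PI - t) + 2 * PI * IZR s)).
    { destruct H as [H0 H]. split.
      - rewrite Rminus_0_r, E. field.
      - intros t. auto_derive; [eexists; apply H|].
        rewrite (is_derive_unique (fun u : R => phi u) _ _ (H _)). unfold fld.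
        rewrite sin_period_Z.
        replace (sin (e * PI - phi (2 * PI - t))) with (sin (phi (2 * PI + - t))).
        + replace (cos (2 * PI + - t)) with (cos t).
          * ring.
          * rewrite <- (cos_neg t). rewrite <- (cos_period_Z (- t) 1). f_equal. ring.
        + destruct He as [-> | ->].
          * rewrite Rmult_1_l, <- sin_PI_x. reflexivity.
          * rewrite <- (sin_period_Z (-1 * PI - phi (2 * PI - t)) 1).
            replace (-1 * PI - phi (2 * PI - t) + 2 * PI * 1) with (PI - phi (2 * PI - t)) by ring.
            rewrite sin_PI_x. reflexivity. }
    intros t Ht. assert (U := sol_unique _ _ _ _ _ _ t Ht H H'). cbv beta in U.
    rewrite <- U, cos_period_Z. destruct He as [-> | ->].
    - rewrite Rmult_1_l, Rtrigo_facts.cos_pi_minus. ring.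
    - replace (-1 * PI - phi (2 * PI - t)) with (- (phi (2 * PI - t) + PI)) by ring.
      rewrite cos_neg, neg_cos. ring. }
  assert (A := fun t => amp_derive _ _ _ _ _ t H).
  assert (K := deriv_zero_eq (fun t => amp al phi (2 * PI - t) / amp al phi t) (fun _ => 0) 0 PI ltac:(lra)).
  cbv beta in K.
  replace (2 * PI - PI) with PI in K by ring.
  rewrite Rminus_0_r, amp_0 in K.
  replace (amp al phi PI / amp al phi PI) with 1 in K by (field; apply Rgt_not_eq, amp_pos).
  cut (1 = amp al phi (2 * PI) / 1); [lra|]. apply K; [clear K|reflexivity].
  intros t Ht. auto_derive.
  - conj_split; try ex_der. apply Rgt_not_eq, amp_pos.
  - rewrite !(is_derive_unique (fun u : R => amp al phi u) _ _ (A _)).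
    change (2 * PI + - t) with (2 * PI - t). rewrite S by lra.
    field. apply Rgt_not_eq, amp_pos.
Qed.

(** * Trigonometric sums *)

(** Integer indices let the shift k -> k + 1 and the reflection k -> L - k of the recurrence act on
    windows of any sign. *)
Fixpoint zsum (F : Z -> R) (k0 : Z) (n : nat) : R :=
  match n with
  | O => 0
  | S m => zsum F k0 m + F (k0 + Z.of_nat m)%Z
  end.

Lemma zsum_ext (F G : Z -> R) (k0 : Z) (n : nat) :
  (forall k, (k0 <= k < k0 + Z.of_nat n)%Z -> F k = G k) -> zsum F k0 n = zsum G k0 n.
Proof.
  induction n as [|n IH]; intros H; simpl; [reflexivity|].
  rewrite IH, (H (k0 + Z.of_nat n)%Z); [reflexivity|lia|intros; apply H; lia].
Qed.

Lemma zsum_linear (F G : Z -> R) (x y : R) (k0 : Z) (n : nat) :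
  zsum (fun k => x * F k + y * G k) k0 n = x * zsum F k0 n + y * zsum G k0 n.
Proof. induction n as [|n IH]; simpl; [ring|rewrite IH; ring]. Qed.

Lemma zsum_0 (k0 : Z) (n : nat) : zsum (fun _ => 0) k0 n = 0.
Proof. induction n as [|n IH]; simpl; [reflexivity|rewrite IH; ring]. Qed.

Lemma zsum_shift (F : Z -> R) (k0 : Z) (n : nat) :
  zsum (fun k => F (k + 1)%Z) k0 n = zsum F k0 n + F (k0 + Z.of_nat n)%Z - F k0.
Proof.
  induction n as [|n IH]; cbn [zsum].
  - rewrite Z.add_0_r. ring.
  - rewrite IH. replace (k0 + Z.of_nat n + 1)%Z with (k0 + Z.of_nat (S n))%Z by lia. ring.
Qed.

Lemma zsum_front (F : Z -> R) (k0 : Z) (n : nat) :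
  zsum F k0 (S n) = F k0 + zsum F (k0 + 1) n.
Proof.
  induction n as [|n IH]; [simpl; rewrite Z.add_0_r; ring|].
  cbn [zsum] in *. rewrite IH.
  replace (k0 + 1 + Z.of_nat n)%Z with (k0 + Z.of_nat (S n))%Z by lia. ring.
Qed.

Lemma zsum_reverse (F : Z -> R) (m k0 : Z) (n : nat) :
  zsum (fun k => F (m - k)%Z) k0 n = zsum F (m - k0 - Z.of_nat n + 1) n.
Proof.
  induction n as [|n IH]; [reflexivity|].
  rewrite (zsum_front F). cbn [zsum]. rewrite IH.
  replace (m - k0 - Z.of_nat (S n) + 1 + 1)%Z with (m - k0 - Z.of_nat n + 1)%Z by lia.
  replace (m - k0 - Z.of_nat (S n) + 1)%Z with (m - (k0 + Z.of_nat n))%Z by lia. ring.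
Qed.

Lemma zsum_derive (F : Z -> R -> R) (dF : Z -> R) (k0 : Z) (n : nat) (t : R) :
  (forall k, is_derive (F k) t (dF k)) ->
  is_derive (fun u => zsum (fun k => F k u) k0 n) t (zsum dF k0 n).
Proof.
  intros H. induction n as [|n IH]; simpl.
  - apply @is_derive_const.
  - apply @is_derive_plus; [exact IH|apply H].
Qed.

Lemma zsum_continuous (F : Z -> R -> R) (k0 : Z) (n : nat) (t : R) :
  (forall k, continuous (F k) t) -> continuous (fun u => zsum (fun k => F k u) k0 n) t.
Proof.
  intros H. induction n as [|n IH]; simpl.
  - apply continuous_const.
  - apply @continuous_plus; [exact IH|apply H].
Qed.

Lemma zsum_RInt (F : Z -> R -> R) (k0 : Z) (n : nat) (a b : R) :
  (forall k t, continuous (F k) t) ->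
  RInt (fun u => zsum (fun k => F k u) k0 n) a b = zsum (fun k => RInt (F k) a b) k0 n.
Proof.
  intros H.
  rewrite (RInt_derivative (fun u => zsum (fun k => RInt (F k) a u) k0 n)).
  - replace (zsum (fun k => RInt (F k) a a) k0 n) with (zsum (fun _ => 0) k0 n).
    + rewrite zsum_0. apply Rminus_0_r.
    + apply zsum_ext. intros k _. now rewrite RInt_point.
  - intros t. apply zsum_derive. intros k. now apply antiderivative_continuous.
  - intros t. apply zsum_continuous. intros k. apply H.
Qed.

Lemma zsum_single (F : Z -> R) (j k0 : Z) (n : nat) :
  (k0 <= j < k0 + Z.of_nat n)%Z -> (forall k, k <> j -> F k = 0) -> zsum F k0 n = F j.
Proof.
  intros Hj HF. induction n as [|n IH]; [lia|]. cbn [zsum].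
  destruct (Z.eq_dec j (k0 + Z.of_nat n)) as [E|N].
  - rewrite <- E. replace (zsum F k0 n) with 0; [ring|].
    symmetry. rewrite <- (zsum_0 k0 n). apply zsum_ext. intros k Hk. apply HF. lia.
  - rewrite IH, (HF (k0 + Z.of_nat n)%Z); [ring|lia|lia].
Qed.

Definition trig_cos (t : Z -> R) (k0 : Z) (n : nat) (u : R) : R :=
  zsum (fun k => t k * cos (IZR k * u)) k0 n.

Definition trig_sin (t : Z -> R) (k0 : Z) (n : nat) (u : R) : R :=
  zsum (fun k => t k * sin (IZR k * u)) k0 n.

Lemma trig_combine_cos (t : Z -> R) (k0 : Z) (n : nat) (u x : R) :
  zsum (fun k => t k * cos (IZR k * u - x)) k0 n =
  cos x * trig_cos t k0 n u + sin x * trig_sin t k0 n u.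
Proof.
  unfold trig_cos, trig_sin. rewrite <- zsum_linear. apply zsum_ext.
  intros k _. rewrite cos_minus. ring.
Qed.

Lemma trig_combine_sin (t : Z -> R) (k0 : Z) (n : nat) (u x : R) :
  zsum (fun k => t k * sin (IZR k * u - x)) k0 n =
  cos x * trig_sin t k0 n u - sin x * trig_cos t k0 n u.
Proof.
  unfold trig_cos, trig_sin.
  replace (cos x * zsum (fun k => t k * sin (IZR k * u)) k0 n - sin x * zsum (fun k => t k * cos (IZR k * u)) k0 n)
    with (cos x * zsum (fun k => t k * sin (IZR k * u)) k0 n + (- sin x) * zsum (fun k => t k * cos (IZR k * u)) k0 n) by ring.
  rewrite <- zsum_linear. apply zsum_ext.
  intros k _. rewrite sin_minus. ring.
Qed.

(* With z = exp(i u) and G = sum t_k z^k, the recurrence says that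
   -i G' = - (mu / z) G + kap z^L conj(G), up to the two end terms. *)
Lemma trig_sum_system (t : Z -> R) (mu kap : R) (L k0 : Z) (n : nat) (u : R) :
  L = (2 * k0 + Z.of_nat n - 1)%Z ->
  (forall k, IZR k * t k + mu * t (k + 1)%Z = kap * t (L - k)%Z) ->
  let P := trig_cos t k0 n u in let Q := trig_sin t k0 n u in
  let x := IZR L * u in let k1 := (k0 + Z.of_nat n)%Z in
  is_derive (trig_cos t k0 n) u
    (mu * (cos u * Q - sin u * P) - kap * (sin x * P - cos x * Q)
     + mu * (t k1 * sin (IZR k1 * u - u) - t k0 * sin (IZR k0 * u - u))) /\
  is_derive (trig_sin t k0 n) u
    (kap * (cos x * P + sin x * Q) - mu * (cos u * P + sin u * Q)
     - mu * (t k1 * cos (IZR k1 * u - u) - t k0 * cos (IZR k0 * u - u))).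
Proof.
  intros HL Hr P Q x k1.
  (* The condition on [L] makes the window invariant under k -> L - k; only the shift k -> k + 1
     leaves it, and this produces the two end terms. *)
  assert (HR : forall F : Z -> R, zsum (fun k => F (L - k)%Z) k0 n = zsum F k0 n).
  { intros F. rewrite zsum_reverse. f_equal. lia. }
  split.
  - replace (mu * (cos u * Q - sin u * P) - kap * (sin x * P - cos x * Q)
     + mu * (t k1 * sin (IZR k1 * u - u) - t k0 * sin (IZR k0 * u - u)))
    with (zsum (fun k => t k * (- IZR k * sin (IZR k * u))) k0 n).
    + apply (zsum_derive (fun k u => t k * cos (IZR k * u))). intros k.
      auto_derive; [exact I|ring].
    + transitivity (zsum (fun k => mu * (t (k + 1)%Z * sin (IZR (k + 1) * u - u))
         + kap * (t (L - k)%Z * sin (IZR (L - k) * u - x))) k0 n).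
      * apply zsum_ext. intros k _.
        replace (IZR (k + 1) * u - u) with (IZR k * u) by (rewrite plus_IZR; ring).
        replace (IZR (L - k) * u - x) with (- (IZR k * u)) by (unfold x; rewrite minus_IZR; ring).
        rewrite sin_neg. specialize (Hr k).
        replace (t k * (- IZR k * sin (IZR k * u))) with (- (IZR k * t k) * sin (IZR k * u)) by ring.
        replace (IZR k * t k) with (kap * t (L - k)%Z - mu * t (k + 1)%Z) by lra. ring.
      * rewrite zsum_linear.
        rewrite (zsum_shift (fun j => t j * sin (IZR j * u - u))).
        rewrite (HR (fun j => t j * sin (IZR j * u - x))).
        rewrite !trig_combine_sin. fold P Q k1. ring.
  - replace (kap * (cos x * P + sin x * Q) - mu * (cos u * P + sin u * Q)
     - mu * (t k1 * cos (IZR k1 * u - u) - t k0 * cos (IZR k0 * u - u)))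
    with (zsum (fun k => t k * (IZR k * cos (IZR k * u))) k0 n).
    + apply (zsum_derive (fun k u => t k * sin (IZR k * u))). intros k.
      auto_derive; [exact I|ring].
    + transitivity (zsum (fun k => (- mu) * (t (k + 1)%Z * cos (IZR (k + 1) * u - u))
         + kap * (t (L - k)%Z * cos (IZR (L - k) * u - x))) k0 n).
      * apply zsum_ext. intros k _.
        replace (IZR (k + 1) * u - u) with (IZR k * u) by (rewrite plus_IZR; ring).
        replace (IZR (L - k) * u - x) with (- (IZR k * u)) by (unfold x; rewrite minus_IZR; ring).
        rewrite cos_neg. specialize (Hr k).
        replace (t k * (IZR k * cos (IZR k * u))) with ((IZR k * t k) * cos (IZR k * u)) by ring.
        replace (IZR k * t k) with (kap * t (L - k)%Z - mu * t (k + 1)%Z) by lra. ring.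
      * rewrite zsum_linear.
        rewrite (zsum_shift (fun j => t j * cos (IZR j * u - u))).
        rewrite (HR (fun j => t j * cos (IZR j * u - x))).
        rewrite !trig_combine_cos. fold P Q k1. ring.
Qed.

Lemma RInt_cos_period (m : Z) :
  RInt (fun u => cos (IZR m * u)) 0 (2 * PI) = if Z.eq_dec m 0 then 2 * PI else 0.
Proof.
  destruct (Z.eq_dec m 0) as [->|N].
  - rewrite (RInt_ext _ (fun _ => 1)).
    + rewrite RInt_const. unfold scal; simpl; unfold mult; simpl. ring.
    + intros u _. now rewrite Rmult_0_l, cos_0.
  - assert (Hm : IZR m <> 0) by now apply not_0_IZR.
    rewrite (RInt_derivative (fun u => sin (IZR m * u) / IZR m)).
    + rewrite Rmult_0_r, sin_0. rewrite (sin_eq_0_1 (IZR m * (2 * PI))).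
      * match goal with |- ?v = ?w => change (@eq R v w) end. field. exact Hm.
      * exists (2 * m)%Z. rewrite mult_IZR. ring.
    + intros u. auto_derive; [exact I|]. field. exact Hm.
    + intros u. der_cont.
Qed.

Lemma trig_coefficient (t : Z -> R) (k0 j : Z) (n : nat) :
  (k0 <= j < k0 + Z.of_nat n)%Z ->
  RInt (fun u => cos (IZR j * u) * trig_cos t k0 n u + sin (IZR j * u) * trig_sin t k0 n u) 0 (2 * PI)
  = 2 * PI * t j.
Proof.
  intros Hj.
  rewrite (RInt_ext _ (fun u => zsum (fun k => t k * cos (IZR (k - j) * u)) k0 n)).
  - rewrite (zsum_RInt (fun k u => t k * cos (IZR (k - j) * u))).
    + assert (E : forall k, RInt (fun u => t k * cos (IZR (k - j) * u)) 0 (2 * PI)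
        = t k * if Z.eq_dec (k - j) 0 then 2 * PI else 0).
      { intros k. rewrite <- RInt_cos_period.
        apply (RInt_scal (fun u => cos (IZR (k - j) * u))).
        apply (ex_RInt_continuous (fun u => cos (IZR (k - j) * u))). intros; der_cont. }
      rewrite (zsum_single _ j); [|exact Hj|].
      * rewrite E, Z.sub_diag. simpl. match goal with |- ?v = ?w => change (@eq R v w) end. ring.
      * intros k Hk. rewrite E. destruct (Z.eq_dec (k - j) 0); [lia|]. apply Rmult_0_r.
    + intros. der_cont.
  - intros u _. rewrite <- trig_combine_cos. apply zsum_ext. intros k _.
    rewrite minus_IZR. do 2 f_equal. ring.
Qed.

(** * Fourier coefficients of a periodic orbit *)

Definition chi (l : Z) (e : R) (phi : R -> R) (t : R) : R :=
  (IZR l * t - phi t + e * (PI / 2)) / 2.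

Lemma chi_derive (al c x e : R) (l : Z) (phi : R -> R) (t : R) :
  sol al (IZR l) c x phi ->
  is_derive (chi l e phi) t ((al * sin (phi t) - c * cos t) / 2).
Proof.
  intros [_ H]. unfold chi. auto_derive; [ex_der|].
  rewrite (is_derive_unique (fun u : R => phi u) _ _ (H t)). unfold fld. field.
Qed.

Lemma sin_of_chi (l : Z) (e : R) (phi : R -> R) (t : R) : e = 1 \/ e = -1 ->
  sin (phi t) = e * cos (IZR l * t - 2 * chi l e phi t).
Proof.
  intros He. rewrite <- sin_add_half_pi by exact He. f_equal. unfold chi. field.
Qed.

Lemma cos_of_chi (l : Z) (e : R) (phi : R -> R) (t : R) : e = 1 \/ e = -1 ->
  cos (phi t) = - e * sin (IZR l * t - 2 * chi l e phi t).
Proof.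
  intros He. rewrite <- cos_add_half_pi by exact He. f_equal. unfold chi. field.
Qed.

(** nu = c/2 gives the integrand of the Fourier coefficients; nu = - c/2 gives the modulus of an
    exact solution of the linear system that E satisfies on the circle. *)
Definition weight (al nu : R) (phi : R -> R) (t : R) : R := amp al phi t * exp (nu * cos t).

Lemma weight_pos (al nu : R) (phi : R -> R) (t : R) : 0 < weight al nu phi t.
Proof. apply Rmult_lt_0_compat; [apply amp_pos|apply exp_pos]. Qed.

Lemma weight_derive (al b c x nu : R) (phi : R -> R) (t : R) :
  sol al b c x phi ->
  is_derive (weight al nu phi) t
    (weight al nu phi t * (al / 2 * cos (phi t) - nu * sin t)).
Proof.
  intros H. assert (A := fun t => amp_derive _ _ _ _ _ t H).
  unfold weight. auto_derive; [ex_der|].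
  rewrite (is_derive_unique (fun u : R => amp al phi u) _ _ (A t)). ring.
Qed.

(** Unnormalised, and only the real part: integrating the derivative of the weight times sin(chi - k
    t) yields a recurrence among these cosine integrals alone. *)
Definition coef (al c e : R) (l : Z) (phi : R -> R) (k : Z) : R :=
  RInt (fun t => weight al (c / 2) phi t * cos (chi l e phi t - IZR k * t)) 0 (2 * PI).

Lemma coef_integrand_continuous (al c x e nu y : R) (l : Z) (phi : R -> R) (t : R) :
  sol al (IZR l) c x phi ->
  continuous (fun t => weight al nu phi t * cos (chi l e phi t - y * t)) t.
Proof.
  intros H. assert (A := fun t => weight_derive _ _ _ _ nu _ t H).
  assert (B := fun t => chi_derive _ _ _ e _ _ t H).
  der_cont; ex_der.
Qed.

Lemma coef_recurrence (al c e : R) (l s : Z) (phi : R -> R) (k : Z) :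
  e = 1 \/ e = -1 -> sol al (IZR l) c (e * (PI / 2)) phi ->
  phi (2 * PI) = e * (PI / 2) + 2 * PI * IZR s ->
  IZR k * coef al c e l phi k + c / 2 * coef al c e l phi (k + 1)
  = e * (al / 2) * coef al c e l phi (l - k).
Proof.
  intros He H Hs.
  assert (A := fun t => weight_derive _ _ _ _ (c / 2) _ t H).
  assert (B := fun t => chi_derive _ _ _ e _ _ t H).
  assert (C := fun y t => coef_integrand_continuous al c _ e (c / 2) y l phi t H).
  unfold coef.
  set (g := fun k t => weight al (c / 2) phi t * cos (chi l e phi t - IZR k * t)).
  assert (E := RInt_linear3 (g (l - k)%Z) (g (k + 1)%Z) (g k) (e * (al / 2)) (- (c / 2)) (- IZR k)
    0 (2 * PI) (C _) (C _) (C _)).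
  assert (Z : RInt (fun t => e * (al / 2) * g (l - k)%Z t + - (c / 2) * g (k + 1)%Z t + - IZR k * g k t)
    0 (2 * PI) = 0).
  { rewrite (RInt_derivative (fun t => weight al (c / 2) phi t * sin (chi l e phi t - IZR k * t))).
    - rewrite Rmult_0_r, Rminus_0_r.
      replace (chi l e phi 0) with 0 by (unfold chi; destruct H as [-> _]; field).
      rewrite (sin_eq_0_1 (chi l e phi (2 * PI) - IZR k * (2 * PI))).
      + rewrite sin_0. match goal with |- ?v = ?w => change (@eq R v w) end. ring.
      (* chi advances by (l - s) pi over the period, so the boundary terms vanish. *)
      + exists (l - s - 2 * k)%Z. unfold chi. rewrite Hs, !minus_IZR, mult_IZR. field.
    - intros t. auto_derive; [ex_der|].
      rewrite (is_derive_unique (fun u : R => weight al (c / 2) phi u) _ _ (A t)),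
        (is_derive_unique (fun u : R => chi l e phi u) _ _ (B t)).
      unfold g. rewrite (sin_of_chi l e phi t He), (cos_of_chi l e phi t He).
      set (W := weight al (c / 2) phi t). set (X := chi l e phi t).
      set (z := IZR l * t - 2 * X). set (y := X - IZR k * t).
      replace (X + - (IZR k * t)) with y by (unfold y; ring).
      replace (X - IZR (l - k) * t) with (- (z + y)) by (unfold z, y; rewrite minus_IZR; ring).
      replace (X - IZR (k + 1) * t) with (y - t) by (unfold y; rewrite plus_IZR; ring).
      rewrite cos_neg, (cos_plus z y), (cos_minus y t). field.
    - intros t. apply @continuous_plus; [apply @continuous_plus|];
      match goal with |- continuous (fun _ => ?k * g ?w _) _ =>
        apply (continuous_mult (fun _ : R => k) (g w)); [apply continuous_const|apply C] end. }
  rewrite Z in E. fold (g k) (g (k + 1)%Z) (g (l - k)%Z). lra.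
Qed.

Lemma coef_bound (al c e x : R) (l : Z) (phi : R -> R) :
  sol al (IZR l) c x phi -> exists G, 0 <= G /\ forall k, Rabs (coef al c e l phi k) <= G.
Proof.
  intros H.
  assert (A : forall t, continuous (weight al (c / 2) phi) t).
  { intros t. apply (ex_derive_continuous (weight al (c / 2) phi)).
    eexists. eapply weight_derive. exact H. }
  destruct (continuous_bounded _ 0 (2 * PI) A) as [M [HM BM]].
  assert (HPI := PI_RGT_0).
  exists (M * (2 * PI - 0)). split; [nra|]. intros k. unfold coef.
  apply RInt_abs_bound; [lra| |].
  - intros t. eapply coef_integrand_continuous. exact H.
  - intros t Ht. rewrite Rabs_mult. rewrite <- (Rmult_1_r M).
    apply Rmult_le_compat; try apply Rabs_pos; [now apply BM|apply Rabs_cos_le].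
Qed.

(** Here parity enters: chi runs from 0 to a multiple of 2 pi, so weight times cos chi is positive
    at both ends of the period, where the kernels concentrate. *)
Lemma coef_not_all_zero (al c e : R) (l s : Z) (phi : R -> R) :
  sol al (IZR l) c (e * (PI / 2)) phi ->
  phi (2 * PI) = e * (PI / 2) + 2 * PI * IZR s -> Z.Even (s - l) ->
  ~ (forall k, coef al c e l phi k = 0).
Proof.
  intros H Hs [q Hq].
  apply fourier_coefficients_not_all_zero.
  - intros t. apply (ex_derive_continuous (weight al (c / 2) phi)).
    eexists. eapply weight_derive. exact H.
  - intros t. apply (ex_derive_continuous (chi l e phi)).
    eexists. eapply chi_derive. exact H.
  - replace (chi l e phi 0) with 0 by (unfold chi; destruct H as [-> _]; field).
    rewrite cos_0, Rmult_1_r. apply weight_pos.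
  - replace (chi l e phi (2 * PI)) with (0 + 2 * PI * IZR (- q)).
    + rewrite cos_period_Z, cos_0, Rmult_1_r. apply weight_pos.
    + unfold chi. rewrite Hs. replace s with (l + 2 * q)%Z by lia.
      rewrite plus_IZR, mult_IZR, opp_IZR. field.
Qed.

(** * The sign change in the recurrence and the orbit of the opposite point *)

Lemma Rabs_le_of_sqr (x y : R) : 0 <= y -> x * x <= y * y -> Rabs x <= y.
Proof.
  intros Hy H. rewrite <- (Rabs_pos_eq y) by exact Hy. now apply Rsqr_le_abs_0.
Qed.

(* If psi were not fixed, its Wronskian with the truncated sums would force these
   sums to be small at 0, hence everywhere, so that their coefficients vanish. *)
Lemma truncations_force_zero (al c e : R) (l : Z) (psi : R -> R) (t : Z -> R) (B : R) :
  e = 1 \/ e = -1 -> (1 <= l)%Z -> 0 < c ->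
  sol al (IZR l) c (e * (PI / 2)) psi ->
  sin (chi l e psi (2 * PI)) <> 0 ->
  (forall k, IZR k * t k + c / 2 * t (k + 1)%Z = e * (al / 2) * t (l - k)%Z) ->
  (forall k, Rabs (IZR k * t k) <= B) ->
  forall j, t j = 0.
Proof.
  intros He Hl Hc H HS Hr HB j.
  assert (HPI := PI_RGT_0).
  assert (HB0 : 0 <= B) by (eapply Rle_trans; [apply Rabs_pos|apply (HB 0%Z)]).
  set (mu := c / 2) in *. set (kap := e * (al / 2)) in *.
  assert (Hmu : 0 < mu) by (unfold mu; lra).
  set (X := chi l e psi) in *. set (W := weight al (- mu) psi).
  assert (DW : forall u, is_derive W u (W u * (al / 2 * cos (psi u) + mu * sin u))).
  { intros u. replace (al / 2 * cos (psi u) + mu * sin u) with (al / 2 * cos (psi u) - (- mu) * sin u) by ring.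
    eapply weight_derive. exact H. }
  assert (DX : forall u, is_derive X u ((al * sin (psi u) - c * cos u) / 2)).
  { intros u. eapply chi_derive. exact H. }
  assert (X0 : X 0 = 0) by (unfold X, chi; destruct H as [-> _]; field).
  destruct (continuous_bounded W 0 (2 * PI)) as [M [HM BM]].
  { intros u. apply (ex_derive_continuous W). eexists; apply DW. }
  set (D := W (2 * PI) * Rabs (sin (X (2 * PI)))).
  assert (HD : 0 < D).
  { apply Rmult_lt_0_compat; [apply weight_pos|now apply Rabs_pos_lt]. }
  (* C1 will bound |P 0| / eta through the Wronskian, and C2 is the Gronwall constant for P^2 + Q^2
     over one period; neither depends on the truncation. *)
  set (C1 := M * 2 * (2 * PI) / D).
  assert (HC1 : 0 <= C1) by (apply Rle_mult_inv_pos; [nra|exact HD]).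
  set (K := 2 * mu + 4 * Rabs kap + 1).
  assert (HK : 0 <= K) by (unfold K; assert (0 <= Rabs kap) by apply Rabs_pos; lra).
  set (C2 := (C1 * C1 + 2 * (2 * PI)) * exp (K * (2 * PI))).
  assert (HC2 : 0 <= C2).
  { apply Rmult_le_pos; [nra|left; apply exp_pos]. }
  assert (Main : forall N : nat, (Z.abs j <= Z.of_nat N)%Z -> (1 <= N)%nat ->
    Rabs (t j) * INR N <= (C2 + 1) * (mu * (2 * B))).
  { intros N HN HN1.
    (* The window is [-N, N + l], symmetric under k -> l - k. *)
    set (k0 := (- Z.of_nat N)%Z). set (n := (2 * N + Z.to_nat l + 1)%nat).
    set (k1 := (k0 + Z.of_nat n)%Z).
    set (P := trig_cos t k0 n). set (Q := trig_sin t k0 n).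
    set (eta := mu * (Rabs (t k1) + Rabs (t k0))).
    assert (Heta : 0 <= eta).
    { unfold eta. assert (0 <= Rabs (t k1)) by apply Rabs_pos.
      assert (0 <= Rabs (t k0)) by apply Rabs_pos. nra. }
    assert (Eeta : eta * INR N <= mu * (2 * B)).
    { assert (HNR : 1 <= INR N) by (apply (le_INR 1 N); exact HN1).
      assert (E0 : Rabs (t k0) * INR N <= B).
      { eapply Rle_trans; [|apply (HB k0)]. rewrite Rabs_mult.
        unfold k0. rewrite opp_IZR, Rabs_Ropp, <- INR_IZR_INZ, (Rabs_pos_eq (INR N)) by lra. lra. }
      assert (E1 : Rabs (t k1) * INR N <= B).
      { eapply Rle_trans; [|apply (HB k1)]. rewrite Rabs_mult, Rmult_comm.
        apply Rmult_le_compat_r; [apply Rabs_pos|].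
        rewrite INR_IZR_INZ. rewrite Rabs_pos_eq; apply IZR_le; unfold k1, k0, n; lia. }
      unfold eta. nra. }
    set (eP := fun u => mu * (t k1 * sin (IZR k1 * u - u) - t k0 * sin (IZR k0 * u - u))).
    set (eQ := fun u => - (mu * (t k1 * cos (IZR k1 * u - u) - t k0 * cos (IZR k0 * u - u)))).
    assert (B1 : forall a b p q : R, Rabs p <= 1 -> Rabs q <= 1 ->
      Rabs (mu * (a * p - b * q)) <= mu * (Rabs a + Rabs b)).
    { intros a b p q Hp Hq. rewrite Rabs_mult, (Rabs_pos_eq mu) by lra.
      apply Rmult_le_compat_l; [lra|]. eapply Rle_trans; [apply Rabs_triang|].
      rewrite Rabs_Ropp, !Rabs_mult.
      assert (0 <= Rabs a) by apply Rabs_pos. assert (0 <= Rabs b) by apply Rabs_pos. nra. }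
    assert (BeP : forall u, Rabs (eP u) <= eta).
    { intros u. apply B1; apply Rabs_sin_le. }
    assert (BeQ : forall u, Rabs (eQ u) <= eta).
    { intros u. unfold eQ. rewrite Rabs_Ropp. apply B1; apply Rabs_cos_le. }
    assert (DPQ := fun u => trig_sum_system t mu kap l k0 n u
      ltac:(unfold k0, n; lia) Hr). cbv zeta in DPQ. fold P Q k1 in DPQ.
    assert (DP : forall u, is_derive P u (mu * (cos u * Q u - sin u * P u)
      - kap * (sin (IZR l * u) * P u - cos (IZR l * u) * Q u) + eP u)) by (intros u; apply DPQ).
    assert (DQ : forall u, is_derive Q u (kap * (cos (IZR l * u) * P u + sin (IZR l * u) * Q u)
      - mu * (cos u * P u + sin u * Q u) + eQ u)) by (intros u; apply DPQ).
    clear DPQ.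
    assert (Q0 : Q 0 = 0).
    { unfold Q, trig_sin. transitivity (zsum (fun _ => 0) k0 n); [|apply zsum_0]. apply zsum_ext.
      intros k _. rewrite Rmult_0_r, sin_0. ring. }
    assert (Q2 : Q (2 * PI) = 0).
    { unfold Q, trig_sin. transitivity (zsum (fun _ => 0) k0 n); [|apply zsum_0]. apply zsum_ext.
      intros k _. rewrite (sin_eq_0_1 (IZR k * (2 * PI))); [ring|].
      exists (2 * k)%Z. rewrite mult_IZR. ring. }
    assert (P2 : P (2 * PI) = P 0).
    { unfold P, trig_cos. apply zsum_ext. intros k _. f_equal.
      rewrite <- (cos_period_Z (IZR k * 0) k). f_equal. ring. }
    (* W (P sin X - Q cos X) pairs the truncated sum with the orbit of psi; for an exact solution it
       would be constant, here only the end terms survive in its derivative. It runs from 0 to W(2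
       pi) P(0) sin X(2 pi), because P is periodic and Q vanishes at both ends. *)
    assert (HP0 : Rabs (P 0) <= C1 * eta).
    { assert (HW := deriv_bound_le (fun u => W u * (P u * sin (X u) - Q u * cos (X u)))
        (fun u => W u * (eP u * sin (X u) - eQ u * cos (X u))) (M * (2 * eta)) 0 (2 * PI) ltac:(lra)).
      cbv beta in HW. rewrite X0, Q0, Q2, P2, sin_0 in HW.
      replace (W (2 * PI) * (P 0 * sin (X (2 * PI)) - 0 * cos (X (2 * PI))) - W 0 * (P 0 * 0 - 0 * cos 0))
        with (W (2 * PI) * (P 0 * sin (X (2 * PI)))) in HW by ring.
      rewrite !Rabs_mult, (Rabs_pos_eq (W (2 * PI))) in HW by (left; apply weight_pos).
      assert (HW' : W (2 * PI) * (Rabs (P 0) * Rabs (sin (X (2 * PI)))) <= M * (2 * eta) * (2 * PI - 0)).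
      { apply HW; clear HW.
        - intros u _. auto_derive; [ex_der|].
          rewrite (is_derive_unique (fun u : R => W u) _ _ (DW u)),
            (is_derive_unique (fun u : R => X u) _ _ (DX u)),
            (is_derive_unique (fun u : R => P u) _ _ (DP u)),
            (is_derive_unique (fun u : R => Q u) _ _ (DQ u)).
          rewrite (sin_of_chi l e psi u He), (cos_of_chi l e psi u He). fold X.
          unfold kap. replace c with (2 * mu) by (unfold mu; field).
          set (y := X u). set (w := IZR l * u - y).
          replace (IZR l * u - 2 * y) with (w - y) by (unfold w; ring).
          replace (IZR l * u) with (w + y) by (unfold w; ring).
          rewrite cos_plus, sin_plus, cos_minus, sin_minus. field.
        - intros u Hu. rewrite Rabs_mult. apply Rmult_le_compat; try apply Rabs_pos; [now apply BM|].
          eapply Rle_trans; [apply Rabs_triang|]. rewrite Rabs_Ropp, !Rabs_mult.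
          assert (a1 := BeP u). assert (a2 := BeQ u).
          assert (a3 := Rabs_sin_le (X u)). assert (a4 := Rabs_cos_le (X u)).
          assert (0 <= Rabs (eP u)) by apply Rabs_pos. assert (0 <= Rabs (eQ u)) by apply Rabs_pos.
          nra. }
      apply Rmult_le_reg_r with D; [exact HD|].
      replace (C1 * eta * D) with (M * (2 * eta) * (2 * PI - 0)) by (unfold C1; field; lra).
      replace (Rabs (P 0) * D) with (W (2 * PI) * (Rabs (P 0) * Rabs (sin (X (2 * PI))))) by (unfold D; ring).
      exact HW'. }
    assert (HG : forall u, 0 <= u <= 2 * PI -> P u * P u + Q u * Q u <= C2 * (eta * eta)).
    { intros u Hu.
      assert (G := gronwall (fun u => P u * P u + Q u * Q u)
        (fun u => 2 * (mu * (- sin u * (P u * P u + Q u * Q u))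
           + kap * (sin (IZR l * u) * (Q u * Q u - P u * P u) + 2 * cos (IZR l * u) * (P u * Q u))
           + P u * eP u + Q u * eQ u)) K (2 * (eta * eta)) u HK ltac:(nra) ltac:(lra)).
      cbv beta in G. rewrite Q0 in G.
      eapply Rle_trans; [apply G; clear G|].
      - intros v _. auto_derive; [ex_der|].
        rewrite (is_derive_unique (fun u : R => P u) _ _ (DP v)),
            (is_derive_unique (fun u : R => Q u) _ _ (DQ v)). ring.
      - intros v _. set (p := P v). set (q := Q v).
        assert (a1 := BeP v). assert (a2 := BeQ v).
        assert (b1 : 2 * (p * eP v) <= p * p + eta * eta).
        { assert (eP v * eP v <= eta * eta) by (apply Rsqr_le_abs_1; rewrite (Rabs_pos_eq eta) by lra; exact a1).
          assert (0 <= (p - eP v) * (p - eP v)) by apply Rle_0_sqr. nra. }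
        assert (b2 : 2 * (q * eQ v) <= q * q + eta * eta).
        { assert (eQ v * eQ v <= eta * eta) by (apply Rsqr_le_abs_1; rewrite (Rabs_pos_eq eta) by lra; exact a2).
          assert (0 <= (q - eQ v) * (q - eQ v)) by apply Rle_0_sqr. nra. }
        assert (pq : 0 <= p * p + q * q) by (assert (0 <= p * p) by apply Rle_0_sqr; assert (0 <= q * q) by apply Rle_0_sqr; lra).
        assert (b3 : - sin v * (p * p + q * q) <= p * p + q * q).
        { assert (s := SIN_bound v). nra. }
        assert (b4 : kap * (sin (IZR l * v) * (q * q - p * p) + 2 * cos (IZR l * v) * (p * q))
           <= Rabs kap * (2 * (p * p + q * q))).
        { eapply Rle_trans; [apply Rle_abs|]. rewrite Rabs_mult.
          apply Rmult_le_compat_l; [apply Rabs_pos|].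
          eapply Rle_trans; [apply Rabs_triang|]. rewrite !Rabs_mult.
          assert (s1 := Rabs_sin_le (IZR l * v)). assert (s2 := Rabs_cos_le (IZR l * v)).
          assert (Rabs (q * q - p * p) <= p * p + q * q).
          { apply Rabs_le. assert (0 <= p * p) by apply Rle_0_sqr. assert (0 <= q * q) by apply Rle_0_sqr. lra. }
          assert (2 * (Rabs p * Rabs q) <= p * p + q * q).
          { rewrite <- Rabs_mult. assert (0 <= (p - q) * (p - q)) by apply Rle_0_sqr.
            assert (0 <= (p + q) * (p + q)) by apply Rle_0_sqr.
            unfold Rabs; destruct Rcase_abs; nra. }
          rewrite (Rabs_pos_eq 2) by lra.
          assert (0 <= Rabs p * Rabs q) by (apply Rmult_le_pos; apply Rabs_pos).
          assert (0 <= Rabs (q * q - p * p)) by apply Rabs_pos. nra. }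
        unfold K. nra.
      - unfold C2.
        replace ((C1 * C1 + 2 * (2 * PI)) * exp (K * (2 * PI)) * (eta * eta))
          with ((C1 * eta * (C1 * eta) + 2 * (eta * eta) * (2 * PI)) * exp (K * (2 * PI))) by ring.
        apply Rmult_le_compat.
        + assert (0 <= P 0 * P 0) by apply Rle_0_sqr. nra.
        + left; apply exp_pos.
        + assert (P 0 * P 0 <= C1 * eta * (C1 * eta)).
          { apply Rsqr_le_abs_1. rewrite (Rabs_pos_eq (C1 * eta)) by nra. exact HP0. }
          nra.
        + destruct (Req_dec (K * u) (K * (2 * PI))) as [->|Hn]; [lra|].
          left; apply exp_increasing. nra. }
    (* The sums are O(eta) on the whole period, hence so is each of their coefficients, while eta N
       stays bounded. *)
    assert (HT : Rabs (2 * PI * t j) <= (C2 + 1) * eta * (2 * PI - 0)).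
    { rewrite <- (trig_coefficient t k0 j n) by (unfold k0, n; lia).
      fold P Q. apply RInt_abs_bound; [lra| |].
      - intros u. der_cont; ex_der.
      - intros u Hu. specialize (HG u Hu). apply Rabs_le_of_sqr; [nra|].
        set (p := P u) in *. set (q := Q u) in *. set (cc := cos (IZR j * u)). set (ss := sin (IZR j * u)).
        assert (T : ss * ss + cc * cc = 1) by apply sin2_cos2.
        apply Rle_trans with (p * p + q * q).
        + assert (0 <= (cc * q - ss * p) * (cc * q - ss * p)) by apply Rle_0_sqr.
          replace (p * p + q * q) with ((ss * ss + cc * cc) * (p * p + q * q)) by (rewrite T; ring).
          nra.
        + eapply Rle_trans; [exact HG|].
          replace ((C2 + 1) * eta * ((C2 + 1) * eta)) with ((C2 + 1) * (C2 + 1) * (eta * eta)) by ring.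
          apply Rmult_le_compat_r; nra. }
    rewrite Rabs_mult, (Rabs_pos_eq (2 * PI)) in HT by lra.
    assert (HT' : Rabs (t j) <= (C2 + 1) * eta).
    { apply Rmult_le_reg_l with (2 * PI); lra. }
    assert (0 <= INR N) by apply pos_INR.
    apply Rle_trans with ((C2 + 1) * eta * INR N); [apply Rmult_le_compat_r; lra|].
    rewrite Rmult_assoc. apply Rmult_le_compat_l; lra. }
  destruct (Req_dec (t j) 0) as [E|E]; [exact E|exfalso].
  assert (Hp : 0 < Rabs (t j)) by now apply Rabs_pos_lt.
  set (C3 := (C2 + 1) * (mu * (2 * B))) in *.
  destruct (INR_unbounded (C3 / Rabs (t j))) as [N HN].
  specialize (Main (N + Z.to_nat (Z.abs j) + 1)%nat ltac:(lia) ltac:(lia)).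
  assert (INR N <= INR (N + Z.to_nat (Z.abs j) + 1)) by (apply le_INR; lia).
  assert (C3 < Rabs (t j) * INR N).
  { apply Rmult_lt_reg_r with (/ Rabs (t j)); [now apply Rinv_0_lt_compat|].
    replace (Rabs (t j) * INR N * / Rabs (t j)) with (INR N) by (field; lra). exact HN. }
  nra.
Qed.

(** Either chi of the opposite orbit advances by a multiple of pi, which is the claim, or the
    sign-changed coefficients, a solution of the recurrence for - e, are forced to vanish, against
    the completeness of the Fourier coefficients. *)
Lemma companion_fixed (al c e : R) (l s : Z) (phi psi : R -> R) :
  e = 1 \/ e = -1 -> (1 <= l)%Z -> 0 < c ->
  sol al (IZR l) c (e * (PI / 2)) phi ->
  phi (2 * PI) = e * (PI / 2) + 2 * PI * IZR s -> Z.Even (s - l) ->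
  sol al (IZR l) c (- e * (PI / 2)) psi ->
  (forall k, (1 <= k <= l)%Z -> coef al c e l phi k = 0) ->
  exists n : Z, psi (2 * PI) = - e * (PI / 2) + 2 * PI * IZR n.
Proof.
  intros He Hl Hc H Hs Hsl H' Hz.
  assert (He' : - e = 1 \/ - e = -1) by (destruct He; lra).
  destruct (Req_dec (sin (chi l (- e) psi (2 * PI))) 0) as [E|E].
  - destruct (sin_eq_0_0 _ E) as [k Hk]. exists (l - k)%Z.
    unfold chi in Hk. rewrite minus_IZR. lra.
  - exfalso. apply (coef_not_all_zero al c e l s phi H Hs Hsl).
    set (g := coef al c e l phi) in *.
    assert (Hg : forall k, IZR k * g k + c / 2 * g (k + 1)%Z = e * (al / 2) * g (l - k)%Z)
      by (intros k; eapply coef_recurrence; eassumption).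
    (* The sign changes between 0 and 1: at k = 0 the relation involves, besides 0 t_0, only g_1 and
       g_l, which both vanish. *)
    set (t := fun k => if (1 <=? k)%Z then g k else - g k).
    assert (Ht : forall k, t k = 0 -> g k = 0).
    { intros k. unfold t. destruct (1 <=? k)%Z; lra. }
    intros j. apply Ht.
    destruct (coef_bound al c e _ l phi H) as [G [HG BG]]. fold g in BG.
    apply (truncations_force_zero al c (- e) l psi t (Rabs (c / 2) * G + Rabs (e * (al / 2)) * G)
      He' Hl Hc H' E).
    + intros k. specialize (Hg k). unfold t.
      destruct (Z.leb_spec 1 k); destruct (Z.leb_spec 1 (k + 1)); destruct (Z.leb_spec 1 (l - k)); try lia.
      * rewrite (Hz k), (Hz (k + 1)%Z), (Hz (l - k)%Z) by lia. ring.
      * lra.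
      * assert (k = 0)%Z by lia. subst k. 
        rewrite (Hz (0 + 1)%Z), (Hz (l - 0)%Z) by lia. ring.
      * lra.
    + intros k. assert (Ek : Rabs (IZR k * t k) = Rabs (IZR k * g k)).
      { unfold t. destruct (1 <=? k)%Z; [reflexivity|].
        rewrite <- Ropp_mult_distr_r. apply Rabs_Ropp. }
      rewrite Ek.
      replace (IZR k * g k) with (- (c / 2 * g (k + 1)%Z) + e * (al / 2) * g (l - k)%Z) by (specialize (Hg k); lra).
      eapply Rle_trans; [apply Rabs_triang|].
      rewrite Rabs_Ropp, (Rabs_mult (c / 2)), (Rabs_mult (e * (al / 2))).
      apply Rplus_le_compat; apply Rmult_le_compat_l; try apply Rabs_pos; apply BG.
Qed.

(** * Positivity of the area integral *)

(* Boundary values X + i Y, at z = exp(i u), of polynomials in z with real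
   coefficients, in Horner form. *)
Inductive hpoly : (R -> R) -> (R -> R) -> Prop :=
| hpoly_zero X Y : (forall u, X u = 0 /\ Y u = 0) -> hpoly X Y
| hpoly_horner a X Y X1 Y1 : hpoly X Y ->
    (forall u, X1 u = a + (cos u * X u - sin u * Y u) /\ Y1 u = sin u * X u + cos u * Y u) ->
    hpoly X1 Y1.

Lemma hpoly_ext X Y X1 Y1 : hpoly X Y -> (forall u, X1 u = X u /\ Y1 u = Y u) -> hpoly X1 Y1.
Proof.
  intros H. destruct H as [X Y H|a X Y X' Y' H E]; intros Q.
  - apply hpoly_zero. intros u. destruct (Q u) as [-> ->]. apply H.
  - apply (hpoly_horner a X Y); [exact H|]. intros u. destruct (Q u) as [-> ->]. apply E.
Qed.

Lemma hpoly_add X Y X' Y' : hpoly X Y -> hpoly X' Y' ->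
  hpoly (fun u => X u + X' u) (fun u => Y u + Y' u).
Proof.
  intros H. revert X' Y'. induction H as [X Y H|a X Y X1 Y1 H IH E]; intros X' Y' H'.
  - apply (hpoly_ext X' Y'); [exact H'|]. intros u. destruct (H u) as [-> ->]. split; ring.
  - destruct H' as [X' Y' H'|a' X2 Y2 X' Y' H' E'].
    + apply (hpoly_horner a X Y); [exact H|]. intros u.
      destruct (H' u) as [-> ->]. destruct (E u) as [-> ->]. split; ring.
    + apply (hpoly_horner (a + a') _ _ _ _ (IH _ _ H')). intros u.
      destruct (E u) as [-> ->]. destruct (E' u) as [-> ->]. split; ring.
Qed.

Lemma hpoly_scale b X Y : hpoly X Y -> hpoly (fun u => b * X u) (fun u => b * Y u).
Proof.
  induction 1 as [X Y H|a X Y X1 Y1 H IH E].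
  - apply hpoly_zero. intros u. destruct (H u) as [-> ->]. split; ring.
  - apply (hpoly_horner (b * a) _ _ _ _ IH). intros u. destruct (E u) as [-> ->]. split; ring.
Qed.

Lemma hpoly_rotate (n : nat) X Y : hpoly X Y ->
  hpoly (fun u => cos (INR n * u) * X u - sin (INR n * u) * Y u)
        (fun u => sin (INR n * u) * X u + cos (INR n * u) * Y u).
Proof.
  intros H. induction n as [|n IH].
  - apply (hpoly_ext X Y _ _ H). intros u. simpl INR. rewrite Rmult_0_l, cos_0, sin_0. split; ring.
  - apply (hpoly_horner 0 _ _ _ _ IH). intros u.
    rewrite S_INR. replace ((INR n + 1) * u) with (INR n * u + u) by ring.
    rewrite cos_plus, sin_plus. split; ring.
Qed.

(** The sum has indices k <= 0 and enters through its conjugate, so (P - i Q)(X + i Y) is a product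
    of two polynomials in z. *)
Lemma hpoly_trig_mult (t : Z -> R) (k0 : Z) (n : nat) X Y :
  (k0 + Z.of_nat n <= 1)%Z -> hpoly X Y ->
  hpoly (fun u => trig_cos t k0 n u * X u + trig_sin t k0 n u * Y u)
        (fun u => trig_cos t k0 n u * Y u - trig_sin t k0 n u * X u).
Proof.
  intros Hn H. induction n as [|n IH].
  - apply hpoly_zero. intros u. unfold trig_cos, trig_sin. simpl. split; ring.
  - specialize (IH ltac:(lia)).
    assert (R := hpoly_scale (t (k0 + Z.of_nat n)%Z) _ _
      (hpoly_rotate (Z.to_nat (- (k0 + Z.of_nat n))) X Y H)).
    apply (hpoly_ext _ _ _ _ (hpoly_add _ _ _ _ IH R)).
    intros u. unfold trig_cos, trig_sin. cbn [zsum].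
    rewrite INR_IZR_INZ, Z2Nat.id by lia.
    set (k := (k0 + Z.of_nat n)%Z).
    replace (IZR (- k) * u) with (- (IZR k * u)) by (rewrite opp_IZR; ring).
    rewrite cos_neg, sin_neg. split; ring.
Qed.

Lemma RInt_plus_cont (f g : R -> R) (a b : R) :
  (forall t, continuous f t) -> (forall t, continuous g t) ->
  RInt (fun t => f t + g t) a b = RInt f a b + RInt g a b.
Proof.
  intros Hf Hg. apply (RInt_plus f g); [apply (ex_RInt_continuous f)|apply (ex_RInt_continuous g)]; auto.
Qed.

(* For p = a + z q one has int Im(conj p p') = int |q|^2 + int Im(conj q q'). *)
Lemma hpoly_area X Y : hpoly X Y -> exists dX dY : R -> R,
  (forall u, is_derive X u (dX u)) /\ (forall u, is_derive Y u (dY u)) /\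
  (forall u, continuous dX u) /\ (forall u, continuous dY u) /\
  Y (2 * PI) = Y 0 /\ X (2 * PI) = X 0 /\
  RInt (fun u => Y u * Y u) 0 (2 * PI) <= RInt (fun u => X u * dY u - Y u * dX u) 0 (2 * PI).
Proof.
  assert (HPI := PI_RGT_0).
  induction 1 as [X Y H|a X Y X1 Y1 H [dX [dY (DX & DY & CX & CY & EY & EX & I)]] E].
  - exists (fun _ => 0), (fun _ => 0).
    repeat match goal with |- _ /\ _ => split end.
    + intros u. apply is_derive_ext with (fun _ => 0); [|apply @is_derive_const].
      intros v. symmetry. apply H.
    + intros u. apply is_derive_ext with (fun _ => 0); [|apply @is_derive_const].
      intros v. symmetry. apply H.
    + intros; apply continuous_const.
    + intros; apply continuous_const.
    + now rewrite (proj2 (H _)), (proj2 (H 0)).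
    + now rewrite (proj1 (H _)), (proj1 (H 0)).
    + right. apply RInt_ext. intros u _. destruct (H u) as [-> ->]. match goal with |- ?v = ?w => change (@eq R v w) end. ring.
  - set (dX1 := fun u => - sin u * X u + cos u * dX u - cos u * Y u - sin u * dY u).
    set (dY1 := fun u => cos u * X u + sin u * dX u - sin u * Y u + cos u * dY u).
    assert (KX : forall u, continuous X u) by (intros u; apply (ex_derive_continuous X); eexists; apply DX).
    assert (KY : forall u, continuous Y u) by (intros u; apply (ex_derive_continuous Y); eexists; apply DY).
    assert (Kc : forall u, continuous cos u) by apply continuous_cos.
    assert (Ks : forall u, continuous sin u) by apply continuous_sin.
    assert (M : forall f g : R -> R, (forall u, continuous f u) -> (forall u, continuous g u) ->
      forall u, continuous (fun u => f u * g u) u).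
    { intros f g hf hg u. apply (continuous_mult f g); auto. }
    assert (A : forall f g : R -> R, (forall u, continuous f u) -> (forall u, continuous g u) ->
      forall u, continuous (fun u => f u + g u) u).
    { intros f g hf hg u. apply (continuous_plus f g); auto. }
    assert (S : forall f g : R -> R, (forall u, continuous f u) -> (forall u, continuous g u) ->
      forall u, continuous (fun u => f u - g u) u).
    { intros f g hf hg u. apply (continuous_minus f g); auto. }
    assert (N : forall f : R -> R, (forall u, continuous f u) -> forall u, continuous (fun u => - f u) u).
    { intros f hf u. apply continuous_Ropp; auto. }
    assert (CX1 : forall u, continuous dX1 u) by (unfold dX1; auto 10).
    assert (CY1 : forall u, continuous dY1 u) by (unfold dY1; auto 10).
    assert (DX1 : forall u, is_derive X1 u (dX1 u)).
    { intros u. apply is_derive_ext with (fun u => a + (cos u * X u - sin u * Y u)).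
      - intros v. symmetry. apply E.
      - auto_derive; [ex_der|].
        rewrite (is_derive_unique (fun u : R => X u) _ _ (DX u)),
          (is_derive_unique (fun u : R => Y u) _ _ (DY u)). unfold dX1. ring. }
    assert (DY1 : forall u, is_derive Y1 u (dY1 u)).
    { intros u. apply is_derive_ext with (fun u => sin u * X u + cos u * Y u).
      - intros v. symmetry. apply E.
      - auto_derive; [ex_der|].
        rewrite (is_derive_unique (fun u : R => X u) _ _ (DX u)),
          (is_derive_unique (fun u : R => Y u) _ _ (DY u)). unfold dY1. ring. }
    assert (KY1 : forall u, continuous Y1 u) by (intros u; apply (ex_derive_continuous Y1); eexists; apply DY1).
    assert (P1 : Y1 (2 * PI) = Y1 0).
    { rewrite (proj2 (E _)), (proj2 (E 0)), EX, EY, cos_2PI, sin_2PI, cos_0, sin_0. reflexivity. }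
    exists dX1, dY1. repeat match goal with |- _ /\ _ => split end; auto.
    + rewrite (proj1 (E _)), (proj1 (E 0)), EX, EY, cos_2PI, sin_2PI, cos_0, sin_0. reflexivity.
    + assert (J : RInt (fun u => X1 u * dY1 u - Y1 u * dX1 u) 0 (2 * PI) =
        a * RInt dY1 0 (2 * PI) + 1 * RInt (fun u => X u * X u + Y u * Y u) 0 (2 * PI)
        + 1 * RInt (fun u => X u * dY u - Y u * dX u) 0 (2 * PI)).
      { rewrite <- RInt_linear3 by auto 10. apply RInt_ext. intros u _.
        destruct (E u) as [-> ->]. unfold dX1, dY1.
        assert (T := sin2_cos2 u). unfold Rsqr in T.
        set (c := cos u) in *. set (s := sin u) in *.
        assert (T1 : c * c = 1 - s * s) by lra.
        match goal with |- ?v = ?w => change (@eq R v w) end. ring [T1]. }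
      rewrite J, (RInt_derivative Y1 dY1 0 (2 * PI) DY1 CY1), P1.
      assert (0 <= RInt (fun u => Y u * Y u) 0 (2 * PI)).
      { assert (L := RInt_lower (fun u => Y u * Y u) 0 0 (2 * PI) ltac:(lra) (M _ _ KY KY)).
        rewrite Rmult_0_l in L. apply L. intros; apply Rle_0_sqr. }
      assert (RInt (fun u => Y1 u * Y1 u) 0 (2 * PI) <= RInt (fun u => X u * X u + Y u * Y u) 0 (2 * PI)).
      { apply RInt_monotone; auto; [lra|]. intros u _. rewrite (proj2 (E u)).
        assert (T := sin2_cos2 u). unfold Rsqr in T.
        replace (X u * X u + Y u * Y u) with ((sin u * sin u + cos u * cos u) * (X u * X u + Y u * Y u))
          by (rewrite T; ring).
        assert (0 <= (cos u * X u - sin u * Y u) * (cos u * X u - sin u * Y u)) by apply Rle_0_sqr.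
        nra. }
      lra.
Qed.

(** * From polynomials to exp(mu z) times a polynomial *)

Definition ifact (j : Z) : R := if (j <? 0)%Z then 0 else / INR (fact (Z.to_nat j)).

(** With the value 0 at negative integers, as for 1/Gamma(j + 1), the relation holds at every
    integer, including j = 0. *)
Lemma ifact_rec (j : Z) : IZR j * ifact j = ifact (j - 1).
Proof.
  unfold ifact. destruct (Z.ltb_spec j 0); destruct (Z.ltb_spec (j - 1) 0); try lia; try ring.
  - assert (j = 0)%Z by lia. subst j. simpl. ring.
  - replace (Z.to_nat j) with (S (Z.to_nat (j - 1))) by lia.
    rewrite fact_simpl, mult_INR.
    rewrite (INR_IZR_INZ (S _)). replace (Z.of_nat (S (Z.to_nat (j - 1)))) with j by lia.
    field. split; [apply INR_fact_neq_0|apply not_0_IZR; lia].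
Qed.

Lemma ifact_nonneg (j : Z) : 0 <= ifact j.
Proof.
  unfold ifact. destruct (j <? 0)%Z; [lra|]. left. apply Rinv_0_lt_compat, INR_fact_lt_0.
Qed.

Lemma ifact_pos (j : Z) : (0 <= j)%Z -> 0 < ifact j.
Proof.
  intros H. unfold ifact. destruct (Z.ltb_spec j 0); [lia|]. apply Rinv_0_lt_compat, INR_fact_lt_0.
Qed.

Lemma zsum_nonneg (F : Z -> R) (k0 : Z) (n : nat) :
  (forall k, 0 <= F k) -> 0 <= zsum F k0 n.
Proof.
  intros H. induction n as [|n IH]; simpl; [lra|]. specialize (H (k0 + Z.of_nat n)%Z). lra.
Qed.

Lemma zsum_ge_term (F : Z -> R) (j k0 : Z) (n : nat) :
  (forall k, 0 <= F k) -> (k0 <= j < k0 + Z.of_nat n)%Z -> F j <= zsum F k0 n.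
Proof.
  intros H Hj. induction n as [|n IH]; [lia|]. simpl.
  destruct (Z.eq_dec j (k0 + Z.of_nat n)) as [->|Ne].
  - assert (0 <= zsum F k0 n) by now apply zsum_nonneg. lra.
  - specialize (IH ltac:(lia)). specialize (H (k0 + Z.of_nat n)%Z). lra.
Qed.

(* Real and imaginary parts of exp(mu z) (X + i Y) at z = exp(i u). *)
Definition expmul_re (mu : R) (X Y : R -> R) (u : R) : R :=
  exp (mu * cos u) * (cos (mu * sin u) * X u - sin (mu * sin u) * Y u).

Definition expmul_im (mu : R) (X Y : R -> R) (u : R) : R :=
  exp (mu * cos u) * (sin (mu * sin u) * X u + cos (mu * sin u) * Y u).

Lemma exp_opp_mult (x : R) : exp (- x) * exp x = 1.
Proof. rewrite <- exp_plus, Rplus_opp_l. apply exp_0. Qed.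

(** U + i V is exp(- mu z) times a Taylor sum of exp(mu z), normalised to be 1 at z = 1. Its
    derivative along the circle contains only the last Taylor term, so it is C^1-close to 1;
    multiplying by it turns exp(mu z) p into a polynomial. *)
Lemma expmul_hpoly_approx (mu eta : R) : 0 < mu -> 0 < eta ->
  exists U V dU dV : R -> R,
    (forall u, is_derive U u (dU u)) /\ (forall u, is_derive V u (dV u)) /\
    (forall u, 0 <= u <= 2 * PI ->
       Rabs (U u - 1) <= eta /\ Rabs (V u) <= eta /\ Rabs (dU u) <= eta /\ Rabs (dV u) <= eta) /\
    (forall X Y, hpoly X Y ->
       hpoly (fun u => U u * expmul_re mu X Y u - V u * expmul_im mu X Y u)
             (fun u => U u * expmul_im mu X Y u + V u * expmul_re mu X Y u)).
Proof.
  intros Hmu Heta. assert (HPI := PI_RGT_0).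
  (* M collects 1/q <= exp mu, exp(- mu cos u) <= exp mu and two error terms mu sN. The factor 1 + 2
     pi below covers both the derivatives and their integrals over a period. *)
  set (M := exp mu * exp mu * (2 * mu)).
  assert (HM : 0 < M).
  { unfold M. repeat apply Rmult_lt_0_compat; try apply exp_pos; lra. }
  destruct (cv_speed_pow_fact mu (eta / (M * (1 + 2 * PI)))) as [N HN].
  { apply Rdiv_lt_0_compat; [lra|]. apply Rmult_lt_0_compat; lra. }
  specialize (HN N (Nat.le_refl N)). unfold Rdist in HN. rewrite Rminus_0_r in HN.
  set (sN := mu ^ N / INR (fact N)) in *.
  assert (HsN : 0 < sN).
  { apply Rdiv_lt_0_compat; [now apply pow_lt|apply INR_fact_lt_0]. }
  rewrite Rabs_pos_eq in HN by lra.
  (* The Taylor coefficients sit at the indices -N, ..., 0, so P + i Q is the conjugate of the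
     Taylor sum. *)
  set (t := fun k : Z => mu ^ Z.to_nat (- k) * ifact (- k)).
  set (k0 := (- Z.of_nat N)%Z). set (n := (N + 1)%nat).
  assert (Ht0 : t k0 = sN).
  { unfold t, k0, ifact. rewrite Z.opp_involutive.
    destruct (Z.ltb_spec (Z.of_nat N) 0); [lia|]. rewrite Nat2Z.id. reflexivity. }
  assert (Hr : forall k, IZR k * t k + mu * t (k + 1)%Z = 0 * t (2 * k0 + Z.of_nat n - 1 - k)%Z).
  { intros k. rewrite Rmult_0_l. unfold t.
    assert (E := ifact_rec (- k)). rewrite opp_IZR in E.
    replace (- (k + 1))%Z with (- k - 1)%Z by lia. rewrite <- E.
    destruct (Z_lt_le_dec (- k) 1) as [L|L].
    - destruct (Z.eq_dec k 0) as [->|Hk]; [simpl; ring|].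
      unfold ifact. destruct (Z.ltb_spec (- k) 0); [ring|lia].
    - replace (Z.to_nat (- k)) with (S (Z.to_nat (- k - 1))) by lia. simpl. ring. }
  set (P := trig_cos t k0 n). set (Q := trig_sin t k0 n).
  assert (DPQ := fun u => trig_sum_system t mu 0 _ k0 n u eq_refl Hr). cbv zeta in DPQ. fold P Q in DPQ.
  assert (Ht1 : t (k0 + Z.of_nat n)%Z = 0).
  { unfold t, ifact. replace (k0 + Z.of_nat n)%Z with 1%Z by (unfold k0, n; lia). simpl. ring. }
  rewrite Ht1, Ht0 in DPQ.
  set (eP := fun u => - (mu * sN * sin (IZR k0 * u - u))).
  set (eQ := fun u => mu * sN * cos (IZR k0 * u - u)).
  assert (DP : forall u, is_derive P u (mu * (cos u * Q u - sin u * P u) + eP u)).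
  { intros u. destruct (DPQ u) as [D _].
    match type of D with is_derive _ _ ?d => replace (mu * (cos u * Q u - sin u * P u) + eP u) with d; [exact D|] end.
    unfold eP. ring. }
  assert (DQ : forall u, is_derive Q u (- mu * (cos u * P u + sin u * Q u) + eQ u)).
  { intros u. destruct (DPQ u) as [_ D].
    match type of D with is_derive _ _ ?d => replace (- mu * (cos u * P u + sin u * Q u) + eQ u) with d; [exact D|] end.
    unfold eQ. ring. }
  clear DPQ.
  assert (Q0 : Q 0 = 0).
  { unfold Q, trig_sin. transitivity (zsum (fun _ => 0) k0 n); [|apply zsum_0]. apply zsum_ext.
    intros k _. rewrite Rmult_0_r, sin_0. ring. }
  assert (P0 : 1 <= P 0).
  { unfold P, trig_cos. replace 1 with (t 0%Z * cos (IZR 0 * 0)).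
    - apply (zsum_ge_term (fun k => t k * cos (IZR k * 0))).
      + intros k. rewrite Rmult_0_r, cos_0, Rmult_1_r. unfold t.
        apply Rmult_le_pos; [apply pow_le; lra|apply ifact_nonneg].
      + unfold k0, n. lia.
    - rewrite Rmult_0_r, cos_0. unfold t, ifact. simpl. field. }
  set (q := exp (- mu) * P 0).
  assert (Hq : exp (- mu) <= q).
  { unfold q. assert (0 < exp (- mu)) by apply exp_pos. nra. }
  assert (Hq0 : 0 < q) by (eapply Rlt_le_trans; [apply exp_pos|exact Hq]).
  assert (Hiq : / q <= exp mu).
  { apply Rle_trans with (/ exp (- mu)).
    - apply Rinv_le_contravar; [apply exp_pos|exact Hq].
    - rewrite exp_Ropp, Rinv_inv. lra. }
  set (U := fun u => / q * exp (- mu * cos u) * (cos (mu * sin u) * P u - sin (mu * sin u) * Q u)).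
  set (V := fun u => - (/ q * exp (- mu * cos u) * (sin (mu * sin u) * P u + cos (mu * sin u) * Q u))).
  set (dU := fun u => / q * exp (- mu * cos u) * (cos (mu * sin u) * eP u - sin (mu * sin u) * eQ u)).
  set (dV := fun u => - (/ q * exp (- mu * cos u) * (sin (mu * sin u) * eP u + cos (mu * sin u) * eQ u))).
  assert (DU : forall u, is_derive U u (dU u)).
  { intros u. unfold U. auto_derive; [ex_der|].
    rewrite (is_derive_unique (fun u : R => P u) _ _ (DP u)),
      (is_derive_unique (fun u : R => Q u) _ _ (DQ u)). unfold dU. ring. }
  assert (DV : forall u, is_derive V u (dV u)).
  { intros u. unfold V. auto_derive; [ex_der|].
    rewrite (is_derive_unique (fun u : R => P u) _ _ (DP u)),
      (is_derive_unique (fun u : R => Q u) _ _ (DQ u)). unfold dV. ring. }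
  assert (BB : forall u p r, Rabs p <= 1 -> Rabs r <= 1 ->
    Rabs (/ q * exp (- mu * cos u) * (p * eP u + r * eQ u)) <= M * sN).
  { intros u p r Hp Hr'. rewrite Rabs_mult.
    replace (M * sN) with (exp mu * exp mu * (2 * mu * sN)) by (unfold M; ring).
    assert (0 < exp mu) by apply exp_pos.
    apply Rmult_le_compat; try apply Rabs_pos.
    - rewrite Rabs_mult, !Rabs_pos_eq by (left; (apply exp_pos || now apply Rinv_0_lt_compat)).
      apply Rmult_le_compat; try (left; (apply exp_pos || now apply Rinv_0_lt_compat)); [exact Hiq|].
      assert (c := COS_bound u).
      destruct (Req_dec (- mu * cos u) mu) as [->|Ne]; [lra|].
      left. apply exp_increasing. nra.
    - eapply Rle_trans; [apply Rabs_triang|]. rewrite !Rabs_mult.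
      assert (ms : 0 < mu * sN) by (apply Rmult_lt_0_compat; lra).
      assert (Rabs (eP u) <= mu * sN).
      { unfold eP. rewrite Rabs_Ropp, Rabs_mult, (Rabs_pos_eq (mu * sN)) by lra.
        assert (s := Rabs_sin_le (IZR k0 * u - u)). nra. }
      assert (Rabs (eQ u) <= mu * sN).
      { unfold eQ. rewrite Rabs_mult, (Rabs_pos_eq (mu * sN)) by lra.
        assert (s := Rabs_cos_le (IZR k0 * u - u)). nra. }
      assert (0 <= Rabs (eP u)) by apply Rabs_pos. assert (0 <= Rabs (eQ u)) by apply Rabs_pos.
      assert (0 <= Rabs p) by apply Rabs_pos. assert (0 <= Rabs r) by apply Rabs_pos. nra. }
  assert (BU : forall u, Rabs (dU u) <= M * sN).
  { intros u. unfold dU.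
    replace (cos (mu * sin u) * eP u - sin (mu * sin u) * eQ u)
      with (cos (mu * sin u) * eP u + (- sin (mu * sin u)) * eQ u) by ring.
    apply BB; [apply Rabs_cos_le|rewrite Rabs_Ropp; apply Rabs_sin_le]. }
  assert (BV : forall u, Rabs (dV u) <= M * sN).
  { intros u. unfold dV. rewrite Rabs_Ropp. apply BB; [apply Rabs_sin_le|apply Rabs_cos_le]. }
  assert (U0 : U 0 = 1).
  { unfold U. rewrite cos_0, sin_0, Rmult_0_r, cos_0, sin_0, Rmult_1_r. 
    replace (1 * P 0 - 0 * Q 0) with (P 0) by ring. rewrite Rmult_assoc. fold q. field. lra. }
  assert (V0 : V 0 = 0).
  { unfold V. rewrite sin_0, Rmult_0_r, sin_0, Q0. ring. }
  assert (Hfin : M * sN * (1 + 2 * PI) <= eta).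
  { apply Rle_trans with (eta / (M * (1 + 2 * PI)) * (M * (1 + 2 * PI))).
    - replace (M * sN * (1 + 2 * PI)) with (sN * (M * (1 + 2 * PI))) by ring.
      apply Rmult_le_compat_r; [apply Rmult_le_pos; lra|lra].
    - right. field. split; lra. }
  assert (HMs : 0 < M * sN) by (apply Rmult_lt_0_compat; lra).
  exists U, V, dU, dV. split; [exact DU|]. split; [exact DV|]. split.
  - intros u Hu. rewrite <- U0. replace (V u) with (V u - V 0) by (rewrite V0; ring).
    assert (A1 := deriv_bound_le U dU (M * sN) 0 u (proj1 Hu) (fun t _ => DU t) (fun t _ => BU t)).
    assert (A2 := deriv_bound_le V dV (M * sN) 0 u (proj1 Hu) (fun t _ => DV t) (fun t _ => BV t)).
    specialize (BU u). specialize (BV u).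
    assert (M * sN * (u - 0) <= M * sN * (2 * PI)) by (apply Rmult_le_compat_l; lra).
    assert (0 <= M * sN * (2 * PI)) by (apply Rmult_le_pos; lra).
    repeat split; lra.
  - intros X Y H.
    apply (hpoly_ext _ _ _ _ (hpoly_scale (/ q) _ _ (hpoly_trig_mult t k0 n X Y ltac:(unfold k0, n; lia) H))).
    intros u. fold P Q. unfold U, V, expmul_re, expmul_im.
    assert (T := sin2_cos2 (mu * sin u)). unfold Rsqr in T.
    assert (E := exp_opp_mult (mu * cos u)).
    replace (- mu * cos u) with (- (mu * cos u)) by ring.
    set (ep := exp (mu * cos u)) in *. set (em := exp (- (mu * cos u))) in *.
    set (c := cos (mu * sin u)) in *. set (s := sin (mu * sin u)) in *.
    set (p := P u). set (r := Q u). set (x := X u). set (y := Y u).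
    split.
    + transitivity (/ q * (em * ep) * ((s * s + c * c) * (p * x + r * y))); [ring|].
      rewrite E, T. ring.
    + transitivity (/ q * (em * ep) * ((s * s + c * c) * (p * y - r * x))); [ring|].
      rewrite E, T. ring.
Qed.

Lemma RInt_pos_at (f : R -> R) (a b x : R) :
  (forall t, continuous f t) -> (forall t, a <= t <= b -> 0 <= f t) ->
  a < x < b -> 0 < f x -> 0 < RInt f a b.
Proof.
  intros Hc Hn Hx Hp.
  destruct (continuous_pos_near f x (Hc x) Hp) as [d [Hd H]].
  set (y := Rmin b (x + d / 2)).
  assert (Hy : x < y <= b /\ y <= x + d / 2).
  { unfold y. repeat split; [apply Rmin_glb_lt; lra|apply Rmin_l|apply Rmin_r]. }
  rewrite (RInt_split f a x b Hc), (RInt_split f x y b Hc).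
  assert (I1 := RInt_lower f 0 a x ltac:(lra) Hc ltac:(intros; apply Hn; lra)).
  assert (I2 := RInt_lower f (f x / 2) x y ltac:(lra) Hc
    ltac:(intros t Ht; left; apply H; rewrite Rabs_pos_eq; lra)).
  assert (I3 := RInt_lower f 0 y b ltac:(lra) Hc ltac:(intros; apply Hn; lra)).
  nra.
Qed.

(** A factor U + i V that is C^1-close to 1 reduces the claim to [hpoly_area]. C absorbs the bounds
    of G = F H' - H F' and of J = F^2 + H^2. *)
Lemma expmul_area (mu : R) (X Y dF dH : R -> R) : 0 < mu -> hpoly X Y ->
  (forall u, is_derive (expmul_re mu X Y) u (dF u)) ->
  (forall u, is_derive (expmul_im mu X Y) u (dH u)) ->
  (forall u, continuous dF u) -> (forall u, continuous dH u) ->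
  RInt (fun u => expmul_im mu X Y u * expmul_im mu X Y u) 0 (2 * PI) <=
  RInt (fun u => expmul_re mu X Y u * dH u - expmul_im mu X Y u * dF u) 0 (2 * PI).
Proof.
  intros Hmu HXY DF DH CdF CdH. assert (HPI := PI_RGT_0).
  set (F := expmul_re mu X Y) in *. set (H := expmul_im mu X Y) in *.
  assert (CF : forall u, continuous F u) by (intros u; apply (ex_derive_continuous F); eexists; apply DF).
  assert (CH : forall u, continuous H u) by (intros u; apply (ex_derive_continuous H); eexists; apply DH).
  assert (M : forall f g : R -> R, (forall u, continuous f u) -> (forall u, continuous g u) ->
      forall u, continuous (fun u => f u * g u) u).
  { intros f g hf hg u. apply (continuous_mult f g); auto. }
  assert (A : forall f g : R -> R, (forall u, continuous f u) -> (forall u, continuous g u) ->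
      forall u, continuous (fun u => f u + g u) u).
  { intros f g hf hg u. apply (continuous_plus f g); auto. }
  assert (S : forall f g : R -> R, (forall u, continuous f u) -> (forall u, continuous g u) ->
      forall u, continuous (fun u => f u - g u) u).
  { intros f g hf hg u. apply (continuous_minus f g); auto. }
  assert (Cst : forall (y u : R), continuous (fun _ : R => y) u) by (intros; apply continuous_const).
  set (G := fun u => F u * dH u - H u * dF u).
  assert (CG : forall u, continuous G u) by (unfold G; auto 10).
  set (J := fun u => F u * F u + H u * H u).
  assert (CJ : forall u, continuous J u) by (unfold J; auto 10).
  assert (J0 : forall u, 0 <= J u).
  { intros u. unfold J. assert (0 <= F u * F u) by apply Rle_0_sqr. assert (0 <= H u * H u) by apply Rle_0_sqr. lra. }
  destruct (continuous_bounded G 0 (2 * PI) CG) as [MG [HMG BG]].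
  destruct (continuous_bounded J 0 (2 * PI) CJ) as [MJ [HMJ BJ]].
  set (C := 4 * MG + 11 * MJ).
  apply Rnot_lt_le. intros Hlt. fold G in Hlt.
  set (d := RInt (fun u => H u * H u) 0 (2 * PI) - RInt G 0 (2 * PI)).
  assert (Hd : 0 < d) by (unfold d; lra).
  assert (HC : 0 <= C) by (unfold C; lra).
  assert (Hden : 0 < 4 * PI * (C + 1)) by (apply Rmult_lt_0_compat; lra).
  (* Each of the two integrals is changed unfavourably by at most 2 pi eta C; the total 4 pi eta C
     stays below the assumed deficit d. *)
  set (eta := Rmin 1 (d / (4 * PI * (C + 1)))).
  assert (Heta : 0 < eta) by (unfold eta; apply Rmin_glb_lt; [lra|now apply Rdiv_lt_0_compat]).
  assert (Heta1 : eta <= 1) by apply Rmin_l.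
  assert (Heta2 : eta * (4 * PI * (C + 1)) <= d).
  { apply Rle_trans with (d / (4 * PI * (C + 1)) * (4 * PI * (C + 1))).
    - apply Rmult_le_compat_r; [lra|apply Rmin_r].
    - right. field. split; lra. }
  destruct (expmul_hpoly_approx mu eta Hmu Heta) as [U [V [dU [dV (DU & DV & B & HP)]]]].
  specialize (HP X Y HXY). fold F H in HP.
  destruct (hpoly_area _ _ HP) as [dX [dY (DX & DY & CX & CY & _ & _ & I)]].
  assert (CU : forall u, continuous U u) by (intros u; apply (ex_derive_continuous U); eexists; apply DU).
  assert (CV : forall u, continuous V u) by (intros u; apply (ex_derive_continuous V); eexists; apply DV).
  assert (EX : forall u, dX u = dU u * F u + U u * dF u - (dV u * H u + V u * dH u)).
  { intros u. rewrite <- (is_derive_unique _ _ _ (DX u)). apply is_derive_unique.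
    auto_derive; [ex_der|].
    rewrite (is_derive_unique (fun u : R => F u) _ _ (DF u)),
      (is_derive_unique (fun u : R => H u) _ _ (DH u)), (is_derive_unique (fun u : R => U u) _ _ (DU u)),
      (is_derive_unique (fun u : R => V u) _ _ (DV u)). ring. }
  assert (EY : forall u, dY u = dU u * H u + U u * dH u + (dV u * F u + V u * dF u)).
  { intros u. rewrite <- (is_derive_unique _ _ _ (DY u)). apply is_derive_unique.
    auto_derive; [ex_der|].
    rewrite (is_derive_unique (fun u : R => F u) _ _ (DF u)),
      (is_derive_unique (fun u : R => H u) _ _ (DH u)), (is_derive_unique (fun u : R => U u) _ _ (DU u)),
      (is_derive_unique (fun u : R => V u) _ _ (DV u)). ring. }
  assert (I1 : RInt (fun u => H u * H u + - (eta * C)) 0 (2 * PI) <=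
     RInt (fun u => (U u * H u + V u * F u) * (U u * H u + V u * F u)) 0 (2 * PI)).
  { apply RInt_monotone; auto 10; [lra|]. intros u Hu.
    destruct (B u Hu) as (b1 & b2 & _ & _). specialize (BJ u Hu).
    rewrite Rabs_pos_eq in BJ by apply J0. unfold J in BJ.
    apply Rabs_le_between in b1. apply Rabs_le_between in b2.
    set (x := U u) in *. set (y := V u) in *. set (f := F u) in *. set (h := H u) in *.
    assert (j1 : 0 <= f * f) by apply Rle_0_sqr. assert (j2 : 0 <= h * h) by apply Rle_0_sqr.
    assert (fh1 : 2 * (f * h) <= f * f + h * h) by (assert (0 <= (f - h) * (f - h)) by apply Rle_0_sqr; nra).
    assert (fh2 : - (f * f + h * h) <= 2 * (f * h)) by (assert (0 <= (f + h) * (f + h)) by apply Rle_0_sqr; nra).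
    assert (xx : 1 - 2 * eta <= x * x) by nra.
    assert (xy : -2 * eta <= x * y <= 2 * eta) by nra.
    assert (0 <= y * y * (f * f)) by (apply Rmult_le_pos; [apply Rle_0_sqr|exact j1]).
    assert (eta * (4 * (f * f + h * h)) <= eta * C).
    { apply Rmult_le_compat_l; [lra|]. unfold C. lra. }
    assert (x * x * (h * h) >= (1 - 2 * eta) * (h * h)) by (apply Rle_ge, Rmult_le_compat_r; lra).
    assert (2 * (x * y) * (f * h) >= - 2 * eta * (f * f + h * h)) by nra.
    nra. }
  assert (I2 : RInt (fun u => (U u * F u - V u * H u) * dY u - (U u * H u + V u * F u) * dX u) 0 (2 * PI) <=
     RInt (fun u => G u + eta * C) 0 (2 * PI)).
  { apply RInt_monotone; auto 10; [lra|]. intros u Hu.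
    destruct (B u Hu) as (b1 & b2 & b3 & b4). specialize (BJ u Hu). specialize (BG u Hu).
    rewrite Rabs_pos_eq in BJ by apply J0.
    rewrite EX, EY.
    replace ((U u * F u - V u * H u) * (dU u * H u + U u * dH u + (dV u * F u + V u * dF u)) -
      (U u * H u + V u * F u) * (dU u * F u + U u * dF u - (dV u * H u + V u * dH u)))
     with ((U u * U u + V u * V u) * G u + J u * (U u * dV u - V u * dU u)) by (unfold G, J; ring).
    apply Rabs_le_between in b1. apply Rabs_le_between in b2.
    apply Rabs_le_between in b3. apply Rabs_le_between in b4. apply Rabs_le_between in BG.
    specialize (J0 u).
    set (x := U u) in *. set (y := V u) in *. set (p := dU u) in *. set (r := dV u) in *.
    set (g := G u) in *. set (jj := J u) in *.
    assert (q1 : - 4 * eta <= x * x + y * y - 1 <= 4 * eta) by nra.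
    assert (q2 : x * r - y * p <= 3 * eta) by nra.
    assert ((x * x + y * y - 1) * g <= 4 * eta * MG) by nra.
    assert (jj * (x * r - y * p) <= jj * (3 * eta)) by (apply Rmult_le_compat_l; lra).
    assert (jj * (3 * eta) <= MJ * (3 * eta)) by (apply Rmult_le_compat_r; lra).
    assert (0 <= eta * MJ) by (apply Rmult_le_pos; lra).
    unfold C. nra. }
  rewrite (RInt_plus_cont (fun u => H u * H u) (fun _ => - (eta * C))) in I1 by auto.
  rewrite (RInt_plus_cont G (fun _ => eta * C)) in I2 by auto.
  rewrite RInt_const in I1. rewrite RInt_const in I2.
  unfold scal in I1, I2; simpl in I1, I2; unfold mult in I1, I2; simpl in I1, I2.
  unfold d in *.
  assert (0 < eta * PI) by (apply Rmult_lt_0_compat; lra).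
  nra.
Qed.

(** * The modes and their real linear system *)

Definition mode (l : Z) (g : Z -> R) (j : Z) : R := ifact j * ifact (l - 1 - j) * g (l - j)%Z.

(** This is z E' + mu z E = kap z^l E(1/z), coefficient by coefficient. The common factor m ifact(m)
    ifact(l - m) turns it into the recurrence of g at the index l - m. *)
Lemma mode_recurrence (l : Z) (g : Z -> R) (mu kap : R) :
  (forall k, IZR k * g k + mu * g (k + 1)%Z = kap * g (l - k)%Z) ->
  forall m, IZR m * mode l g m + mu * mode l g (m - 1) = kap * mode l g (l - m).
Proof.
  intros Hg m. unfold mode. specialize (Hg (l - m)%Z).
  replace (l - (l - m))%Z with m in * by lia.
  replace (l - 1 - (m - 1))%Z with (l - m)%Z by lia.
  replace (l - (m - 1))%Z with (l - m + 1)%Z by lia.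
  replace (l - 1 - (l - m))%Z with (m - 1)%Z by lia.
  replace (l - 1 - m)%Z with (l - m - 1)%Z by lia.
  rewrite <- (ifact_rec (l - m)), <- (ifact_rec m) in *.
  replace (IZR m * (ifact m * (IZR (l - m) * ifact (l - m)) * g (l - m)%Z) +
    mu * (IZR m * ifact m * ifact (l - m) * g (l - m + 1)%Z))
   with (IZR m * ifact m * ifact (l - m) * (IZR (l - m) * g (l - m)%Z + mu * g (l - m + 1)%Z)) by ring.
  rewrite Hg. ring.
Qed.

Lemma mode_outside (l : Z) (g : Z -> R) (j : Z) : (j < 0 \/ l <= j)%Z -> mode l g j = 0.
Proof.
  intros H. unfold mode, ifact.
  destruct (Z.ltb_spec j 0); [ring|]. destruct (Z.ltb_spec (l - 1 - j) 0); [ring|lia].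
Qed.

Lemma linear_system_zero (mu kap y : R) (X Y : R -> R) (T : R) :
  0 <= T -> X 0 = 0 -> Y 0 = 0 ->
  (forall u, is_derive X u (mu * (sin u * X u + cos u * Y u) + kap * (cos (y * u) * Y u - sin (y * u) * X u))) ->
  (forall u, is_derive Y u (mu * (sin u * Y u - cos u * X u) + kap * (cos (y * u) * X u + sin (y * u) * Y u))) ->
  X T = 0 /\ Y T = 0.
Proof.
  intros HT X0 Y0 DX DY.
  set (K := 2 * (Rabs mu + 2 * Rabs kap)).
  assert (HK : 0 <= K) by (unfold K; assert (0 <= Rabs mu) by apply Rabs_pos; assert (0 <= Rabs kap) by apply Rabs_pos; lra).
  assert (G := gronwall (fun u => X u * X u + Y u * Y u)
    (fun u => 2 * (mu * (sin u * (X u * X u + Y u * Y u))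
      + kap * (sin (y * u) * (Y u * Y u - X u * X u) + 2 * cos (y * u) * (X u * Y u)))) K 0 T HK (Rle_refl 0) HT).
  cbv beta in G. rewrite X0, Y0 in G.
  assert (Z : X T * X T + Y T * Y T <= 0).
  { replace 0 with ((0 * 0 + 0 * 0 + 0 * T) * exp (K * T)) at 1 by ring. apply G; clear G.
    - intros v _. auto_derive; [ex_der|].
      rewrite (is_derive_unique (fun u : R => X u) _ _ (DX v)),
            (is_derive_unique (fun u : R => Y u) _ _ (DY v)). ring.
    - intros v _. set (p := X v). set (q := Y v).
      assert (pp : 0 <= p * p) by apply Rle_0_sqr. assert (qq : 0 <= q * q) by apply Rle_0_sqr.
      assert (b3 : mu * (sin v * (p * p + q * q)) <= Rabs mu * (p * p + q * q)).
      { eapply Rle_trans; [apply Rle_abs|]. rewrite Rabs_mult. apply Rmult_le_compat_l; [apply Rabs_pos|].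
        rewrite Rabs_mult, (Rabs_pos_eq (p * p + q * q)) by lra.
        assert (s := Rabs_sin_le v). nra. }
      assert (b4 : kap * (sin (y * v) * (q * q - p * p) + 2 * cos (y * v) * (p * q))
           <= Rabs kap * (2 * (p * p + q * q))).
      { eapply Rle_trans; [apply Rle_abs|]. rewrite Rabs_mult.
          apply Rmult_le_compat_l; [apply Rabs_pos|].
          eapply Rle_trans; [apply Rabs_triang|]. rewrite !Rabs_mult.
          assert (s1 := Rabs_sin_le (y * v)). assert (s2 := Rabs_cos_le (y * v)).
          assert (Rabs (q * q - p * p) <= p * p + q * q) by (apply Rabs_le; lra).
          assert (2 * (Rabs p * Rabs q) <= p * p + q * q).
          { rewrite <- Rabs_mult. assert (0 <= (p - q) * (p - q)) by apply Rle_0_sqr.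
            assert (0 <= (p + q) * (p + q)) by apply Rle_0_sqr.
            unfold Rabs; destruct Rcase_abs; nra. }
          rewrite (Rabs_pos_eq 2) by lra.
          assert (0 <= Rabs p * Rabs q) by (apply Rmult_le_pos; apply Rabs_pos).
          assert (0 <= Rabs (q * q - p * p)) by apply Rabs_pos. nra. }
      unfold K. nra. }
  assert (0 <= X T * X T) by apply Rle_0_sqr. assert (0 <= Y T * Y T) by apply Rle_0_sqr.
  split; apply Rsqr_0_uniq; unfold Rsqr; lra.
Qed.

(** The nonlinear equation is the argument of a real linear system: r exp(- mu cos u) exp(i chi)
    solves the system that E satisfies on the circle. *)
Lemma polar_system (al c e x : R) (l : Z) (phi : R -> R) :
  e = 1 \/ e = -1 -> sol al (IZR l) c x phi ->
  let mu := c / 2 in let kap := e * (al / 2) in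
  let X := fun u => weight al (- mu) phi u * cos (chi l e phi u) in
  let Y := fun u => weight al (- mu) phi u * sin (chi l e phi u) in
  (forall u, is_derive X u (mu * (sin u * X u + cos u * Y u) + kap * (cos (IZR l * u) * Y u - sin (IZR l * u) * X u))) /\
  (forall u, is_derive Y u (mu * (sin u * Y u - cos u * X u) + kap * (cos (IZR l * u) * X u + sin (IZR l * u) * Y u))).
Proof.
  intros He H mu kap X Y.
  assert (A := fun u => weight_derive _ _ _ _ (- mu) _ u H).
  assert (B := fun u => chi_derive _ _ _ e _ _ u H).
  assert (K : forall u, sin (phi u) = e * cos (IZR l * u - 2 * chi l e phi u)) by (intros; now apply sin_of_chi).
  assert (L : forall u, cos (phi u) = - e * sin (IZR l * u - 2 * chi l e phi u)) by (intros; now apply cos_of_chi).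
  split; intros u; unfold X, Y; auto_derive; try ex_der;
    rewrite (is_derive_unique (fun u : R => weight al (- mu) phi u) _ _ (A u)),
      (is_derive_unique (fun u : R => chi l e phi u) _ _ (B u)), K, L;
    set (y := chi l e phi u); set (w := IZR l * u - y);
    replace (IZR l * u - 2 * y) with (w - y) by (unfold w; ring);
    replace (IZR l * u) with (w + y) by (unfold w; ring);
    rewrite cos_plus, sin_plus, cos_minus, sin_minus; unfold mu, kap; field.
Qed.

(** * The polynomial solution *)

(** The sum over negated indices is the conjugate of E, whence the sign in [mode_sum_im]. The extra
    index - l, with coefficient 0, makes the window symmetric under k -> - l - k, and both end terms
    vanish. *)
Definition mode_sum_re (l : Z) (g : Z -> R) : R -> R :=
  trig_cos (fun k => mode l g (- k)) (- l) (S (Z.to_nat l)).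

Definition mode_sum_im (l : Z) (g : Z -> R) (u : R) : R :=
  - trig_sin (fun k => mode l g (- k)) (- l) (S (Z.to_nat l)) u.

Lemma mode_sum_hpoly (l : Z) (g : Z -> R) : (0 <= l)%Z ->
  hpoly (mode_sum_re l g) (mode_sum_im l g).
Proof.
  intros Hl.
  assert (One : hpoly (fun _ => 1) (fun _ => 0)).
  { apply (hpoly_horner 1 (fun _ => 0) (fun _ => 0)).
    - apply hpoly_zero. intros; split; reflexivity.
    - intros u. split; ring. }
  apply (hpoly_ext _ _ _ _ (hpoly_trig_mult (fun k => mode l g (- k)) (- l) (S (Z.to_nat l)) _ _ ltac:(lia) One)).
  intros u. unfold mode_sum_re, mode_sum_im. split; ring.
Qed.

Lemma mode_sum_system (l : Z) (g : Z -> R) (mu kap : R) : (0 <= l)%Z ->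
  (forall k, IZR k * g k + mu * g (k + 1)%Z = kap * g (l - k)%Z) ->
  let X := mode_sum_re l g in let Y := mode_sum_im l g in
  (forall u, is_derive X u (mu * (sin u * X u + cos u * Y u) + kap * (cos (IZR l * u) * Y u - sin (IZR l * u) * X u))) /\
  (forall u, is_derive Y u (mu * (sin u * Y u - cos u * X u) + kap * (cos (IZR l * u) * X u + sin (IZR l * u) * Y u))).
Proof.
  intros Hl Hg X Y.
  set (t := fun k => mode l g (- k)).
  assert (Ht : forall k, IZR k * t k + - mu * t (k + 1)%Z = - kap * t (- l - k)%Z).
  { intros k. assert (E := mode_recurrence l g mu kap Hg (- k)). unfold t.
    replace (- (k + 1))%Z with (- k - 1)%Z by lia. replace (- (- l - k))%Z with (l - - k)%Z by lia.
    rewrite opp_IZR in E. lra. }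
  assert (D := fun u => trig_sum_system t (- mu) (- kap) (- l) (- l) (S (Z.to_nat l)) u ltac:(lia) Ht).
  cbv zeta in D.
  replace (t (- l + Z.of_nat (S (Z.to_nat l)))%Z) with 0 in D
    by (unfold t; rewrite mode_outside; [reflexivity|lia]).
  replace (t (- l)%Z) with 0 in D by (unfold t; rewrite mode_outside; [reflexivity|lia]).
  rewrite opp_IZR in D.
  split; intros u; destruct (D u) as [D1 D2]; clear D;
    replace (- IZR l * u) with (- (IZR l * u)) in * by ring;
    rewrite cos_neg, sin_neg in *.
  - unfold X, mode_sum_re. fold t.
    match type of D1 with is_derive _ _ ?d => match goal with |- is_derive _ _ ?d' =>
      replace d' with d; [exact D1|unfold Y, mode_sum_im; fold t; ring] end end.
  - apply @is_derive_opp in D2.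
    match type of D2 with is_derive _ _ ?d => match goal with |- is_derive _ _ ?d' =>
      replace d' with d; [exact D2|] end end.
    unfold X, Y, mode_sum_re, mode_sum_im. fold t. unfold opp; simpl. ring.
Qed.

(** For g = [coef] the right side is a sum of the squares of g_1, ..., g_l with positive weights, so
    this pairing detects that E is not zero. *)
Lemma mode_sum_pairing (al c e x : R) (l : Z) (phi : R -> R) (g : Z -> R) :
  sol al (IZR l) c x phi ->
  RInt (fun u => weight al (c / 2) phi u *
     (cos (chi l e phi u - IZR l * u) * mode_sum_re l g u - sin (chi l e phi u - IZR l * u) * mode_sum_im l g u)) 0 (2 * PI)
  = zsum (fun k => mode l g (- k) * coef al c e l phi (l + k)) (- l) (S (Z.to_nat l)).
Proof.
  intros H.
  rewrite (RInt_ext _ (fun u => zsum (fun k => mode l g (- k) *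
      (weight al (c / 2) phi u * cos (chi l e phi u - IZR (l + k) * u))) (- l) (S (Z.to_nat l)))).
  - rewrite (zsum_RInt (fun k u => mode l g (- k) *
      (weight al (c / 2) phi u * cos (chi l e phi u - IZR (l + k) * u)))).
    + apply zsum_ext. intros k _. unfold coef.
      apply (RInt_scal (fun u => weight al (c / 2) phi u * cos (chi l e phi u - IZR (l + k) * u))).
      apply (ex_RInt_continuous (fun u => weight al (c / 2) phi u * cos (chi l e phi u - IZR (l + k) * u))).
      intros u _. eapply coef_integrand_continuous. exact H.
    + intros k u. apply (continuous_mult (fun _ : R => mode l g (- k))
        (fun u => weight al (c / 2) phi u * cos (chi l e phi u - IZR (l + k) * u))).
      * apply continuous_const.
      * eapply coef_integrand_continuous. exact H.
  - intros u _. unfold mode_sum_re, mode_sum_im.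
    set (y := chi l e phi u - IZR l * u). set (t := fun k => mode l g (- k)).
    assert (E := trig_combine_cos t (- l) (S (Z.to_nat l)) u y).
    match goal with |- ?v = ?w => change (@eq R v w) end.
    transitivity (weight al (c / 2) phi u * zsum (fun k => t k * cos (IZR k * u - y)) (- l) (S (Z.to_nat l))
      + 0 * zsum (fun k => t k * cos (IZR k * u - y)) (- l) (S (Z.to_nat l))).
    + rewrite E. ring.
    + rewrite <- zsum_linear. apply zsum_ext. intros k _. unfold t.
      replace (chi l e phi u - IZR (l + k) * u) with (- (IZR k * u - y)) by (unfold y; rewrite plus_IZR; ring).
      rewrite cos_neg. ring.
Qed.

(** The factor exp(mu z) cancels the term - mu z E of the system and leaves only the reflected
    term. *)
Lemma expmul_derive (mu kap y : R) (X Y : R -> R) :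
  (forall u, is_derive X u (mu * (sin u * X u + cos u * Y u) + kap * (cos (y * u) * Y u - sin (y * u) * X u))) ->
  (forall u, is_derive Y u (mu * (sin u * Y u - cos u * X u) + kap * (cos (y * u) * X u + sin (y * u) * Y u))) ->
  let A := fun u => kap * (cos (y * u) * Y u - sin (y * u) * X u) in
  let B := fun u => kap * (cos (y * u) * X u + sin (y * u) * Y u) in
  (forall u, is_derive (expmul_re mu X Y) u (expmul_re mu A B u)) /\
  (forall u, is_derive (expmul_im mu X Y) u (expmul_im mu A B u)).
Proof.
  intros DX DY A B.
  split; intros u; unfold expmul_re, expmul_im; auto_derive; try ex_der;
    rewrite (is_derive_unique (fun u : R => X u) _ _ (DX u)),
      (is_derive_unique (fun u : R => Y u) _ _ (DY u)); unfold A, B; ring.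
Qed.

Lemma amp_sin_integral_pos (al c e : R) (l s : Z) (phi : R -> R) :
  e = 1 \/ e = -1 -> (1 <= l)%Z -> 0 < c -> 0 < al ->
  sol al (IZR l) c (e * (PI / 2)) phi ->
  phi (2 * PI) = e * (PI / 2) + 2 * PI * IZR s ->
  (exists k, (1 <= k <= l)%Z /\ coef al c e l phi k <> 0) ->
  0 < RInt (fun u => amp al phi u * amp al phi u * sin (phi u)) 0 (2 * PI).
Proof.
  intros He Hl Hc Hal H Hs [kk [Hkk Hgk]].
  assert (HPI := PI_RGT_0).
  assert (Hg := fun k => coef_recurrence al c e l s phi k He H Hs).
  set (g := coef al c e l phi) in *. set (mu := c / 2) in *. set (kap := e * (al / 2)) in *.
  assert (Hmu : 0 < mu) by (unfold mu; lra).
  set (X := mode_sum_re l g). set (Y := mode_sum_im l g).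
  destruct (mode_sum_system l g mu kap ltac:(lia) Hg) as [DX DY]. fold X Y in DX, DY.
  destruct (polar_system al c e _ l phi He H) as [DX' DY']. fold mu in DX', DY'. fold kap in DX', DY'.
  set (w := weight al (- mu) phi) in *. set (x := chi l e phi) in *.
  assert (x0 : x 0 = 0) by (unfold x, chi; destruct H as [-> _]; field).
  assert (w0 : 0 < w 0) by apply weight_pos.
  (* X + i Y and w exp(i x) solve the same linear system and are both real at u = 0, so one real
     constant relates them. *)
  set (c0 := X 0 / w 0).
  assert (Y0 : Y 0 = 0).
  { unfold Y, mode_sum_im, trig_sin.
    match goal with |- - ?z = 0 => cut (z = 0); [intros ->; ring|] end.
    transitivity (zsum (fun _ => 0) (- l) (S (Z.to_nat l))); [|apply zsum_0]. apply zsum_ext.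
    intros k _. rewrite Rmult_0_r, sin_0. ring. }
  assert (Eq : forall u, 0 <= u -> X u = c0 * (w u * cos (x u)) /\ Y u = c0 * (w u * sin (x u))).
  { intros u Hu.
    destruct (linear_system_zero mu kap (IZR l)
      (fun u => X u - c0 * (w u * cos (x u))) (fun u => Y u - c0 * (w u * sin (x u))) u Hu) as [E1 E2].
    - rewrite x0, cos_0. unfold c0. field. lra.
    - rewrite x0, sin_0, Y0. ring.
    - intros v.
      assert (D := is_derive_minus _ _ _ _ _ (DX v) (is_derive_scal _ _ c0 _ (DX' v))).
      match type of D with is_derive _ _ ?d => match goal with |- is_derive _ _ ?d' =>
        replace d' with d; [exact D|unfold minus, plus, opp, scal; simpl; unfold mult; simpl; ring] end end.
    - intros v.
      assert (D := is_derive_minus _ _ _ _ _ (DY v) (is_derive_scal _ _ c0 _ (DY' v))).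
      match type of D with is_derive _ _ ?d => match goal with |- is_derive _ _ ?d' =>
        replace d' with d; [exact D|unfold minus, plus, opp, scal; simpl; unfold mult; simpl; ring] end end.
    - split; lra. }
  assert (c0n : c0 <> 0).
  { intros E. assert (Q := mode_sum_pairing al c e _ l phi g H). fold mu X Y x g in Q.
    rewrite (RInt_ext _ (fun _ => 0)) in Q.
    - assert (Z0 : RInt (fun _ : R => 0) 0 (2 * PI) = 0).
      { rewrite RInt_const. apply Rmult_0_r. }
      rewrite Z0 in Q.
      assert (T := zsum_ge_term (fun k => mode l g (- k) * g (l + k)%Z) (kk - l) (- l) (S (Z.to_nat l))).
      cbv beta in T. rewrite <- Q in T.
      assert (T' : mode l g (- (kk - l)) * g (l + (kk - l))%Z <= 0).
      { apply T; [|lia]. intros k. unfold mode. replace (l - - k)%Z with (l + k)%Z by lia.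
        assert (0 <= ifact (- k)) by apply ifact_nonneg.
        assert (0 <= ifact (l - 1 - - k)) by apply ifact_nonneg.
        rewrite Rmult_assoc. apply Rmult_le_pos; [now apply Rmult_le_pos|apply Rle_0_sqr]. }
      unfold mode in T'. replace (l - - (kk - l))%Z with kk in T' by lia.
      replace (l + (kk - l))%Z with kk in T' by lia.
      assert (0 < ifact (- (kk - l))) by (apply ifact_pos; lia).
      assert (0 < ifact (l - 1 - - (kk - l))) by (apply ifact_pos; lia).
      assert (0 < g kk * g kk) by (apply Rsqr_pos_lt; exact Hgk).
      assert (0 < ifact (- (kk - l)) * ifact (l - 1 - - (kk - l)) * (g kk * g kk))
        by (apply Rmult_lt_0_compat; [apply Rmult_lt_0_compat|]; assumption).
      lra.
    - rewrite Rmin_left, Rmax_right by lra. intros u Hu.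
      destruct (Eq u ltac:(lra)) as [-> ->]. rewrite E.
      match goal with |- ?v = ?w => change (@eq R v w) end. ring. }
  destruct (expmul_derive mu kap (IZR l) X Y DX DY) as [DF DH]. cbv zeta in DF, DH.
  set (A := fun u => kap * (cos (IZR l * u) * Y u - sin (IZR l * u) * X u)) in *.
  set (B := fun u => kap * (cos (IZR l * u) * X u + sin (IZR l * u) * Y u)) in *.
  assert (CdF : forall u, continuous (expmul_re mu A B) u).
  { intros u. unfold expmul_re, A, B. der_cont; ex_der. }
  assert (CdH : forall u, continuous (expmul_im mu A B) u).
  { intros u. unfold expmul_im, A, B. der_cont; ex_der. }
  assert (Area := expmul_area mu X Y _ _ Hmu (mode_sum_hpoly l g ltac:(lia)) DF DH CdF CdH).
  (* xi is the argument of exp(mu z) E up to the sign of c0; adding mu sin u cancels the forcing and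
     leaves xi' = (al/2) sin phi. *)
  set (xi := fun u => x u + mu * sin u).
  assert (Dphi := proj2 H). cbv beta in Dphi.
  assert (Damp := fun u => amp_derive _ _ _ _ _ u H).
  assert (Dx := fun u => chi_derive _ _ _ e _ _ u H). fold x in Dx.
  assert (Wa : forall u, exp (mu * cos u) * w u = amp al phi u).
  { intros u. unfold w, weight. rewrite (Rmult_comm (amp al phi u)), <- Rmult_assoc, <- exp_plus.
    replace (mu * cos u + - mu * cos u) with 0 by ring. rewrite exp_0. ring. }
  assert (E2 : forall u, 0 <= u -> expmul_im mu X Y u = c0 * (amp al phi u * sin (xi u))).
  { intros u Hu. unfold expmul_im. destruct (Eq u Hu) as [-> ->]. rewrite <- Wa.
    unfold xi. rewrite (Rplus_comm (x u)), sin_plus. ring. }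
  assert (EG : forall u, 0 <= u -> expmul_re mu X Y u * expmul_im mu A B u - expmul_im mu X Y u * expmul_re mu A B u
     = c0 * c0 * (al / 2) * (amp al phi u * amp al phi u * sin (phi u))).
  { intros u Hu. unfold expmul_re, expmul_im.
    rewrite (sin_of_chi l e phi u He). fold x.
    transitivity (exp (mu * cos u) * exp (mu * cos u) * (X u * B u - Y u * A u)).
    - assert (T := sin2_cos2 (mu * sin u)). unfold Rsqr in T.
      set (s1 := sin (mu * sin u)) in *. set (c1 := cos (mu * sin u)) in *.
      transitivity (exp (mu * cos u) * exp (mu * cos u) * ((s1 * s1 + c1 * c1) * (X u * B u - Y u * A u))); [ring|].
      rewrite T. ring.
    - unfold A, B. destruct (Eq u Hu) as [-> ->].
      replace (IZR l * u - 2 * x u) with (IZR l * u - x u - x u) by ring.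
      rewrite cos_minus, (cos_minus (IZR l * u)), (sin_minus (IZR l * u)), <- Wa.
      unfold kap. ring. }
  set (Kf := fun u => amp al phi u * amp al phi u * sin (phi u)) in *.
  assert (CK : forall u, continuous Kf u) by (intros u; unfold Kf; der_cont; ex_der).
  rewrite (RInt_ext (fun u => expmul_re mu X Y u * expmul_im mu A B u - expmul_im mu X Y u * expmul_re mu A B u)
    (fun u => c0 * c0 * (al / 2) * Kf u)) in Area.
  2:{ rewrite Rmin_left, Rmax_right by lra. intros u Hu. apply EG. lra. }
  rewrite (RInt_ext (fun u => expmul_im mu X Y u * expmul_im mu X Y u)
    (fun u => (c0 * (amp al phi u * sin (xi u))) * (c0 * (amp al phi u * sin (xi u))))) in Area.
  2:{ rewrite Rmin_left, Rmax_right by lra. intros u Hu. rewrite E2 by lra. reflexivity. }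
  assert (SK : RInt (fun u => c0 * c0 * (al / 2) * Kf u) 0 (2 * PI) = c0 * c0 * (al / 2) * RInt Kf 0 (2 * PI)).
  { apply (RInt_scal Kf). apply (ex_RInt_continuous Kf). auto. }
  rewrite SK in Area.
  assert (cc : 0 < c0 * c0) by now apply Rsqr_pos_lt.
  (* Strictness: e sin xi vanishes at 0 with derivative al/2, so the imaginary part is nonzero just
     after 0. *)
  assert (Hex : exists v, 0 < v < 2 * PI /\ 0 < e * sin (xi v)).
  { set (D := fun u => e * cos (xi u) * (al / 2 * sin (phi u))).
    assert (CD : forall u, continuous D u).
    { intros u. unfold D, xi. der_cont; ex_der. }
    assert (ee : e * e = 1) by (destruct He as [-> | ->]; ring).
    assert (D0 : D 0 = al / 2).
    { unfold D, xi. rewrite x0, sin_0, Rmult_0_r, Rplus_0_r, cos_0, (sin_of_chi l e phi 0 He). fold x.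
      rewrite x0, !Rmult_0_r, Rminus_0_r, cos_0.
      transitivity (e * e * (al / 2)); [ring|rewrite ee; ring]. }
    destruct (continuous_pos_near D 0 (CD 0) ltac:(lra)) as [d [Hd HD]].
    set (v := Rmin (d / 2) 1).
    assert (Hv : 0 < v <= 1 /\ v < d).
    { unfold v. assert (h1 := Rmin_l (d / 2) 1). assert (h2 := Rmin_r (d / 2) 1).
      assert (0 < Rmin (d / 2) 1) by (apply Rmin_glb_lt; lra). lra. }
    assert (P3 := PI2_3_2).
    exists v. split; [lra|].
    assert (L := deriv_nonpos_le (fun u => al / 4 * u - e * sin (xi u)) (fun u => al / 4 - D u) 0 v ltac:(lra)).
    assert (xi0 : sin (xi 0) = 0).
    { unfold xi. rewrite x0, sin_0, Rmult_0_r, Rplus_0_r. apply sin_0. }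
    cbv beta in L. rewrite xi0 in L.
    assert (al / 4 * v - e * sin (xi v) <= al / 4 * 0 - e * 0).
    { apply L; clear L.
      - intros u _. unfold xi, D. auto_derive; [ex_der|].
        rewrite (is_derive_unique (fun u : R => x u) _ _ (Dx u)). unfold xi, mu. field.
      - intros u Hu. specialize (HD u ltac:(rewrite Rabs_pos_eq; lra)). lra. }
    assert (0 < al / 4 * v) by (apply Rmult_lt_0_compat; lra). lra. }
  destruct Hex as [v [Hv Hsv]].
  assert (Pos : 0 < RInt (fun u => (c0 * (amp al phi u * sin (xi u))) * (c0 * (amp al phi u * sin (xi u)))) 0 (2 * PI)).
  { apply (RInt_pos_at _ 0 (2 * PI) v).
    - intros u. unfold xi. der_cont; ex_der.
    - intros; apply Rle_0_sqr.
    - exact Hv.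
    - apply Rsqr_pos_lt. apply Rmult_integral_contrapositive_currified; [exact c0n|].
      apply Rmult_integral_contrapositive_currified; [apply Rgt_not_eq, amp_pos|].
      intros E. rewrite E in Hsv. lra. }
  apply Rmult_lt_reg_l with (c0 * c0 * (al / 2)); [apply Rmult_lt_0_compat; lra|].
  rewrite Rmult_0_r. lra.
Qed.

(** * Finiteness and first variation *)

(* Polynomial functions of degree at most n with coefficient c in degree n. *)
Inductive lead_poly : nat -> R -> (R -> R) -> Prop :=
| lead_poly_0 c Q : (forall x, Q x = c) -> lead_poly 0 c Q
| lead_poly_S n c Q Q' : (forall x, is_derive Q x (Q' x)) ->
    lead_poly n (INR (S n) * c) Q' -> lead_poly (S n) c Q.

Lemma lead_poly_add n c d P Q : lead_poly n c P -> lead_poly n d Q ->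
  lead_poly n (c + d) (fun x => P x + Q x).
Proof.
  intros H. revert d Q. induction H as [c P H|n c P P' D H IH]; intros d Q HQ.
  - inversion HQ; subst. apply lead_poly_0. intros x. congruence.
  - inversion HQ as [|n' d' Q0 Q' DQ HQ']; subst.
    apply lead_poly_S with (fun x => P' x + Q' x).
    + intros x. apply @is_derive_plus; auto.
    + rewrite Rmult_plus_distr_l. now apply IH.
Qed.

Lemma lead_poly_scale n c k P : lead_poly n c P -> lead_poly n (k * c) (fun x => k * P x).
Proof.
  induction 1 as [c P H|n c P P' D H IH].
  - apply lead_poly_0. intros x. now rewrite H.
  - apply lead_poly_S with (fun x => k * P' x).
    + intros x. apply is_derive_scal, D.
    + replace (INR (S n) * (k * c)) with (k * (INR (S n) * c)) by ring. exact IH.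
Qed.

Lemma lead_poly_raise n c P : lead_poly n c P -> lead_poly (S n) 0 P.
Proof.
  induction 1 as [c P H|n c P P' D H IH].
  - apply lead_poly_S with (fun _ => 0).
    + intros x. apply is_derive_ext with (fun _ => c); [intros; symmetry; apply H|apply @is_derive_const].
    + apply lead_poly_0. intros _. ring.
  - apply lead_poly_S with P'; [exact D|]. rewrite Rmult_0_r. exact IH.
Qed.

Lemma lead_poly_mul_id n c P : lead_poly n c P -> lead_poly (S n) c (fun x => x * P x).
Proof.
  induction 1 as [c P H|n c P P' D H IH].
  - apply lead_poly_S with (fun _ => c).
    + intros x. apply is_derive_ext with (fun x => x * c); [intros; now rewrite H|].
      auto_derive; [exact I|ring].
    + apply lead_poly_0. intros _. simpl. ring.
  - apply lead_poly_S with (fun x => P x + x * P' x).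
    + intros x. auto_derive; [ex_der|].
      rewrite (is_derive_unique (fun u : R => P u) _ _ (D x)). ring.
    + replace (INR (S (S n)) * c) with (c + INR (S n) * c) by (rewrite (S_INR (S n)); ring).
      apply lead_poly_add; [|exact IH]. now apply lead_poly_S with P'.
Qed.

Lemma lead_poly_vanishing n c Q a b : lead_poly n c Q -> a < b ->
  (forall x, a < x < b -> Q x = 0) -> c = 0.
Proof.
  intros H Hab. induction H as [c Q H|n c Q Q' D H IH]; intros HQ.
  - rewrite <- (H ((a + b) / 2)). apply HQ. lra.
  - assert (E : INR (S n) * c = 0).
    { apply IH. intros x Hx.
      rewrite <- (is_derive_unique _ _ _ (D x)). apply is_derive_unique.
      apply is_derive_ext_loc with (fun _ => 0); [|apply @is_derive_const].
      assert (Hr : 0 < Rmin (x - a) (b - x)) by (apply Rmin_glb_lt; lra).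
      exists (mkposreal _ Hr). intros y Hy. symmetry. apply HQ.
      unfold ball in Hy; simpl in Hy; unfold AbsRing_ball in Hy; simpl in Hy.
      unfold abs, minus, plus, opp in Hy; simpl in Hy.
      apply Rabs_lt_between in Hy.
      assert (h1 := Rmin_l (x - a) (b - x)). assert (h2 := Rmin_r (x - a) (b - x)). lra. }
    apply Rmult_integral in E. destruct E as [E|E]; [|exact E].
    exfalso. apply (not_0_INR (S n)); [lia|exact E].
Qed.

(* Rescaled forward recurrence for the modes, as polynomials in x = mu^2. *)
Fixpoint mode_poly (a2 : R) (l : Z) (n : nat) (x : R) : R * R :=
  match n with
  | O => (1, 0)
  | S m => let (u, v) := mode_poly a2 l m x in
           let w := INR m * (IZR l - INR m) in
           ((a2 - x - w) * u - w * x * v, u)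
  end.

(** At each step only - x u reaches the top degree: the second component is the previous polynomial,
    so its coefficient in degree n is 0. *)
Lemma mode_poly_lead (a2 : R) (l : Z) (n : nat) :
  lead_poly n ((-1) ^ n) (fun x => fst (mode_poly a2 l n x)) /\
  lead_poly n 0 (fun x => snd (mode_poly a2 l n x)).
Proof.
  induction n as [|n [IH1 IH2]].
  - split; apply lead_poly_0; intros; reflexivity.
  - set (w := INR n * (IZR l - INR n)).
    assert (E : forall x, mode_poly a2 l (S n) x =
      ((a2 - w) * fst (mode_poly a2 l n x) + (-1 * (x * fst (mode_poly a2 l n x)) +
        (- w) * (x * snd (mode_poly a2 l n x))), fst (mode_poly a2 l n x))).
    { intros x. simpl. destruct (mode_poly a2 l n x) as [u v]. simpl. f_equal. fold w. ring. }
    assert (ext : forall m c P Q, lead_poly m c P -> (forall x, Q x = P x) -> lead_poly m c Q).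
    { intros m c P Q HP HE. replace (c) with (c + (-1) * 0) by ring.
      inversion HP; subst.
      - apply lead_poly_0. intros x. rewrite HE, H. ring.
      - apply lead_poly_S with Q'; [|now replace (c + -1 * 0) with c by ring].
        intros x. apply is_derive_ext with P; [intros; symmetry; apply HE|auto]. }
    split.
    + eapply ext; [|intros x; rewrite E; reflexivity]. cbn [fst].
      replace ((-1) ^ S n) with ((a2 - w) * 0 + (-1 * (-1) ^ n + - w * 0)) by (simpl; ring).
      apply lead_poly_add; [|apply lead_poly_add].
      * apply lead_poly_scale. eapply lead_poly_raise. exact IH1.
      * apply lead_poly_scale, lead_poly_mul_id, IH1.
      * apply lead_poly_scale, lead_poly_mul_id, IH2.
    + eapply ext; [|intros x; rewrite E; reflexivity]. cbn [snd].
      eapply lead_poly_raise. exact IH1.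
Qed.

(** Using the recurrence at k, k + 1 and l - k eliminates the reflected terms; what remains has
    three terms and depends only on kap^2. Scaling by mu^n n! makes it polynomial in mu^2. The
    factor [INR n] makes the second clause trivial at n = 0, where [pred] stays at 0. *)
Lemma mode_poly_value (l : Z) (m : Z -> R) (mu kap : R) :
  (forall k, IZR k * m k + mu * m (k - 1)%Z = kap * m (l - k)%Z) -> m (-1)%Z = 0 ->
  forall n, mu ^ n * INR (fact n) * m (Z.of_nat n) =
      m 0%Z * fst (mode_poly (kap * kap) l n (mu * mu)) /\
    INR n * (mu ^ pred n * INR (fact (pred n)) * m (Z.of_nat n - 1)%Z) =
      INR n * (m 0%Z * snd (mode_poly (kap * kap) l n (mu * mu))).
Proof.
  intros Hm Hm1 n.
  assert (H2 : forall k, mu * (IZR k + 1) * m (k + 1)%Z =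
    (kap * kap - mu * mu - IZR k * (IZR l - IZR k)) * m k - (IZR l - IZR k) * mu * m (k - 1)%Z).
  { intros k. assert (E1 := Hm k). assert (E2 := Hm (k + 1)%Z). assert (E3 := Hm (l - k)%Z).
    replace (k + 1 - 1)%Z with k in E2 by lia.
    replace (l - (l - k))%Z with k in E3 by lia.
    replace (l - k - 1)%Z with (l - (k + 1))%Z in E3 by lia.
    rewrite plus_IZR in E2. rewrite minus_IZR in E3.
    assert (E4 : kap * kap * m k = (IZR l - IZR k) * (kap * m (l - k)%Z) + mu * (kap * m (l - (k + 1))%Z)).
    { rewrite Rmult_assoc, <- E3. ring. }
    rewrite <- E1, <- E2 in E4. lra. }
  induction n as [|n [IH1 IH2]].
  - simpl. split; ring.
  - cbn [mode_poly pred].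
    destruct (mode_poly (kap * kap) l n (mu * mu)) as [u v]. cbn [fst snd] in *.
    split.
    + specialize (H2 (Z.of_nat n)). rewrite <- INR_IZR_INZ in H2.
      rewrite fact_simpl, mult_INR, S_INR.
      replace (Z.of_nat (S n)) with (Z.of_nat n + 1)%Z by lia.
      transitivity (mu ^ n * INR (fact n) * (mu * (INR n + 1) * m (Z.of_nat n + 1)%Z)); [simpl; ring|].
      rewrite H2.
      transitivity ((kap * kap - mu * mu - INR n * (IZR l - INR n)) * (mu ^ n * INR (fact n) * m (Z.of_nat n))
        - (IZR l - INR n) * (mu * mu) * (INR n * (mu ^ pred n * INR (fact (pred n)) * m (Z.of_nat n - 1)%Z))).
      * destruct n as [|n].
        -- simpl (Z.of_nat 0). replace (0 - 1)%Z with (-1)%Z by lia. rewrite Hm1. simpl. ring.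
        -- cbn [pred]. rewrite (fact_simpl n), mult_INR. simpl pow. ring.
      * rewrite IH1, IH2. ring.
    + f_equal. replace (Z.of_nat (S n) - 1)%Z with (Z.of_nat n) by lia. exact IH1.
Qed.

(** Mode 0 generates all the others, so it is nonzero; the forward recurrence must then reach mode
    l, which is 0. *)
Lemma mode_poly_root (l : Z) (g : Z -> R) (mu kap : R) : mu <> 0 ->
  (forall k, IZR k * g k + mu * g (k + 1)%Z = kap * g (l - k)%Z) ->
  (exists k, (1 <= k <= l)%Z /\ g k <> 0) ->
  fst (mode_poly (kap * kap) l (Z.to_nat l) (mu * mu)) = 0.
Proof.
  intros Hmu Hg [k [Hk Hgk]].
  assert (V := mode_poly_value l (mode l g) mu kap (mode_recurrence l g mu kap Hg)
    ltac:(apply mode_outside; lia)).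
  assert (M0 : mode l g 0 <> 0).
  { intros E. destruct (V (Z.to_nat (l - k))) as [V1 _].
    rewrite E, Rmult_0_l, Z2Nat.id in V1 by lia.
    apply Rmult_integral in V1. destruct V1 as [V1|V1].
    - apply Rmult_integral in V1. destruct V1 as [V1|V1].
      + now apply (pow_nonzero mu (Z.to_nat (l - k)) Hmu).
      + now apply (INR_fact_neq_0 (Z.to_nat (l - k))).
    - unfold mode in V1. replace (l - (l - k))%Z with k in V1 by lia.
      assert (0 < ifact (l - k)) by (apply ifact_pos; lia).
      assert (0 < ifact (l - 1 - (l - k))) by (apply ifact_pos; lia).
      apply Rmult_integral in V1. destruct V1 as [V1|V1]; [|contradiction].
      assert (0 < ifact (l - k) * ifact (l - 1 - (l - k))) by now apply Rmult_lt_0_compat. lra. }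
  destruct (V (Z.to_nat l)) as [V1 _]. rewrite Z2Nat.id in V1 by lia.
  rewrite (mode_outside l g l) in V1 by lia. rewrite Rmult_0_r in V1.
  symmetry in V1. apply Rmult_integral in V1. tauto.
Qed.

Lemma mode_poly_no_interval (a2 : R) (l : Z) (n : nat) (p q : R) :
  0 < p < q -> ~ (forall mu, p < mu < q -> fst (mode_poly a2 l n (mu * mu)) = 0).
Proof.
  intros Hpq H.
  assert (E : (-1) ^ n = 0).
  { apply (lead_poly_vanishing n _ _ (p * p) (q * q) (proj1 (mode_poly_lead a2 l n))); [nra|].
    intros x Hx. rewrite <- (sqrt_sqrt x) by nra. apply H. split.
    - rewrite <- (sqrt_square p) by lra. apply sqrt_lt_1; nra.
    - rewrite <- (sqrt_square q) by lra. apply sqrt_lt_1; nra. }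
  apply (pow_nonzero (-1) n); [lra|exact E].
Qed.

(** * First variation of the return map in the parameters *)

Lemma sin_taylor_bound (x y : R) : Rabs (sin y - sin x - cos x * (y - x)) <= (y - x) * (y - x).
Proof.
  destruct (MVT_gen sin x y cos) as [z [Hz E]].
  - intros. apply is_derive_sin.
  - intros. apply continuity_sin.
  - rewrite E. replace (cos z * (y - x) - cos x * (y - x)) with ((cos z - cos x) * (y - x)) by ring.
    rewrite Rabs_mult.
    assert (A := cos_lipschitz z x).
    assert (B : Rabs (z - x) <= Rabs (y - x)).
    { revert Hz. unfold Rmin, Rmax, Rabs. repeat destruct Rle_dec; repeat destruct Rcase_abs; lra. }
    assert (C : Rabs (y - x) * Rabs (y - x) = (y - x) * (y - x)).
    { rewrite <- Rabs_mult. apply Rabs_pos_eq, Rle_0_sqr. }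
    assert (0 <= Rabs (y - x)) by apply Rabs_pos. nra.
Qed.

Lemma sol_distance (al b c al' b' c' x : R) (phi psi : R -> R) (T S : R) :
  0 <= T <= S -> sol al b c x phi -> sol al' b' c' x psi ->
  Rabs (psi T - phi T) <=
  (Rabs (al' - al) + Rabs (b' - b) + Rabs (c' - c)) * (S * exp ((2 * Rabs al + 1) * S) + 1).
Proof.
  intros HT Hp Hq.
  assert (D := sol_dependence _ _ _ _ _ _ _ _ _ T (proj1 HT) Hp Hq). unfold Rsqr in D.
  set (eta := Rabs (al' - al) + Rabs (b' - b) + Rabs (c' - c)) in *.
  assert (He : 0 <= eta).
  { unfold eta. assert (0 <= Rabs (al' - al)) by apply Rabs_pos.
    assert (0 <= Rabs (b' - b)) by apply Rabs_pos. assert (0 <= Rabs (c' - c)) by apply Rabs_pos. lra. }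
  set (C := S * exp ((2 * Rabs al + 1) * S)).
  assert (Ha : 0 <= Rabs al) by apply Rabs_pos.
  assert (HC : T * exp ((2 * Rabs al + 1) * T) <= C).
  { unfold C. apply Rmult_le_compat; [lra|left; apply exp_pos|lra|].
    destruct (Req_dec T S) as [->|N]; [lra|]. left. apply exp_increasing. nra. }
  assert (HC0 : 0 <= T * exp ((2 * Rabs al + 1) * T)).
  { apply Rmult_le_pos; [lra|left; apply exp_pos]. }
  apply Rabs_le_of_sqr; [nra|].
  eapply Rle_trans; [exact D|].
  replace (eta * (C + 1) * (eta * (C + 1))) with (eta * eta * ((C + 1) * (C + 1))) by ring.
  rewrite Rmult_assoc. apply Rmult_le_compat_l; [apply Rle_0_sqr|nra].
Qed.

(** Multiplication by amp^2 cancels the linear part of the equation for psi - phi: the derivative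
    becomes d amp^2 (p sin phi - q) plus O(d^2), and for small d the remainder cannot change the
    sign. *)
Lemma first_variation (al b c x p q : R) (phi : R -> R) :
  sol al b c x phi ->
  0 < RInt (fun u => amp al phi u * amp al phi u * (p * sin (phi u) - q)) 0 (2 * PI) ->
  exists d0, 0 < d0 /\ forall d psi, 0 < Rabs d < d0 ->
    sol (al - d * p) (b - d * q) c x psi -> 0 < d * (psi (2 * PI) - phi (2 * PI)).
Proof.
  intros H HL. assert (HPI := PI_RGT_0).
  assert (Da := fun u => amp_derive _ _ _ _ _ u H).
  assert (Dp := proj2 H). cbv beta in Dp.
  set (f := fun u => amp al phi u * amp al phi u * (p * sin (phi u) - q)) in *.
  assert (Cf : forall u, continuous f u) by (intros u; unfold f; der_cont; ex_der).
  assert (Cm : forall u, continuous (fun u => amp al phi u * amp al phi u) u)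
    by (intros u; der_cont; ex_der).
  destruct (continuous_bounded _ 0 (2 * PI) Cm) as [M [HM BM]].
  set (L := RInt f 0 (2 * PI)) in *.
  (* C bounds |psi - phi| / |d|, and E bounds the remainder divided by d^2. *)
  set (C := (Rabs p + Rabs q) * (2 * PI * exp ((2 * Rabs al + 1) * (2 * PI)) + 1)).
  set (E := M * (Rabs al * (C * C) + Rabs p * C)).
  assert (Hp : 0 <= Rabs p) by apply Rabs_pos. assert (Hq : 0 <= Rabs q) by apply Rabs_pos.
  assert (Ha : 0 <= Rabs al) by apply Rabs_pos.
  assert (HC : 0 <= C).
  { unfold C. assert (0 < exp ((2 * Rabs al + 1) * (2 * PI))) by apply exp_pos.
    apply Rmult_le_pos; [lra|]. nra. }
  assert (HE : 0 <= E).
  { unfold E. apply Rmult_le_pos; [lra|]. apply Rplus_le_le_0_compat; apply Rmult_le_pos; try lra.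
    apply Rmult_le_pos; exact HC. }
  exists (L / (2 * PI * E + 1)).
  assert (Hden : 0 < 2 * PI * E + 1) by nra.
  split; [now apply Rdiv_lt_0_compat|].
  intros d psi Hd Hpsi.
  assert (Bd : forall u, 0 <= u <= 2 * PI -> Rabs (psi u - phi u) <= Rabs d * C).
  { intros u Hu. eapply Rle_trans; [exact (sol_distance _ _ _ _ _ _ _ _ _ u (2 * PI) Hu H Hpsi)|].
    replace (al - d * p - al) with (- (d * p)) by ring.
    replace (b - d * q - b) with (- (d * q)) by ring.
    rewrite Rminus_diag, Rabs_R0, !Rabs_Ropp, !Rabs_mult. unfold C. right. ring. }
  assert (Dpsi := proj2 Hpsi). cbv beta in Dpsi.
  assert (Df := fun u => antiderivative_continuous f 0 u Cf).
  assert (B := deriv_bound_le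
    (fun u => amp al phi u * amp al phi u * (psi u - phi u) - d * RInt f 0 u)
    (fun u => amp al phi u * amp al phi u *
      (- al * (sin (psi u) - sin (phi u) - cos (phi u) * (psi u - phi u)) + d * p * (sin (psi u) - sin (phi u))))
    (E * (d * d)) 0 (2 * PI) ltac:(lra)).
  cbv beta in B. rewrite RInt_point in B. destruct H as [H0 _]. destruct Hpsi as [Hpsi0 _].
  rewrite H0, Hpsi0 in B. unfold zero in B; simpl in B.
  assert (B' : Rabs (amp al phi (2 * PI) * amp al phi (2 * PI) * (psi (2 * PI) - phi (2 * PI)) - d * L
     - (amp al phi 0 * amp al phi 0 * (x - x) - d * 0)) <= E * (d * d) * (2 * PI - 0)).
  { apply B; clear B.
    - intros u _.
      set (IF := fun u => RInt f 0 u) in *.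
      change (is_derive (fun u => amp al phi u * amp al phi u * (psi u - phi u) - d * IF u) u
       (amp al phi u * amp al phi u *
      (- al * (sin (psi u) - sin (phi u) - cos (phi u) * (psi u - phi u)) + d * p * (sin (psi u) - sin (phi u))))).
      clearbody IF. auto_derive; [ex_der|].
      rewrite (is_derive_unique (fun u : R => amp al phi u) _ _ (Da u)),
        (is_derive_unique (fun u : R => phi u) _ _ (Dp u)),
        (is_derive_unique (fun u : R => psi u) _ _ (Dpsi u)),
        (is_derive_unique (fun u : R => IF u) _ _ (Df u)).
      unfold f, fld. field.
    - intros u Hu. specialize (BM u Hu). specialize (Bd u Hu).
      rewrite Rabs_mult. replace (E * (d * d)) with (M * ((Rabs al * (C * C) + Rabs p * C) * (d * d))) by (unfold E; ring).
      apply Rmult_le_compat; try apply Rabs_pos; [exact BM|].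
      eapply Rle_trans; [apply Rabs_triang|]. rewrite !Rabs_mult, Rabs_Ropp.
      assert (T1 := sin_taylor_bound (phi u) (psi u)).
      assert (T2 := sin_lipschitz (psi u) (phi u)).
      set (y := psi u - phi u) in *.
      assert (yy : y * y <= (Rabs d * C) * (Rabs d * C)).
      { apply Rsqr_le_abs_1. rewrite (Rabs_pos_eq (Rabs d * C)); [exact Bd|].
        apply Rmult_le_pos; [apply Rabs_pos|exact HC]. }
      assert (dd : Rabs d * Rabs d = d * d) by (rewrite <- Rabs_mult; apply Rabs_pos_eq, Rle_0_sqr).
      apply Rle_trans with (Rabs al * (Rabs d * C * (Rabs d * C)) + Rabs d * Rabs p * (Rabs d * C)).
      + apply Rplus_le_compat.
        * apply Rmult_le_compat_l; lra.
        * apply Rmult_le_compat_l; [|lra]. apply Rmult_le_pos; [apply Rabs_pos|exact Hp].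
      + rewrite <- dd. right. ring. }
  replace (amp al phi 0 * amp al phi 0 * (x - x) - d * 0) with 0 in B' by ring.
  rewrite !Rminus_0_r in B'. apply Rabs_le_between in B'.
  set (m := amp al phi (2 * PI) * amp al phi (2 * PI)) in *.
  assert (Hm : 0 < m) by (apply Rmult_lt_0_compat; apply amp_pos).
  set (y := psi (2 * PI) - phi (2 * PI)) in *.
  assert (dd : Rabs d * Rabs d = d * d) by (rewrite <- Rabs_mult; apply Rabs_pos_eq, Rle_0_sqr).
  assert (Hd2 : Rabs d * (2 * PI * E + 1) < L).
  { apply Rlt_le_trans with (L / (2 * PI * E + 1) * (2 * PI * E + 1)).
    - apply Rmult_lt_compat_r; lra.
    - right. field. lra. }
  apply Rmult_lt_reg_l with m; [exact Hm|]. rewrite Rmult_0_r.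
  replace (m * (d * y)) with (d * (m * y - d * L) + d * d * L) by ring.
  assert (K : Rabs (d * (m * y - d * L)) <= Rabs d * (E * (d * d) * (2 * PI))).
  { rewrite Rabs_mult. apply Rmult_le_compat_l; [lra|]. apply Rabs_le. exact B'. }
  apply Rabs_le_between in K.
  assert (K2 : Rabs d * (E * (d * d) * (2 * PI)) < d * d * L).
  { replace (Rabs d * (E * (d * d) * (2 * PI))) with (d * d * (Rabs d * (2 * PI * E))) by ring.
    apply Rmult_lt_compat_l; [|lra]. rewrite <- dd. apply Rmult_lt_0_compat; lra. }
  lra.
Qed.

(** Both fixed orbits return with amplitude 1, so the linear system fixes two independent directions
    up to a common sign. The Wronskians of h with them give r exp(i u) = exp(i v), hence r = 1 and h
    returns to y modulo 2 pi. *)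
Lemma identity_of_two_fixed (al b c y : R) (s : Z) (f g h : R -> R) :
  sol al b c (PI / 2) f -> f (2 * PI) = PI / 2 + 2 * PI * IZR s ->
  sol al b c (- (PI / 2)) g -> g (2 * PI) = - (PI / 2) + 2 * PI * IZR s ->
  sol al b c y h -> exists k : Z, h (2 * PI) = y + 2 * PI * IZR k.
Proof.
  intros Hf Ef Hg Eg Hh. assert (HPI := PI_RGT_0).
  assert (Hf' : sol al b c (1 * (PI / 2)) f) by now rewrite Rmult_1_l.
  assert (Hg' : sol al b c (-1 * (PI / 2)) g) by (now replace (-1 * (PI / 2)) with (- (PI / 2)) by ring).
  assert (Af : amp al f (2 * PI) = 1).
  { apply (amp_2PI al b c 1 s f Hf'); [rewrite Ef; ring|now left]. }
  assert (Ag : amp al g (2 * PI) = 1).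
  { apply (amp_2PI al b c (-1) s g Hg'); [rewrite Eg; ring|now right]. }
  assert (W1 := wronskian_const _ _ _ _ _ _ _ (2 * PI) ltac:(lra) Hh Hf).
  assert (W2 := wronskian_const _ _ _ _ _ _ _ (2 * PI) ltac:(lra) Hh Hg).
  rewrite Af, Ef in W1. rewrite Ag, Eg in W2.
  set (r := amp al h (2 * PI)) in *. assert (Hr : 0 < r) by apply amp_pos.
  set (u := h (2 * PI) / 2 - PI * IZR s). set (v := y / 2).
  replace ((h (2 * PI) - (PI / 2 + 2 * PI * IZR s)) / 2) with (u - PI / 4) in W1 by (unfold u; field).
  replace ((h (2 * PI) - (- (PI / 2) + 2 * PI * IZR s)) / 2) with (u + PI / 4) in W2 by (unfold u; field).
  replace ((y - PI / 2) / 2) with (v - PI / 4) in W1 by (unfold v; field).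
  replace ((y - - (PI / 2)) / 2) with (v + PI / 4) in W2 by (unfold v; field).
  rewrite !sin_minus, cos_PI4, sin_PI4 in W1. rewrite !sin_plus, cos_PI4, sin_PI4 in W2.
  assert (Hs : 0 < 1 / sqrt 2) by (apply Rdiv_lt_0_compat; [lra|apply sqrt_lt_R0; lra]).
  set (k := 1 / sqrt 2) in *.
  assert (S : r * sin u = sin v).
  { apply Rmult_eq_reg_r with k; [lra|lra]. }
  assert (C : r * cos u = cos v).
  { apply Rmult_eq_reg_r with k; [lra|lra]. }
  assert (R1 : r = 1).
  { assert (T1 := sin2_cos2 u). assert (T2 := sin2_cos2 v). unfold Rsqr in T1, T2.
    rewrite <- S, <- C in T2.
    assert (r * r = 1).
    { replace (r * r) with (r * r * (sin u * sin u + cos u * cos u)) by (rewrite T1; ring). lra. }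
    nra. }
  rewrite R1, Rmult_1_l in S, C.
  assert (Z : sin ((u - v) / 2) = 0).
  { assert (E : cos (u - v) = 1).
    { rewrite cos_minus, S, C. assert (T := sin2_cos2 v). unfold Rsqr in T. lra. }
    replace (u - v) with (2 * ((u - v) / 2)) in E by field.
    rewrite cos_2a_sin in E. apply Rsqr_0_uniq. unfold Rsqr. lra. }
  destruct (sin_eq_0_0 _ Z) as [n Hn].
  exists (s + 2 * n)%Z. rewrite plus_IZR, mult_IZR. unfold u, v in Hn. lra.
Qed.

(** * The tangency *)

Definition defect (s : Z) (x al b c : R) : R :=
  flow al b c x (2 * PI) - x - 2 * PI * IZR s.

Lemma defect_distance (s : Z) (x al b c al' b' c' : R) :
  Rabs (defect s x al' b' c' - defect s x al b c) <=
  (Rabs (al' - al) + Rabs (b' - b) + Rabs (c' - c))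
    * (2 * PI * exp ((2 * Rabs al + 1) * (2 * PI)) + 1).
Proof.
  assert (HPI := PI_RGT_0). unfold defect.
  match goal with |- Rabs ?z <= _ =>
    replace z with (flow al' b' c' x (2 * PI) - flow al b c x (2 * PI)) by ring end.
  eapply sol_distance; [lra|apply flow_sol|apply flow_sol].
Qed.

Lemma defect_continuous (s : Z) (x al b c : R) (eps : R) : 0 < eps ->
  exists r, 0 < r /\ forall al' b' c',
    Rabs (al' - al) + Rabs (b' - b) + Rabs (c' - c) < r ->
    Rabs (defect s x al' b' c' - defect s x al b c) < eps.
Proof.
  intros He. assert (HPI := PI_RGT_0).
  set (K := 2 * PI * exp ((2 * Rabs al + 1) * (2 * PI)) + 1).
  assert (HK : 0 < K).
  { unfold K. assert (0 < exp ((2 * Rabs al + 1) * (2 * PI))) by apply exp_pos. nra. }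
  exists (eps / K). split; [now apply Rdiv_lt_0_compat|].
  intros al' b' c' H. eapply Rle_lt_trans; [apply defect_distance|]. fold K.
  apply Rlt_le_trans with (eps / K * K); [now apply Rmult_lt_compat_r|].
  right. field. lra.
Qed.

Lemma continuity_of_abs (f : R -> R) :
  (forall x eps, 0 < eps -> exists r, 0 < r /\ forall y, Rabs (y - x) < r -> Rabs (f y - f x) < eps) ->
  continuity f.
Proof.
  intros H x eps He. destruct (H x eps He) as [r [Hr Hy]]. exists r. split; [exact Hr|].
  intros y [_ Hd]. now apply Hy.
Qed.

Lemma defect_continuity_b (s : Z) (x al c : R) : continuity (fun b => defect s x al b c).
Proof.
  apply continuity_of_abs. intros b eps He.
  destruct (defect_continuous s x al b c eps He) as [r [Hr H]]. exists r. split; [exact Hr|].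
  intros b' Hb. apply H. rewrite !Rminus_diag, Rabs_R0. lra.
Qed.

Lemma defect_continuity_c (s : Z) (x al b : R) : continuity (fun c => defect s x al b c).
Proof.
  apply continuity_of_abs. intros c eps He.
  destruct (defect_continuous s x al b c eps He) as [r [Hr H]]. exists r. split; [exact Hr|].
  intros c' Hc. apply H. rewrite !Rminus_diag, Rabs_R0. lra.
Qed.

Lemma bdry_sgn_iff (om B A : R) (s : Z) (sg : bool) : 0 < om ->
  bdry_sgn om s sg B A <-> defect s (half_pi sg) (/ om) (B / om) (A / om) = 0.
Proof.
  intros Hom. set (x := half_pi sg).
  assert (F := flow_sol (/ om) (B / om) (A / om) x).
  unfold defect. split.
  - intros [H1 H2].
    assert (E := fixed_of_poinc_fixes om B A x s _ Hom H1 H2 F). lra.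
  - intros E. assert (E' : flow (/ om) (B / om) (A / om) x (2 * PI) = x + 2 * PI * IZR s) by lra.
    split; [now apply (phase_lock_of_fixed om B A x s _ Hom F)|].
    now apply (poinc_fixes_of_fixed om B A x s _ Hom F).
Qed.

Lemma rotation_unique (al b c x y : R) (s n : Z) :
  defect s x al b c = 0 -> defect n y al b c = 0 -> n = s.
Proof.
  unfold defect. intros H1 H2.
  assert (F1 := flow_sol al b c x). assert (F2 := flow_sol al b c y).
  assert (L1 := rotation_number_fixed _ _ _ _ s _ F1 ltac:(lra) _ _ F1).
  assert (L2 := rotation_number_fixed _ _ _ _ n _ F2 ltac:(lra) _ _ F1).
  apply is_lim_seq_unique in L1. apply is_lim_seq_unique in L2.
  rewrite L1 in L2. apply eq_IZR. symmetry. now injection L2.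
Qed.

Definition sgnR (sg : bool) : R := if sg then 1 else -1.

Lemma sgnR_cases (sg : bool) : sgnR sg = 1 \/ sgnR sg = -1.
Proof. destruct sg; [now left|now right]. Qed.

Lemma half_pi_sgnR (sg : bool) : half_pi sg = sgnR sg * (PI / 2).
Proof. destruct sg; unfold half_pi, sgnR; ring. Qed.

(* If all the coefficients vanished, the orbit of the opposite point would be
   fixed as well. *)
Lemma exists_nonzero_coef (al c : R) (l s : Z) (sg : bool) :
  (1 <= l)%Z -> 0 < c -> Z.Even (s - l) ->
  defect s (half_pi sg) al (IZR l) c = 0 ->
  defect s (half_pi (negb sg)) al (IZR l) c <> 0 ->
  exists k, (1 <= k <= l)%Z /\ coef al c (sgnR sg) l (flow al (IZR l) c (half_pi sg)) k <> 0.
Proof.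
  intros Hl Hc Hsl H0 H1. apply NNPP. intros Hn.
  assert (F := flow_sol al (IZR l) c (half_pi sg)).
  assert (F' := flow_sol al (IZR l) c (half_pi (negb sg))).
  assert (E' : half_pi (negb sg) = - sgnR sg * (PI / 2))
    by (destruct sg; unfold half_pi, sgnR; simpl; ring).
  unfold defect in H0.
  destruct (companion_fixed al c (sgnR sg) l s (flow al (IZR l) c (half_pi sg))
    (flow al (IZR l) c (half_pi (negb sg))) (sgnR_cases sg) Hl Hc) as [n Hfix].
  - rewrite <- half_pi_sgnR. exact F.
  - rewrite <- half_pi_sgnR. lra.
  - exact Hsl.
  - rewrite <- E'. exact F'.
  - intros k Hk. apply NNPP. intros Hne. apply Hn. now exists k.
  - rewrite <- E' in Hfix. apply H1.
    assert (Hd : defect n (half_pi (negb sg)) al (IZR l) c = 0) by (unfold defect; lra).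
    assert (H0' : defect s (half_pi sg) al (IZR l) c = 0) by (unfold defect; lra).
    now rewrite <- (rotation_unique _ _ _ _ _ _ _ H0' Hd).
Qed.

Lemma constriction_of_both_fixed (om B A : R) (s : Z) (sg : bool) : 0 < om -> A <> 0 ->
  defect s (half_pi sg) (/ om) (B / om) (A / om) = 0 ->
  defect s (half_pi (negb sg)) (/ om) (B / om) (A / om) = 0 ->
  constriction om B A.
Proof.
  intros Hom HA H1 H2.
  assert (P : forall sg', defect s (half_pi sg') (/ om) (B / om) (A / om) = 0).
  { intros sg'. destruct sg, sg'; assumption. }
  split; [|split; [exact HA|]].
  - exists s. apply (bdry_sgn_iff om B A s sg Hom), H1.
  - intros y h Hh. apply is_sol_iff in Hh; [|exact Hom].
    assert (Q1 := P true). assert (Q2 := P false). unfold defect in Q1, Q2.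
    apply (identity_of_two_fixed _ _ _ y s _ _ h
      (flow_sol (/ om) (B / om) (A / om) (half_pi true)) ltac:(unfold half_pi in *; lra)
      (flow_sol (/ om) (B / om) (A / om) (half_pi false)) ltac:(unfold half_pi in *; lra) Hh).
Qed.

(** If the curve contained an arc of the axis, the opposite orbit would still not be fixed near c0,
    so E would exist for every mu in an interval, against the polynomial equation in mu^2. *)
Lemma defect_nonzero_nearby (al c0 : R) (l s : Z) (sg : bool) (r : R) :
  (1 <= l)%Z -> 0 < c0 -> Z.Even (s - l) -> 0 < r ->
  defect s (half_pi (negb sg)) al (IZR l) c0 <> 0 ->
  exists c, Rabs (c - c0) < r /\ 0 < c /\ defect s (half_pi sg) al (IZR l) c <> 0.
Proof.
  intros Hl Hc0 Hsl Hr H1. apply NNPP. intros Hn.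
  destruct (defect_continuous s (half_pi (negb sg)) al (IZR l) c0
    (Rabs (defect s (half_pi (negb sg)) al (IZR l) c0)) (Rabs_pos_lt _ H1)) as [r1 [Hr1 C1]].
  set (d := Rmin (c0 / 2) (Rmin r r1)).
  assert (Hd : 0 < d /\ d <= c0 / 2 /\ d <= r /\ d <= r1).
  { unfold d. assert (A := Rmin_l (c0 / 2) (Rmin r r1)). assert (B := Rmin_r (c0 / 2) (Rmin r r1)).
    assert (C := Rmin_l r r1). assert (D := Rmin_r r r1).
    assert (0 < Rmin (c0 / 2) (Rmin r r1)) by (repeat apply Rmin_glb_lt; lra). lra. }
  apply (mode_poly_no_interval ((sgnR sg * (al / 2)) * (sgnR sg * (al / 2))) l (Z.to_nat l) (c0 / 2) ((c0 + d) / 2)); [lra|].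
  intros mu Hmu. set (c := 2 * mu).
  assert (Hc : c0 < c < c0 + d) by (unfold c; lra).
  assert (Hz : defect s (half_pi sg) al (IZR l) c = 0).
  { apply NNPP. intros Hne. apply Hn. exists c. split; [rewrite Rabs_pos_eq; lra|]. split; [lra|exact Hne]. }
  assert (Hz1 : defect s (half_pi (negb sg)) al (IZR l) c <> 0).
  { intros E. specialize (C1 al (IZR l) c). rewrite E, !Rminus_diag, Rabs_R0 in C1.
    rewrite Rminus_0_l, Rabs_Ropp in C1.
    assert (Rabs (c - c0) = c - c0) by (apply Rabs_pos_eq; lra). lra. }
  assert (Ex := exists_nonzero_coef al c l s sg Hl ltac:(lra) Hsl Hz Hz1).
  assert (F := flow_sol al (IZR l) c (half_pi sg)). rewrite half_pi_sgnR in F at 1.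
  apply mode_poly_root with (coef al c (sgnR sg) l (flow al (IZR l) c (half_pi sg))).
  - lra.
  - intros k. replace mu with (c / 2) by (unfold c; field).
    apply (coef_recurrence al c (sgnR sg) l s _ k (sgnR_cases sg)).
    + exact F.
    + rewrite <- half_pi_sgnR. unfold defect in Hz. lra.
  - exact Ex.
Qed.

Theorem theorem1p30 :
  forall (om0 : R) (l s : Z) (sg : bool) (mu : R),
    0 < om0 -> (1 <= l)%Z -> (0 <= s)%Z -> s <> l -> 0 < mu ->
    left_moving_tangency om0 l s sg (IZR l * om0) (2 * mu * om0) ->
    ~ gen_simple_int om0 l (IZR l * om0) (2 * mu * om0).
Proof.
  intros om0 l s sg mu Hom Hl _ _ Hmu (Hb & _ & [dg [Hdg Hg]] & [r [Hr [eps [Heps Hmv]]]])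
    [s' (Hev & _ & Hb' & Hnc)].
  assert (HPI := PI_RGT_0).
  set (al0 := / om0). set (c0 := 2 * mu). set (x := half_pi sg). set (b0 := IZR l).
  assert (Hal0 : 0 < al0) by now apply Rinv_0_lt_compat.
  assert (Hao : al0 * om0 = 1) by (unfold al0; field; lra).
  assert (Hb0 : 1 <= b0) by now apply IZR_le.
  assert (Hc0 : 0 < c0) by (unfold c0; lra).
  assert (Eb : IZR l * om0 / om0 = b0) by (unfold b0; field; lra).
  assert (Ec : 2 * mu * om0 / om0 = c0) by (unfold c0; field; lra).
  assert (Bi : forall b c, bdry_sgn om0 s sg (b * om0) (c * om0) <-> defect s x al0 b c = 0).
  { intros b c. rewrite (bdry_sgn_iff om0 _ _ s sg Hom).
    replace (b * om0 / om0) with b by (field; lra). replace (c * om0 / om0) with c by (field; lra).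
    reflexivity. }
  assert (Z0 : defect s x al0 b0 c0 = 0) by now apply Bi.
  (* The parity is given for some s' and an unspecified sign; uniqueness of the rotation number
     identifies s' with s. *)
  assert (Es : s' = s).
  { assert (Q : exists sg', defect s' (half_pi sg') al0 b0 c0 = 0).
    { destruct Hb' as [Hb'|Hb']; [exists true|exists false];
        apply (bdry_sgn_iff om0 _ _ s' _ Hom) in Hb'; rewrite Eb, Ec in Hb'; exact Hb'. }
    destruct Q as [sg' Q]. exact (rotation_unique _ _ _ _ _ _ _ Z0 Q). }
  rewrite Es in Hev.
  assert (N0 : defect s (half_pi (negb sg)) al0 b0 c0 <> 0).
  { intros E. apply Hnc. apply (constriction_of_both_fixed om0 _ _ s sg Hom).
    - apply Rgt_not_eq. apply Rmult_lt_0_compat; lra.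
    - rewrite Eb, Ec. exact Z0.
    - rewrite Eb, Ec. exact E. }
  assert (F0 := flow_sol al0 b0 c0 x).
  assert (K : 0 < RInt (fun u => amp al0 (flow al0 b0 c0 x) u * amp al0 (flow al0 b0 c0 x) u * sin (flow al0 b0 c0 x u)) 0 (2 * PI)).
  { apply (amp_sin_integral_pos al0 c0 (sgnR sg) l s _ (sgnR_cases sg) Hl Hc0 Hal0).
    - rewrite <- half_pi_sgnR. exact F0.
    - rewrite <- half_pi_sgnR. unfold defect in Z0. fold x. lra.
    - exact (exists_nonzero_coef al0 c0 l s sg Hl Hc0 Hev Z0 N0). }
  (* (p, q) = (1, 0) lowers al at fixed b = l, that is, raises the frequency along the axis. *)
  destruct (first_variation al0 b0 c0 x 1 0 _ F0) as [d1 [Hd1 V1]].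
  { rewrite (RInt_ext _ (fun u => amp al0 (flow al0 b0 c0 x) u * amp al0 (flow al0 b0 c0 x) u * sin (flow al0 b0 c0 x u))); [exact K|].
    intros u _. match goal with |- ?v = ?w => change (@eq R v w) end. ring. }
  assert (P1 : forall d, 0 < d < d1 -> 0 < defect s x (al0 - d) b0 c0).
  { intros d Hd.
    assert (S := V1 d (flow (al0 - d) b0 c0 x) ltac:(rewrite Rabs_pos_eq; lra)).
    rewrite Rmult_1_r, Rmult_0_r, Rminus_0_r in S. specialize (S (flow_sol _ _ _ _)).
    unfold defect in *. replace (flow al0 b0 c0 x (2 * PI)) with (x + 2 * PI * IZR s) in S by lra. nra. }
  (* (p, q) = (0, -1) moves b off the axis: the integrand is amp^2 > 0, and a negative d goes to the
     left. *)
  destruct (first_variation al0 b0 c0 x 0 (-1) _ F0) as [d2 [Hd2 V2]].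
  { assert (Da := fun u => amp_derive _ _ _ _ _ u F0).
    assert (Df := proj2 F0). cbv beta in Df.
    apply (RInt_pos_at _ 0 (2 * PI) PI).
    - intros u. der_cont; ex_der.
    - intros u _. assert (A := amp_pos al0 (flow al0 b0 c0 x) u). nra.
    - lra.
    - assert (A := amp_pos al0 (flow al0 b0 c0 x) PI). nra. }
  assert (P2 : forall d, 0 < d < d2 -> defect s x al0 (b0 - d) c0 < 0).
  { intros d Hd.
    assert (S := V2 (- d) (flow al0 (b0 - d) c0 x) ltac:(rewrite Rabs_Ropp, Rabs_pos_eq; lra)).
    replace (al0 - - d * 0) with al0 in S by ring. replace (b0 - - d * -1) with (b0 - d) in S by ring.
    specialize (S (flow_sol _ _ _ _)). unfold defect in *.
    replace (flow al0 b0 c0 x (2 * PI)) with (x + 2 * PI * IZR s) in S by lra. nra. }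
  (* A positive value on the axis, against the negative one at b0 - be, would put a point of the
     curve to the left of the axis within the germ. *)
  assert (P3 : exists r3, 0 < r3 /\ forall c, Rabs (c - c0) < r3 -> defect s x al0 b0 c <= 0).
  { set (be := Rmin (d2 / 2) (dg * al0 / 2)).
    assert (Hbe : 0 < be /\ be < d2 /\ be * om0 < dg).
    { unfold be. assert (0 < dg * al0) by now apply Rmult_lt_0_compat.
      assert (A := Rmin_l (d2 / 2) (dg * al0 / 2)). assert (B := Rmin_r (d2 / 2) (dg * al0 / 2)).
      assert (0 < Rmin (d2 / 2) (dg * al0 / 2)) by (apply Rmin_glb_lt; lra).
      repeat split; try lra.
      apply Rle_lt_trans with (dg * al0 / 2 * om0); [apply Rmult_le_compat_r; lra|].
      replace (dg * al0 / 2 * om0) with (dg * (al0 * om0) / 2) by field. rewrite Hao. lra. }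
    assert (Hneg := P2 be ltac:(lra)).
    destruct (defect_continuous s x al0 (b0 - be) c0 (- defect s x al0 (b0 - be) c0) ltac:(lra)) as [r1 [Hr1 C1]].
    exists (Rmin r1 (dg * al0)). split; [apply Rmin_glb_lt; [lra|now apply Rmult_lt_0_compat]|].
    intros c Hc. apply Rnot_lt_le. intros Hpos.
    assert (A := Rmin_l r1 (dg * al0)). assert (B := Rmin_r r1 (dg * al0)).
    assert (Hneg' : defect s x al0 (b0 - be) c < 0).
    { specialize (C1 al0 (b0 - be) c). rewrite !Rminus_diag, Rabs_R0 in C1.
      specialize (C1 ltac:(lra)). apply Rabs_lt_between in C1. lra. }
    destruct (IVT_gen (fun b => defect s x al0 b c) (b0 - be) b0 0 (defect_continuity_b s x al0 c)) as [bs [Hbs Ebs]].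
    { rewrite Rmin_left, Rmax_right by lra. lra. }
    rewrite Rmin_left, Rmax_right in Hbs by lra.
    assert (Hne : bs <> b0) by (intros ->; lra).
    assert (G := Hg (bs * om0) (c * om0) (proj2 (Bi bs c) Ebs)). fold b0 c0 in G.
    assert (b0 * om0 <= bs * om0).
    { apply G.
      - replace (bs * om0 - b0 * om0) with (- ((b0 - bs) * om0)) by ring.
        rewrite Rabs_Ropp, Rabs_pos_eq by (apply Rmult_le_pos; lra).
        apply Rle_lt_trans with (be * om0); [apply Rmult_le_compat_r; lra|lra].
      - replace (c * om0 - c0 * om0) with ((c - c0) * om0) by ring.
        rewrite Rabs_mult, (Rabs_pos_eq om0) by lra.
        apply Rlt_le_trans with (dg * al0 * om0); [apply Rmult_lt_compat_r; lra|].
        rewrite Rmult_assoc, Hao. lra. }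
    assert (bs < b0) by lra. nra. }
  destruct P3 as [r3 [Hr3 P3]].
  (* The new frequency will be at most 2 om0, so moving c costs at most r/2; the other half of r
     pays for (om - om0) c0. *)
  set (r4 := Rmin r3 (r / (4 * om0))).
  assert (Hr4 : 0 < r4 /\ r4 <= r3 /\ r4 * (4 * om0) <= r).
  { unfold r4. assert (0 < r / (4 * om0)) by (apply Rdiv_lt_0_compat; lra).
    split; [apply Rmin_glb_lt; lra|]. split; [apply Rmin_l|].
    apply Rle_trans with (r / (4 * om0) * (4 * om0)).
    - apply Rmult_le_compat_r; [lra|apply Rmin_r].
    - right. field. lra. }
  (* The inequality of [P3] alone allows the defect to vanish along the axis; the finiteness of the
     admissible mu supplies a point c1 where it is nonzero, hence negative. *)
  destruct (defect_nonzero_nearby al0 c0 l s sg r4 Hl Hc0 Hev ltac:(lra) N0) as [c1 (Hc1 & Hc1p & Hc1n)].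
  fold x b0 in Hc1n.
  assert (Neg : defect s x al0 b0 c1 < 0).
  { specialize (P3 c1 ltac:(lra)). lra. }
  destruct (defect_continuous s x al0 b0 c1 (- defect s x al0 b0 c1) ltac:(lra)) as [r5 [Hr5 C5]].
  (* For d <= al0/2 the frequency om = 1/(al0 - d) exceeds om0 by at most 2 d om0^2. *)
  set (bd := Rmin eps (Rmin om0 (Rmin (r / b0) (r / (2 * c0))))).
  assert (Hbd : 0 < bd /\ bd <= eps /\ bd <= om0 /\ bd * b0 <= r /\ bd * (2 * c0) <= r).
  { assert (0 < r / b0) by (apply Rdiv_lt_0_compat; lra).
    assert (0 < r / (2 * c0)) by (apply Rdiv_lt_0_compat; lra).
    assert (A1 := Rmin_l eps (Rmin om0 (Rmin (r / b0) (r / (2 * c0))))).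
    assert (A2 := Rmin_r eps (Rmin om0 (Rmin (r / b0) (r / (2 * c0))))).
    assert (A3 := Rmin_l om0 (Rmin (r / b0) (r / (2 * c0)))).
    assert (A4 := Rmin_r om0 (Rmin (r / b0) (r / (2 * c0)))).
    assert (A5 := Rmin_l (r / b0) (r / (2 * c0))).
    assert (A6 := Rmin_r (r / b0) (r / (2 * c0))).
    assert (0 < bd) by (unfold bd; repeat apply Rmin_glb_lt; lra).
    fold bd in A1, A2. split; [lra|]. split; [lra|]. split; [lra|]. split.
    - apply Rle_trans with (r / b0 * b0); [apply Rmult_le_compat_r; lra|right; field; lra].
    - apply Rle_trans with (r / (2 * c0) * (2 * c0)); [apply Rmult_le_compat_r; lra|right; field; lra]. }
  (* d1 keeps the value at c0 positive, r5 the value at c1 negative; the last two bounds keep om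
     within bd of om0. *)
  set (d := Rmin (d1 / 2) (Rmin (r5 / 2) (Rmin (al0 / 2) (bd / (4 * (om0 * om0)))))).
  assert (oo : 0 < om0 * om0) by now apply Rmult_lt_0_compat.
  assert (Hd : 0 < d /\ d < d1 /\ d < r5 /\ d <= al0 / 2 /\ d * (4 * (om0 * om0)) <= bd).
  { assert (0 < bd / (4 * (om0 * om0))) by (apply Rdiv_lt_0_compat; lra).
    assert (A1 := Rmin_l (d1 / 2) (Rmin (r5 / 2) (Rmin (al0 / 2) (bd / (4 * (om0 * om0)))))).
    assert (A2 := Rmin_r (d1 / 2) (Rmin (r5 / 2) (Rmin (al0 / 2) (bd / (4 * (om0 * om0)))))).
    assert (A3 := Rmin_l (r5 / 2) (Rmin (al0 / 2) (bd / (4 * (om0 * om0))))).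
    assert (A4 := Rmin_r (r5 / 2) (Rmin (al0 / 2) (bd / (4 * (om0 * om0))))).
    assert (A5 := Rmin_l (al0 / 2) (bd / (4 * (om0 * om0)))).
    assert (A6 := Rmin_r (al0 / 2) (bd / (4 * (om0 * om0)))).
    assert (0 < d) by (unfold d; repeat apply Rmin_glb_lt; lra).
    fold d in A1, A2. split; [lra|]. split; [lra|]. split; [lra|]. split; [lra|].
    apply Rle_trans with (bd / (4 * (om0 * om0)) * (4 * (om0 * om0))); [apply Rmult_le_compat_r; lra|right; field; lra]. }
  set (om := / (al0 - d)).
  assert (Hal : 0 < al0 - d) by lra.
  assert (Homp : 0 < om) by now apply Rinv_0_lt_compat.
  assert (Eom : om * (al0 - d) = 1) by (unfold om; field; lra).
  assert (Hom1 : om0 < om /\ om - om0 < bd).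
  { assert (E : om - om0 = d * (om * om0)).
    { transitivity (om * (al0 * om0) - om0 * (om * (al0 - d))); [rewrite Hao, Eom; ring|ring]. }
    assert (P : 0 < om * om0) by now apply Rmult_lt_0_compat.
    assert (om <= 2 * om0).
    { apply Rmult_le_reg_r with (al0 - d); [lra|]. rewrite Eom.
      apply Rle_trans with (2 * om0 * (al0 / 2)); [lra|]. apply Rmult_le_compat_l; lra. }
    assert (om * om0 <= 2 * (om0 * om0)) by nra.
    assert (0 < d * (om * om0)) by (apply Rmult_lt_0_compat; lra).
    assert (d * (om * om0) <= d * (2 * (om0 * om0))) by (apply Rmult_le_compat_l; lra).
    lra. }
  assert (Neg1 : defect s x (al0 - d) b0 c1 < 0).
  { specialize (C5 (al0 - d) b0 c1). rewrite !Rminus_diag, Rabs_R0 in C5.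
    replace (al0 - d - al0) with (- d) in C5 by ring. rewrite Rabs_Ropp, Rabs_pos_eq in C5 by lra.
    specialize (C5 ltac:(lra)). apply Rabs_lt_between in C5. lra. }
  assert (Pos0 := P1 d ltac:(lra)).
  (* Opposite signs at c0 and c1 for the same om > om0: the curve meets the axis in between, inside
     the neighborhood that should be free of such points. *)
  destruct (IVT_gen (fun c => defect s x (al0 - d) b0 c) c0 c1 0 (defect_continuity_c s x (al0 - d) b0)) as [c2 [Hc2 Ec2]].
  { rewrite Rmin_right, Rmax_left by lra. lra. }
  assert (Hc2' : Rabs (c2 - c0) < r4).
  { revert Hc2 Hc1. unfold Rmin, Rmax, Rabs. repeat destruct Rle_dec; repeat destruct Rcase_abs; lra. }
  apply (Hmv om ltac:(lra) (b0 * om) (c2 * om)).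
  - fold b0. replace (b0 * om - b0 * om0) with ((om - om0) * b0) by ring.
    rewrite Rabs_pos_eq by (apply Rmult_le_pos; lra).
    apply Rlt_le_trans with (bd * b0); [apply Rmult_lt_compat_r; lra|lra].
  - fold c0. replace (c2 * om - c0 * om0) with ((c2 - c0) * om + (om - om0) * c0) by ring.
    eapply Rle_lt_trans; [apply Rabs_triang|].
    rewrite (Rabs_mult (c2 - c0)), (Rabs_pos_eq om) by lra.
    rewrite (Rabs_pos_eq ((om - om0) * c0)) by (apply Rmult_le_pos; lra).
    assert (Rabs (c2 - c0) * om <= r4 * (2 * om0)) by (apply Rmult_le_compat; [apply Rabs_pos|lra|lra|lra]).
    assert ((om - om0) * c0 < bd * c0) by (apply Rmult_lt_compat_r; lra).
    lra.
  - split; [|reflexivity].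
    apply (bdry_sgn_iff om _ _ s sg Homp).
    replace (/ om) with (al0 - d) by (unfold om; now rewrite Rinv_inv).
    replace (b0 * om / om) with b0 by (field; lra).
    replace (c2 * om / om) with c2 by (field; lra).
    exact Ec2.
Qed.
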